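(* Fix $\lambda\in[0,1)$, $p\in[0,1]$ and $T>0$. Consider the sequence of $N$-station systems, $N\ge1$, with (possibly random) initial states $\mathbf{V}^N(0)\in\overline{\mathcal{V}}^\infty$. If for some $\mathbf{v}^0\in\overline{\mathcal{V}}^\infty$ we have $\lim_{N\to\infty}\mathbb{P}(\|\mathbf{V}^N(0)-\mathbf{v}^0\|_w>\gamma)=0$ for all $\gamma>0$, then $$\lim_{N\to\infty}\mathbb{P}\Big(\sup_{t\in[0,T]}\|\mathbf{V}^N(t)-\mathbf{v}(\mathbf{v}^0,t)\|_w>\gamma\Big)=0\quad\text{for all }\gamma>0,$$ where $\mathbf{v}(\mathbf{v}^0,\cdot)$ is the unique solution to the fluid model with initial condition $\mathbf{v}^0$.
   Context: The $N$-station system: station $n\in\{1,\dots,N\}$ has queue length $Q_n(t)\in\mathbb{Z}_+$, initially finite. Tasks arrive to each station according to independent Poisson processes of rate $\lambda$. Each station has an independent Poisson clock of rate $1-p$ (''local service tokens''): at a tick, if $Q_n>0$ one task leaves station $n$, otherwise nothing happens. An independent central Poisson clock of rate $Np$ (''central service tokens''): at a tick, if $\sum_nQ_n>0$ one task leaves a station chosen uniformly at random among the stations with a longest queue, otherwise nothing happens. Let $\mathbf{S}^N_i(t)=\frac1N\sum_{n=1}^N\mathbb{I}\{Q_n(t)\ge i\}$ and $\mathbf{V}^N_i(t)=\sum_{j\ge i}\mathbf{S}^N_j(t)$, $i\ge0$. Sets: $\mathcal{S}=\{\mathbf{s}\in[0,1]^{\mathbb{Z}_+}:1=\mathbf{s}_0\ge\mathbf{s}_1\ge\cdots\ge0\}$,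 $\overline{\mathcal{S}}^\infty=\{\mathbf{s}\in\mathcal{S}:\sum_{i\ge1}\mathbf{s}_i<\infty\}$, $\overline{\mathcal{V}}^\infty=\{\mathbf{v}:\mathbf{v}_i=\sum_{j\ge i}\mathbf{s}_j\ \forall i,\text{ for some }\mathbf{s}\in\overline{\mathcal{S}}^\infty\}$; $\|\mathbf{x}\|_w^2=\sum_{i\ge0}2^{-i}\mathbf{x}_i^2$. Fluid model: $g_i(\mathbf{v})=p$ if $\mathbf{v}_i>0$, $=\min\{\lambda\mathbf{v}_{i-1},p\}$ if $\mathbf{v}_i=0<\mathbf{v}_{i-1}$, $=0$ if $\mathbf{v}_i=\mathbf{v}_{i-1}=0$. A solution with initial condition $\mathbf{v}^0$ is $\mathbf{v}:[0,\infty)\to\overline{\mathcal{V}}^\infty$ with (0) all coordinates $L$-Lipschitz for a common $L$; (1) $\mathbf{v}(0)=\mathbf{v}^0$; (2) for all $t$, $\mathbf{v}_0-\mathbf{v}_1=1$ and $1\ge\mathbf{v}_i-\mathbf{v}_{i+1}\ge\mathbf{v}_{i+1}-\mathbf{v}_{i+2}\ge0$, $i\ge0$; (3) for a.e. $t$ and all $i\ge1$, $\dot{\mathbf{v}}_i=\lambda(\mathbf{v}_{i-1}-\mathbf{v}_i)-(1-p)(\mathbf{v}_i-\mathbf{v}_{i+1})-g_i(\mathbf{v})$. It exists and is unique for every $\mathbf{v}^0\in\overline{\mathcal{V}}^\infty$. *)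

(* Defs.v *)
From HB Require Import structures.
From mathcomp Require Import all_boot all_order all_algebra.
From mathcomp Require Import all_classical all_reals all_analysis.

Set Implicit Arguments.
Unset Strict Implicit.
Unset Printing Implicit Defensive.

Import Order.TTheory GRing.Theory Num.Theory.
Import numFieldNormedType.Exports.

Local Open Scope classical_set_scope.
Local Open Scope ring_scope.

Section Defs.
Variable R : realType.

Definition tail_sum (x : nat -> R) (i : nat) : R :=
  \big[+%R/0%R]_(i <= j <oo) x j.

Definition in_S (s : nat -> R) : Prop :=
  s 0%N = 1 /\ (forall i, 0 <= s i <= 1) /\ (forall i, s i.+1 <= s i).

Definition in_Sbar (s : nat -> R) : Prop :=
  in_S s /\ cvgn (series (fun i => s i.+1)).

Definition in_Vbar (v : nat -> R) : Prop :=
  exists s, in_Sbar s /\ forall i, v i = tail_sum s i.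

Definition norm_w (x : nat -> R) : R :=
  Num.sqrt (\big[+%R/0%R]_(0 <= i <oo) ((2%:R)^-1 ^+ i * (x i) ^+ 2)).

Definition g_fl (lam p : R) (v : nat -> R) (i : nat) : R :=
  if 0 < v i then p
  else if (v i == 0) && (0 < v i.-1) then Num.min (lam * v i.-1) p
  else 0.

(** v : [0,oo) -> V-bar^infty is a solution of the fluid model with initial
    condition v0 (values of v at negative times are irrelevant). *)
Definition fluid_solution (lam p : R) (v0 : nat -> R) (v : R -> nat -> R) : Prop :=
  (exists L : R, forall i t s, 0 <= t -> 0 <= s ->
      `|v t i - v s i| <= L * `|t - s|) /\
  v 0 = v0 /\
  (forall t, 0 <= t ->
     in_Vbar (v t) /\ v t 0%N - v t 1%N = 1 /\
     forall i, 1 >= v t i - v t i.+1 /\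
               v t i - v t i.+1 >= v t i.+1 - v t i.+2 /\
               v t i.+1 - v t i.+2 >= 0) /\
  (exists Z : set R, (@lebesgue_measure R).-negligible Z /\
     forall t, 0 < t -> ~ Z t -> forall i, (0 < i)%N ->
       is_derive t 1 (fun s => v s i)
         (lam * (v t i.-1 - v t i) - (1 - p) * (v t i - v t i.+1)
          - g_fl lam p (v t) i)).

(** Poisson clocks of the N-station system:
    inl (inl n) = arrival clock of station n      (rate lam),
    inl (inr n) = local service clock of station n (rate 1 - p),
    inr tt      = central service clock           (rate N p). *)
Definition clock (N : nat) := ('I_N + 'I_N + unit)%type.

Definition rate (lam p : R) (N : nat) (c : clock N) : R :=
  match c with
  | inl (inl _) => lam
  | inl (inr _) => 1 - p
  | inr _ => N%:R * p
  end.

Section System.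
Variables (lam p : R) (N : nat).
(** E c k : the (k+1)-th inter-tick time of clock c, measured in units of
    1 / rate c (so E c k ~ Exp(1) i.i.d.); U k : the uniform mark used for the
    random tie-break at the (k+1)-th central tick; q0 : initial queues. *)
Variables (E : clock N -> nat -> R) (U : nat -> R) (q0 : 'I_N -> nat).

(** time of the (k+1)-th tick of clock c (a rate-0 clock never ticks) *)
Definition tick (c : clock N) (k : nat) : \bar R :=
  if 0 < rate lam p c then ((\sum_(j < k.+1) E c j) / rate lam p c)%:E
  else +oo%E.

(** station chosen uniformly at random (using the mark u in [0,1]) among the
    stations with a longest queue *)
Definition choose_longest (q : 'I_N -> nat) (u : R) : option 'I_N :=
  let L := [seq n <- enum 'I_N | [forall m, (q m <= q n)%N]] in
  let k := minn (Num.truncn (u * (size L)%:R)) (size L).-1 in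
  if L is n0 :: _ then Some (nth n0 L k) else None.

(** state: number of ticks already consumed for each clock, queue lengths *)
Definition sys_state := ((clock N -> nat) * ('I_N -> nat))%type.

Definition next_clock (st : sys_state) : clock N :=
  [arg min_(c < inr tt) tick c (st.1 c)]%O.

Definition next_time (st : sys_state) : \bar R :=
  tick (next_clock st) (st.1 (next_clock st)).

Definition decr (q : 'I_N -> nat) (n : 'I_N) : 'I_N -> nat :=
  fun m => if m == n then (q m).-1 else q m.

Definition step (st : sys_state) : sys_state :=
  let c := next_clock st in
  let cnt := st.1 in let q := st.2 in
  ((fun c' => if c' == c then (cnt c).+1 else cnt c'),
   match c with
   | inl (inl n) => fun m => if m == n then (q m).+1 else q m
   | inl (inr n) => decr q n
   | inr _ =>
       if (0 < \sum_(m < N) q m)%N then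
         match choose_longest q (U (cnt c)) with
         | Some n => decr q n
         | None => q
         end
       else q
   end).

Definition event_state (k : nat) : sys_state := iter k step (fun _ => 0%N, q0).

Definition event_time (k : nat) : \bar R := next_time (event_state k).

Definition n_events (t : R) : nat :=
  xget 0%N [set k | (forall j, (j < k)%N -> (event_time j <= t%:E)%E) /\
                    (t%:E < event_time k)%E].

Definition Q (t : R) : 'I_N -> nat := (event_state (n_events t)).2.

End System.

Definition S_of (N : nat) (q : 'I_N -> nat) (i : nat) : R :=
  #|[set n : 'I_N | (i <= q n)%N]|%:R / N%:R.

Definition V_of (N : nat) (q : 'I_N -> nat) (i : nat) : R :=
  tail_sum (S_of q) i.

Definition mutually_independent d (Om : measurableType d) (P : probability Om R)
    (I : Type) (F : I -> set (set Om)) : Prop :=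
  forall (m : nat) (J : nat -> I) (A : nat -> set Om),
    (forall a b, (a < m)%N -> (b < m)%N -> J a = J b -> a = b) ->
    (forall a, (a < m)%N -> F (J a) (A a)) ->
    fine (P (\bigcap_(a in [set a | (a < m)%N]) A a)) =
      \prod_(a < m) fine (P (A a)).

Inductive source (N : nat) := SrcQ0 | SrcE of clock N & nat | SrcU of nat.

(** The random inputs of the N-station system on the probability space
    (Om, P): initial state Q0, i.i.d. Exp(1) inter-tick variables E (so that
    each clock of positive rate r is a Poisson process of rate r), i.i.d.
    uniform[0,1] tie-break marks U, all mutually independent. *)
Definition system_inputs d (Om : measurableType d) (P : probability Om R)
    (N : nat) (Q0 : Om -> 'I_N -> nat) (E : clock N -> nat -> Om -> R)
    (U : nat -> Om -> R) : Prop :=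
  (forall q, measurable (Q0 @^-1` [set q])) /\
  (forall c k, measurable_fun setT (E c k) /\
     forall A, measurable A -> P (E c k @^-1` A) = exponential_prob 1 A) /\
  (forall k, measurable_fun setT (U k) /\
     forall A, measurable A -> P (U k @^-1` A) = @uniform_prob R 0 1 ltr01 A) /\
  mutually_independent P
    (fun s : source N => match s with
     | SrcQ0 => [set Q0 @^-1` B | B in [set: set ('I_N -> nat)]]
     | SrcE c k => [set E c k @^-1` B | B in [set B : set R | measurable B]]
     | SrcU k => [set U k @^-1` B | B in [set B : set R | measurable B]]
     end).

End Defs.

(* Main.v *)
(** Each coordinate [V_i] of the [N]-station system is a compensated path plus a
    martingale divided by [N].  The martingale has variance of order [N] (the
    increments of the event chain are uncorrelated because, for an Exp(1) input,
    [f' - f] has mean zero whenever [f] vanishes at the origin), so Chebyshev's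
    inequality on a fine time grid makes it uniformly small, the oscillation
    between grid points being bounded by the event count, itself such a path.
    The compensated path solves the fluid equations up to a small error, with
    [p * 1{V_i > 0}] in place of [g_i].  This substitution is harmless: where the
    two differ, [v_i = 0 < V_i] or [V_i = 0] with the sign of the difference
    pulling the two solutions together.  Hence the weighted distance to the fluid
    solution obeys a Gronwall inequality, where the null set of times at which
    the fluid equation fails is absorbed by the Lipschitz property. *)
Require Import Defs.
From HB Require Import structures.
From mathcomp Require Import all_boot all_order all_algebra.
From mathcomp Require Import all_classical all_reals all_analysis.
From mathcomp Require Import measurable_realfun.
From mathcomp Require Import zify ring lra.

Set Implicit Arguments.
Unset Strict Implicit.
Unset Printing Implicit Defensive.

Import Order.TTheory GRing.Theory Num.Theory.
Import numFieldNormedType.Exports.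
Local Open Scope classical_set_scope.
Local Open Scope ring_scope.

(** * Stability of the fluid equation *)

(** No filtration or conditional expectation is set up. The increment at event [k] is split
    according to the number [l] of ticks that a clock has already consumed. On each piece the past
    depends on the [l]-th input of that clock only through the event that it exceeds a threshold
    determined by the other inputs. With the others frozen, integrating over this single Exp(1)
    variable gives zero, and Fubini concludes. The threshold and the past are read off a chain in
    which the clock never rings again from index [l] on. The martingales are indexed by a number of
    events, with time truncated at [t] inside each term. Every random variable is therefore bounded
    and no stopping theorem is involved. Taking a number of events proportional to [N], the same
    second moment estimate for the counting martingale shows that these events are not exhausted
    before [T], which rules out explosion. A second moment of order [N] against the squared
    threshold [(N * alpha) ^ 2] leaves a failure probability of order [1 / N]. *)

Lemma le_lebesgue_measure (R : realType) (A B : set R) :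
  measurable A -> measurable B -> A `<=` B ->
  (lebesgue_measure A <= lebesgue_measure B)%E.
Proof. by move=> mA mB AB; apply: le_measure => //; rewrite inE. Qed.

Lemma lebesgue_measureU (R : realType) (A B : set R) :
  measurable A -> measurable B -> A `&` B = set0 ->
  (lebesgue_measure (A `|` B) = lebesgue_measure A + lebesgue_measure B)%E.
Proof. by move=> mA mB AB; exact: measureU. Qed.

Lemma negligible_open_cover (R : realType) (Z : set R) (eps : R) :
  (@lebesgue_measure R).-negligible Z -> 0 < eps ->
  exists O : set R, [/\ open O, Z `<=` O & (lebesgue_measure O < eps%:E)%E].
Proof.
move=> [B [mB B0 ZB]] e0.
have [|O [oO BO Oe]] := @lebesgue_regularity_outer R B eps mB _ e0.
  by rewrite [X in (X < _)%E](B0 : _ = 0%E) ltry.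
exists O; split => //; first exact: subset_trans BO.
have mO : measurable O by exact: open_measurable.
rewrite -(setDUK BO); apply: (le_lt_trans (measureU2 _ _ _)) => //.
  exact: measurableD.
by rewrite [X in (X + _)%E](B0 : _ = 0%E) add0e.
Qed.

(* Off [Z] the one-step bound is the hypothesis; on [Z] it is paid for by the
   Lipschitz constant times the measure of a small open set covering [Z]. *)
Lemma lipschitz_dini_le (R : realType) (f : R -> R) (a b L : R) (Z : set R) :
  a <= b -> 0 <= L -> (@lebesgue_measure R).-negligible Z ->
  (forall s t, a <= s -> s <= t -> t <= b -> f t - f s <= L * (t - s)) ->
  (forall t (eta : R), a <= t -> t < b -> ~ Z t -> 0 < eta ->
     exists t', [/\ t < t', t' <= b & f t' - f t <= eta * (t' - t)]) ->
  f b <= f a.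
Proof.
move=> ab L0 Zn fL fD.
suff H (eta eps : R) : 0 < eta -> 0 < eps -> f b - f a <= L * eps + eta * (b - a).
  rewrite -subr_le0; apply/ler_addgt0Pr => e e0; rewrite add0r.
  have c0 : 0 < L + (b - a) + 1 by lra.
  have := H (e / (L + (b - a) + 1)) (e / (L + (b - a) + 1)).
  rewrite !divr_gt0// => /(_ isT isT) /le_trans; apply.
  rewrite (_ : _ + _ = (e * (L + (b - a))) / (L + (b - a) + 1)); last by ring.
  by rewrite ler_pdivrMr// ler_wpM2l ?(ltW e0)//; lra.
move=> eta0 eps0.
have [ O [oO ZO Oe]] := @negligible_open_cover R Z eps Zn eps0.
have mO : measurable O by exact: open_measurable.
pose I t := O `&` `[a, t]%classic.
have mI t : measurable (I t) by apply: measurableI.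
have Ifin t : lebesgue_measure (I t) \is a fin_num.
  rewrite ge0_fin_numE//; apply: (@le_lt_trans _ _ (lebesgue_measure O)).
    by apply: le_lebesgue_measure => //; exact: subIsetl.
  by rewrite (lt_trans Oe)// ltry.
pose m t := fine (lebesgue_measure (I t)).
have mle s t : s <= t -> m s <= m t.
  move=> st; rewrite /m fine_le//; apply: le_lebesgue_measure => //.
  apply: setIS => x /=; rewrite !in_itv/= => /andP[-> xs].
  exact: le_trans xs st.
have mb t : m t <= eps.
  rewrite -lee_fin fineK//; apply: le_trans (ltW Oe).
  by apply: le_lebesgue_measure => //; exact: subIsetl.
have m0 t : 0 <= m t by rewrite fine_ge0.
have mstep s t : a <= s -> s < t -> `[s, t]%classic `<=` O -> t - s <= m t - m s.
  move=> as_ st stO.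
  have sub : I s `|` `]s, t]%classic `<=` I t.
    move=> x [[Ox]|] /=; rewrite !in_itv/=; move=> /andP[h1 h2].
      by split => //=; rewrite in_itv/= h1 (le_trans h2)// ltW.
    split; first by apply: stO; rewrite /= in_itv/= h2 ltW.
    by rewrite /= in_itv/= h2 (le_trans as_)// ltW.
  have dis : I s `&` `]s, t]%classic = set0.
    rewrite -subset0 => x /= [[_]] /=; rewrite !in_itv/= => /andP[_ xs] /andP[sx _].
    by have := lt_le_trans sx xs; rewrite ltxx.
  have : (lebesgue_measure (I s `|` `]s, t]%classic) <= lebesgue_measure (I t))%E.
    by apply: le_lebesgue_measure => //; exact: measurableU.
  rewrite lebesgue_measureU//.
  rewrite lebesgue_measure_itv/= lte_fin st -(fineK (Ifin s)) -(fineK (Ifin t)).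
  by rewrite -!EFinD lee_fin -/(m s) -/(m t); lra.
(* Real induction: the supremum [s] of the times where [phi <= 0] satisfies the bound too, and
   [s < b] is refuted by a strictly later time at which [phi] has not increased. *)
pose phi t := f t - f a - L * m t - eta * (t - a).
pose S := [set t | a <= t <= b /\ phi t <= 0].
have Sa : S a.
  split; first by rewrite lexx.
  by rewrite /phi !subrr mulr0 subr0 sub0r oppr_le0 mulr_ge0.
have Ssup : has_sup S.
  by split; [exists a | exists b => x [/andP[]]].
pose s := sup S.
have as_ : a <= s by apply: sup_upper_bound.
have sb : s <= b by apply: ge_sup => [|x [/andP[]]//]; exists a.
have phis : phi s <= 0.
  apply/ler_addgt0Pr => e e0; rewrite add0r.
  have e'0 : 0 < e / (L + 1) by rewrite divr_gt0// ltr_wpDl.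
  have [t St ts] := sup_adherent e'0 Ssup.
  have tles : t <= s by exact: sup_upper_bound.
  have [/andP[at_ tb] pt] := St.
  have h1 := fL t s at_ tles sb.
  have h2 := ler_wpM2l L0 (mle _ _ tles).
  have h3 : eta * (t - a) <= eta * (s - a) by rewrite ler_pM2l// lerB.
  have h4 : L * (s - t) <= e.
    apply: (@le_trans _ _ (L * (e / (L + 1)))).
      by apply: ler_wpM2l => //; rewrite -/s in ts; lra.
    by rewrite mulrCA ler_piMr ?(ltW e0)// ler_pdivrMr ?mul1r; lra.
  rewrite /phi in pt *; lra.
have [sb'|bs] := ltP s b; last first.
  have sE : s = b by apply/eqP; rewrite eq_le sb bs.
  move: phis; rewrite sE /phi => h.
  have := ler_wpM2l L0 (mb b); lra.
have contra t' : s < t' -> t' <= b -> ~ phi t' <= phi s.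
  move=> st' t'b h.
  have : t' <= s.
    apply: sup_upper_bound => //; split; last exact: le_trans h phis.
    by rewrite t'b (le_trans as_)// ltW.
  by rewrite leNgt st'.
exfalso.
have [Zs|nZs] := pselect (Z s).
  have Os : O s by exact: ZO.
  have /nbhs_ballP[d /= d0 dO] : nbhs s O by exact: open_nbhs_nbhs.
  pose t' := Num.min b (s + d / 2).
  have st' : s < t' by rewrite lt_min sb'/= ltrDl divr_gt0.
  have t'b : t' <= b by rewrite ge_min lexx.
  apply: (contra t' st' t'b).
  have sub : `[s, t']%classic `<=` O.
    move=> x; rewrite /= in_itv/= => /andP[sx xt]; apply: dO.
    rewrite /ball/= ler0_norm ?subr_le0// opprB.
    have : x <= s + d / 2 by rewrite (le_trans xt)// /t' ge_min lexx orbT.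
    lra.
  have h1 := mstep s t' as_ st' sub.
  have h2 := fL s t' as_ (ltW st') t'b.
  have h3 := ler_wpM2l L0 h1.
  have h4 : eta * (s - a) <= eta * (t' - a) by rewrite ler_pM2l// lerB// ltW.
  by rewrite /phi; lra.
have [t' [st' t'b h]] := fD s eta as_ sb' nZs eta0.
apply: (contra t' st' t'b).
have := ler_wpM2l L0 (mle _ _ (ltW st')).
by rewrite /phi; lra.
Qed.

Lemma is_derive_le0_step (R : realType) (F : R -> R) (t l eta : R) :
  is_derive t 1 F l -> l <= 0 -> 0 < eta ->
  exists2 del, 0 < del &
    forall s, t < s -> s < t + del -> F s - F t <= eta * (s - t).
Proof.
move=> [dF Fl] l0 eta0.
have := dF; rewrite /derivable => /cvg_ex[/= l' cl'].
have l'E : l' = l by rewrite -Fl /derive; apply/esym/cvg_lim.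
move: cl'; rewrite l'E => /cvgrPdist_lt /(_ _ eta0) [del /= del0 H].
exists del => // s ts sd.
have := H (s - t); rewrite /ball_/= sub0r normrN gtr0_norm ?subr_gt0//.
have st0 : s - t != 0 by rewrite subr_eq0 gt_eqF.
rewrite ltrBlDl => /(_ sd st0); rewrite /GRing.scale/= mulr1 subrK => h.
have : (s - t)^-1 * (F s - F t) - l < eta.
  by apply: le_lt_trans h; rewrite distrC ler_norm.
have st : 0 < s - t by rewrite subr_gt0.
have e : F s - F t = (s - t) * ((s - t)^-1 * (F s - F t)).
  by rewrite mulrA divff// mul1r.
move=> h2; rewrite e mulrC ler_pM2r//.
by apply: ltW; lra.
Qed.

(** * Shifts of geometrically weighted sums and the drift estimate *)

Section WeightedShift.
Variables (R : realType) (a : nat -> R).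
Hypothesis a0 : forall i, 0 <= a i.
Let w i : R := 2^-1 ^+ i.

(** The shift halves the weights, which costs half of the sum. The term at index 0 has no
    counterpart on the right; it becomes [a 1] by hypothesis and costs at most one full sum. *)
Lemma weighted_shift_down I : a 0%N = a 1%N ->
  \sum_(i < I) w i.+1 * a i <= 3 / 2 * \sum_(i < I) w i.+1 * a i.+1.
Proof.
have w0 i : 0 <= w i by rewrite exprn_ge0.
have wa i j : 0 <= w i * a j by rewrite mulr_ge0.
have S0 J : 0 <= \sum_(i < J) w i.+1 * a i.+1 by apply: sumr_ge0.
case: I => [|I] a01; first by rewrite !big_ord0 mulr0.
have -> : \sum_(i < I.+1) w i.+1 * a i =
    w 1%N * a 1%N + 2^-1 * \sum_(i < I) w i.+1 * a i.+1.
  rewrite big_ord_recl/= a01; congr (_ + _); rewrite mulr_sumr.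
  by apply: eq_bigr => i _; rewrite /w [in LHS]exprS mulrA.
have h1 : w 1%N * a 1%N <= \sum_(i < I.+1) w i.+1 * a i.+1.
  by rewrite big_ord_recl/= lerDl; apply: sumr_ge0.
have h2 : \sum_(i < I) w i.+1 * a i.+1 <= \sum_(i < I.+1) w i.+1 * a i.+1.
  by rewrite big_ord_recr/= lerDl.
lra.
Qed.

(** The shift doubles the weights. The last term leaves the truncated range and stays as a boundary
    term, made small later by the choice of [I]. *)
Lemma weighted_shift_up I :
  \sum_(i < I) w i.+1 * a i.+2 <=
  2 * (\sum_(i < I) w i.+1 * a i.+1) + w I * a I.+1.
Proof.
elim: I => [|I IH]; first by rewrite !big_ord0 mulr0 add0r mulr_ge0// exprn_ge0.
rewrite !big_ord_recr/=.
have -> : w I.+1 = w I / 2 by rewrite /w exprS mulrC.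
lra.
Qed.

End WeightedShift.

Lemma sum_half_powers_le1 (R : realType) I :
  \sum_(i < I) (2^-1 : R) ^+ i.+1 <= 1.
Proof.
suff -> : \sum_(i < I) (2^-1 : R) ^+ i.+1 = 1 - 2^-1 ^+ I.
  by rewrite lerBlDr lerDl exprn_ge0.
elim: I => [|I IH]; first by rewrite big_ord0 expr0 subrr.
by rewrite big_ord_recr/= IH !exprS; field.
Qed.

(** The mean velocity of [V_i] in the finite system; see [hrate_jump]. *)
Definition drift (R : realType) (lam p : R) (u : nat -> R) (i : nat) : R :=
  lam * (u i.-1 - u i) - (1 - p) * (u i - u i.+1) - (if 0 < u i then p else 0).

(** A truncation of the squared weighted norm: a finite sum can be differentiated term by term and
    requires only finitely many martingales to be small. Coordinate 0 is left out, its difference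
    being that of coordinate 1. *)
Definition wdist2 (R : realType) (I : nat) (x y : nat -> R) : R :=
  \sum_(i < I) 2^-1 ^+ i.+1 * (x i.+1 - y i.+1) ^+ 2.

Lemma wdist2_ge0 (R : realType) I (x y : nat -> R) : 0 <= wdist2 I x y.
Proof. by apply: sumr_ge0 => i _; rewrite mulr_ge0 ?sqr_ge0 ?exprn_ge0. Qed.

Section DriftBound.
Variables (R : realType) (lam p B eps : R) (u v x : nat -> R) (I : nat).
Hypothesis lam01 : 0 <= lam <= 1.
Hypothesis p01 : 0 <= p <= 1.
Hypothesis uB : forall i, 0 <= u i <= B.
Hypothesis vB : forall i, 0 <= v i <= B.
Hypothesis u01 : u 0%N = u 1%N + 1.
Hypothesis v01 : v 0%N = v 1%N + 1.
Hypothesis eps0 : 0 <= eps.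
Hypothesis uxeps : forall i, (i < I)%N -> `|u i.+1 - x i.+1| <= eps.

(* The key monotonicity is [(u i - v i) * (central_u - g_i v) >= 0]: wherever
   the two central service terms differ, the sign of [u i - v i] is known. *)
Lemma drift_gap_step i : (i < I)%N ->
  2 * (x i.+1 - v i.+1) *
    (drift lam p u i.+1 -
     (lam * (v i - v i.+1) - (1 - p) * (v i.+1 - v i.+2) - g_fl lam p v i.+1))
  <= 4 * (x i.+1 - v i.+1) ^+ 2 +
     ((u i - v i) ^+ 2 + 2 * (u i.+1 - v i.+1) ^+ 2 + (u i.+2 - v i.+2) ^+ 2) +
     2 * eps.
Proof.
move=> iI; rewrite /drift /=.
set cu := if _ then p else 0.
set gv := g_fl _ _ _ _.
have [l0 l1] := andP lam01; have [p0 p1] := andP p01.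
have /andP[v0 _] := vB i; have /andP[v1 _] := vB i.+1.
have /andP[u1 _] := uB i.+1.
have gb : 0 <= gv <= p.
  rewrite /gv /g_fl; case: ifP => _; first by rewrite p0 lexx.
  case: ifP => _; last by rewrite lexx p0.
  by rewrite le_min p0 ge_min lexx orbT !andbT mulr_ge0.
have cb : 0 <= cu <= p by rewrite /cu; case: ifP; rewrite ?lexx ?p0.
have mono : 0 <= (u i.+1 - v i.+1) * (cu - gv).
  rewrite /cu; case: ltP => hu.
    have [hv|hv] := ltP 0 (v i.+1).
      by rewrite /gv /g_fl hv subrr mulr0.
    by apply: mulr_ge0; rewrite subr_ge0; [exact: le_trans hv (ltW hu)|case/andP: gb].
  have -> : u i.+1 = 0 by apply/eqP; rewrite eq_le hu u1.
  by rewrite !sub0r mulrNN mulr_ge0//; case/andP: gb.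
have h : 0 <= 2 * eps + 2 * (x i.+1 - v i.+1) * (cu - gv).
  have e1 : `|(u i.+1 - x i.+1) * (cu - gv)| <= eps.
    rewrite normrM -[leRHS]mulr1 ler_pM ?uxeps//.
    by rewrite ler_norml; case/andP: gb => ? ?; case/andP: cb => ? ?; apply/andP; split; lra.
  have := ler_norm ((u i.+1 - x i.+1) * (cu - gv)).
  rewrite [X in X <= _ -> _](_ : _ = (u i.+1 - v i.+1) * (cu - gv) - (x i.+1 - v i.+1) * (cu - gv)); last by ring.
  lra.
set e := x i.+1 - v i.+1 in h *.
set a := u i - v i; set b := u i.+1 - v i.+1; set c := u i.+2 - v i.+2.
have ab (y z k : R) : 0 <= k <= 1 -> 2 * y * (k * z) <= y ^+ 2 + z ^+ 2.
  move=> /andP[k0 k1].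
  apply: (@le_trans _ _ (k * (y ^+ 2 + z ^+ 2))).
    rewrite (_ : _ * _ = k * (2 * y * z)); last by ring.
    apply: ler_wpM2l => //; rewrite -subr_ge0.
    by rewrite (_ : _ - _ = (y - z) ^+ 2) ?sqr_ge0//; ring.
  by rewrite ler_piMl// addr_ge0 ?sqr_ge0.
have a1 := ab e a lam lam01.
have a2 := ab e (- b) lam lam01.
have q01 : 0 <= 1 - p <= 1 by apply/andP; split; lra.
have a3 := ab e (- b) (1 - p) q01.
have a4 := ab e c (1 - p) q01.
rewrite sqrrN in a2 a3.
rewrite [leLHS](_ : _ = 2 * e * (lam * a) + 2 * e * (lam * (- b)) +
   2 * e * ((1 - p) * (- b)) + 2 * e * ((1 - p) * c) - 2 * e * (cu - gv)).
  by lra.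
by rewrite /a /b /c; ring.
Qed.

(** The three neighbouring squares contribute [3 / 2 + 2 + 2 = 11 / 2] copies of the distance from
    [u] to [v]. Each copy is at most twice that from [x] to [v] plus [2 * eps ^ 2], whence the 11;
    adding the 4 of the one-coordinate bound gives 15. *)
Lemma drift_gap_sum :
  \sum_(i < I) 2^-1 ^+ i.+1 * (2 * (x i.+1 - v i.+1) *
    (drift lam p u i.+1 -
     (lam * (v i - v i.+1) - (1 - p) * (v i.+1 - v i.+2) - g_fl lam p v i.+1)))
  <= 15 * wdist2 I x v + (11 * eps ^+ 2 + 2 * eps + 2^-1 ^+ I * B ^+ 2).
Proof.
pose a i := (u i - v i) ^+ 2.
have a0 i : 0 <= a i by exact: sqr_ge0.
have a01 : a 0%N = a 1%N by rewrite /a u01 v01; congr (_ ^+ 2); ring.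
have w0 i : 0 <= (2^-1 : R) ^+ i by rewrite exprn_ge0.
have D := weighted_shift_down a0 I a01.
have Up := weighted_shift_up a0 I.
have aB : (2^-1 : R) ^+ I * a I.+1 <= 2^-1 ^+ I * B ^+ 2.
  apply: ler_wpM2l => //; rewrite /a -(real_normK (num_real (u _ - _))).
  have /andP[? ?] := uB I.+1; have /andP[? ?] := vB I.+1.
  rewrite ler_pXn2r// ?nnegrE ?normr_ge0//; last by lra.
  by rewrite ler_norml; apply/andP; split; lra.
have S : \sum_(i < I) 2^-1 ^+ i.+1 * a i.+1 <= 2 * wdist2 I x v + 2 * eps ^+ 2.
  apply: (@le_trans _ _ (\sum_(i < I) (2 * (2^-1 ^+ i.+1 * (x i.+1 - v i.+1) ^+ 2) +
                                  2 * eps ^+ 2 * 2^-1 ^+ i.+1))).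
    apply: ler_sum => i _.
    rewrite (_ : _ + _ = 2^-1 ^+ i.+1 * (2 * (x i.+1 - v i.+1) ^+ 2 + 2 * eps ^+ 2)); last by ring.
    apply: ler_wpM2l => //; rewrite /a.
    have : (u i.+1 - x i.+1) ^+ 2 <= eps ^+ 2.
      by rewrite -(real_normK (num_real (u _ - _))) ler_pXn2r ?nnegrE ?normr_ge0 ?uxeps.
    have := sqr_ge0 ((u i.+1 - x i.+1) - (x i.+1 - v i.+1)).
    nra.
  rewrite big_split/= -!mulr_sumr lerD2l; apply: ler_piMr.
    by rewrite mulr_ge0 ?sqr_ge0.
  exact: sum_half_powers_le1.
apply: (@le_trans _ _ (\sum_(i < I) (4 * (2^-1 ^+ i.+1 * (x i.+1 - v i.+1) ^+ 2) +
   (2^-1 ^+ i.+1 * a i + 2 * (2^-1 ^+ i.+1 * a i.+1) + 2^-1 ^+ i.+1 * a i.+2) +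
   2 * eps * 2^-1 ^+ i.+1))).
  apply: ler_sum => i _.
  rewrite (_ : _ + _ = 2^-1 ^+ i.+1 * (4 * (x i.+1 - v i.+1) ^+ 2 +
     (a i + 2 * a i.+1 + a i.+2) + 2 * eps)); last by ring.
  by apply: ler_wpM2l => //; exact: drift_gap_step.
rewrite !big_split/= -!mulr_sumr -/(wdist2 I x v).
have : 2 * eps * \sum_(i < I) (2^-1 : R) ^+ i.+1 <= 2 * eps.
  by apply: ler_piMr; [rewrite mulr_ge0|exact: sum_half_powers_le1].
have := sqr_ge0 eps.
lra.
Qed.

End DriftBound.

Section Stability.
Variables (R : realType) (lam p T B eps Lx Lv : R) (u v x : R -> nat -> R).
Variables (I : nat) (Z : set R).
Hypothesis lam01 : 0 <= lam <= 1.
Hypothesis p01 : 0 <= p <= 1.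
Hypothesis T0 : 0 <= T.
Hypothesis uB : forall (t : R) i, 0 <= t <= T -> 0 <= u t i <= B.
Hypothesis vB : forall (t : R) i, 0 <= t <= T -> 0 <= v t i <= B.
Hypothesis u01 : forall t : R, 0 <= t <= T -> u t 0%N = u t 1%N + 1.
Hypothesis v01 : forall t : R, 0 <= t <= T -> v t 0%N = v t 1%N + 1.
Hypothesis eps0 : 0 <= eps.
Hypothesis uxeps : forall (t : R) i, 0 <= t <= T -> (i < I)%N ->
  `|u t i.+1 - x t i.+1| <= eps.
Hypothesis xL : forall (s t : R) i, 0 <= s -> s <= t -> t <= T ->
  `|x t i.+1 - x s i.+1| <= Lx * (t - s).
Hypothesis vL : forall (s t : R) i, 0 <= s -> s <= t -> t <= T ->
  `|v t i - v s i| <= Lv * (t - s).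
Hypothesis xD : forall (t : R) i, 0 <= t -> t < T -> exists2 del : R, 0 < del &
  forall s : R, t <= s -> s < t + del -> s <= T ->
    x s i.+1 = x t i.+1 + drift lam p (u t) i.+1 * (s - t).
Hypothesis Zn : (@lebesgue_measure R).-negligible Z.
Hypothesis vD : forall t : R, 0 < t -> ~ Z t -> forall i, (0 < i)%N ->
  is_derive t 1 (fun s => v s i)
    (lam * (v t i.-1 - v t i) - (1 - p) * (v t i - v t i.+1)
     - g_fl lam p (v t) i).

Let K := 11 * eps ^+ 2 + 2 * eps + 2^-1 ^+ I * B ^+ 2.
Let C : R := 15.

Let xv_bound (t : R) i : 0 <= t <= T -> (i < I)%N -> `|x t i.+1 - v t i.+1| <= B + eps.
Proof.
move=> tT iI; have := uxeps tT iI; have := uB i.+1 tT; have := vB i.+1 tT.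
rewrite !ler_norml => /andP[? ?] /andP[? ?] /andP[? ?].
by apply/andP; split; lra.
Qed.

Let K0 : 0 <= K.
Proof.
have h1 : 0 <= (2^-1 : R) ^+ I * B ^+ 2 by rewrite mulr_ge0 ?sqr_ge0// exprn_ge0.
by apply: addr_ge0 => //; rewrite addr_ge0// mulr_ge0// sqr_ge0.
Qed.

Let wdist2_lip (s t : R) : 0 <= s -> s <= t -> t <= T ->
  wdist2 I (x t) (v t) - wdist2 I (x s) (v s) <=
  I%:R * (2 * (B + eps) * (Lx + Lv)) * (t - s).
Proof.
move=> s0 st tT; rewrite /wdist2 -sumrB -mulrA -[in leRHS](card_ord I).
rewrite -sum1_card natr_sum mulr_suml; apply: ler_sum => i _; rewrite mul1r.
have tI : 0 <= t <= T by rewrite tT (le_trans s0).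
have sI : 0 <= s <= T by rewrite s0 (le_trans st).
have b1 := xv_bound tI (ltn_ord i); have b2 := xv_bound sI (ltn_ord i).
have l1 := xL i s0 st tT; have l2 := vL i.+1 s0 st tT.
rewrite -mulrBr.
apply: (@le_trans _ _ `|(x t i.+1 - v t i.+1) ^+ 2 - (x s i.+1 - v s i.+1) ^+ 2|).
  apply: (@le_trans _ _ (2^-1 ^+ i.+1 * `|(x t i.+1 - v t i.+1) ^+ 2 - (x s i.+1 - v s i.+1) ^+ 2|)).
    by apply: ler_wpM2l; [rewrite exprn_ge0|exact: ler_norm].
  by apply: ler_piMl => //; rewrite exprn_ile1// invf_le1// ler1n.
rewrite subr_sqr normrM mulrAC.
rewrite (_ : 2 * _ * _ * _ = ((Lx + Lv) * (t - s)) * (2 * (B + eps))); last by ring.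
apply: ler_pM => //.
  rewrite (_ : _ - _ = (x t i.+1 - x s i.+1) - (v t i.+1 - v s i.+1)); last by ring.
  by apply: le_trans (ler_normB _ _) _; rewrite mulrDl lerD.
by apply: le_trans (ler_normD _ _) _; lra.
Qed.

(** The integrating factor turns the differential inequality [W' <= C * W + K] into monotonicity of
    the function [F] below, which [lipschitz_dini_le] derives from one-sided steps outside a null
    set. *)
Lemma wdist2_gronwall (t : R) : 0 <= t <= T ->
  wdist2 I (x t) (v t) <= (wdist2 I (x 0) (v 0) + K * T) * expR (C * T).
Proof.
move=> /andP[t0 tT].
pose F s := expR (- C * s) * wdist2 I (x s) (v s) - K * s.
suff : F t <= F 0.
  rewrite /F !mulr0 expR0 mul1r subr0 lerBlDr => h.
  have e0 : 0 < expR (C * t) by exact: expR_gt0.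
  have -> : wdist2 I (x t) (v t) =
      expR (C * t) * (expR (- C * t) * wdist2 I (x t) (v t)).
    by rewrite mulrA -expRD mulNr addrN expR0 mul1r.
  rewrite mulrC; apply: ler_pM; rewrite ?mulr_ge0 ?expR_ge0 ?wdist2_ge0//.
    by apply: (le_trans h); rewrite lerD2l ler_wpM2l.
  by rewrite ler_expR ler_pM2l.
have BE : 0 <= B + eps.
  have T0T : 0 <= (0 : R) <= T by rewrite lexx T0.
  by have /andP[b1 b2] := uB 0%N T0T; rewrite addr_ge0// (le_trans b1).
have [T00|Tn0] := eqVneq T 0.
  by rewrite (_ : t = 0)//; apply/eqP; rewrite eq_le t0 -[X in _ <= X]T00 tT.
have Tp : 0 < T by rewrite lt_def Tn0.
have LL : 0 <= Lx + Lv.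
  have h0 : 0 <= Lx.
    have := xL 0 (lexx 0) T0 (lexx T); rewrite subr0.
    by move/(le_trans (normr_ge0 _)); rewrite pmulr_lge0.
  have h1 : 0 <= Lv.
    have := vL 0 (lexx 0) T0 (lexx T); rewrite subr0.
    by move/(le_trans (normr_ge0 _)); rewrite pmulr_lge0.
  lra.
pose L := I%:R * (2 * (B + eps) * (Lx + Lv)).
have L0 : 0 <= L by rewrite /L !mulr_ge0.
(* The fluid equation is only given at positive times, so time 0 joins the exceptional set. *)
have ZZ : (@lebesgue_measure R).-negligible (Z `|` [set 0]).
  apply: negligibleU => //; exists [set 0]; split => //.
  exact: lebesgue_measure_set1.
apply: (@lipschitz_dini_le R F 0 t L _ t0 L0 ZZ).
  move=> r s r0 rs st.
  have sT : s <= T by exact: le_trans st tT.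
  have h := wdist2_lip r0 rs sT.
  have e1 : expR (- C * s) <= expR (- C * r).
    by rewrite ler_expR !mulNr lerN2 ler_pM2l.
  have e2 : 0 < expR (- C * s) by exact: expR_gt0.
  have e3 : expR (- C * s) <= 1.
    by rewrite -expR0 ler_expR mulNr oppr_le0 mulr_ge0// (le_trans r0).
  have w0 := wdist2_ge0 I (x r) (v r).
  have h1 : expR (- C * s) * wdist2 I (x r) (v r) <= expR (- C * r) * wdist2 I (x r) (v r).
    exact: ler_wpM2r.
  have h2 : expR (- C * s) * (wdist2 I (x s) (v s) - wdist2 I (x r) (v r)) <= L * (s - r).
    apply: (@le_trans _ _ (expR (- C * s) * (L * (s - r)))).
      by rewrite ler_pM2l.
    by apply: ler_piMl => //; rewrite mulr_ge0// subr_ge0.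
  have h3 : K * r <= K * s by apply: ler_wpM2l.
  by rewrite /F mulrBr in h2 *; lra.
move=> s eta s0 st nZ eta0.
have sT : s < T by exact: lt_le_trans st tT.
have sp : 0 < s.
  rewrite lt_def s0 andbT; apply/eqP => s00; apply: nZ; right; exact: s00.
have nZs : ~ Z s by move=> ?; apply: nZ; left.
have sI : 0 <= s <= T by rewrite s0 ltW.
pose b i := drift lam p (u s) i.+1.
pose v' i := lam * (v s i - v s i.+1) - (1 - p) * (v s i.+1 - v s i.+2)
     - g_fl lam p (v s) i.+1.
(* The path [x] has only a right derivative at [s]. Its tangent line [xh] agrees with it on a right
   neighbourhood and makes [Fh] differentiable in the two-sided sense. *)
pose xh i := fun r => x s i.+1 + b i * (r - s).
pose fh := fun r => \sum_(i < I) 2^-1 ^+ i.+1 * (xh i r - v r i.+1) ^+ 2.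
pose Fh := fun r => expR (- C * r) * fh r - K * r.
pose l := expR (- C * s) * (\sum_(i < I) 2^-1 ^+ i.+1 *
  (2 * (x s i.+1 - v s i.+1) * (b i - v' i))) - C * expR (- C * s) * wdist2 I (x s) (v s) - K.
have xhs i : xh i s = x s i.+1 by rewrite /xh subrr mulr0 addr0.
have dF : is_derive s 1 Fh l.
  have dv i : is_derive s 1 (fun r => v r i.+1) (v' i) by exact: (vD sp nZs).
  have dxh i : is_derive s 1 (xh i) (b i).
    rewrite /xh; apply: is_derive_eq.
    by rewrite /GRing.scale/=; ring.
  have dfh : is_derive s 1 fh (\sum_(i < I) 2^-1 ^+ i.+1 *
      (2 * (x s i.+1 - v s i.+1) * (b i - v' i))).
    have -> : fh = \sum_(i < I) (fun r => 2^-1 ^+ i.+1 * (xh i r - v r i.+1) ^+ 2).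
      by apply/funext => r; rewrite fct_sumE.
    apply: is_derive_sum => i.
    apply: is_derive_eq.
    by rewrite /GRing.scale/= -xhs; ring.
  have de : is_derive s 1 (fun r => expR (- C * r)) (- C * expR (- C * s)).
    apply: is_derive_eq.
    by rewrite /GRing.scale/=; ring.
  rewrite /Fh /l; apply: is_derive_eq.
  rewrite /GRing.scale/=.
  have -> : fh s = wdist2 I (x s) (v s).
    by apply: eq_bigr => i _; rewrite xhs.
  by ring.
have l0 : l <= 0.
  have e0 : 0 < expR (- C * s) by exact: expR_gt0.
  have e3 : expR (- C * s) <= 1.
    by rewrite -expR0 ler_expR mulNr oppr_le0 mulr_ge0.
  have h : \sum_(i < I) 2^-1 ^+ i.+1 * (2 * (x s i.+1 - v s i.+1) * (b i - v' i))
      <= C * wdist2 I (x s) (v s) + K.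
    apply: (@drift_gap_sum R lam p B eps (u s) (v s) (x s) I) => //.
    - by move=> i; exact: uB.
    - by move=> i; exact: vB.
    - exact: u01.
    - exact: v01.
    - by move=> i iI; exact: uxeps.
  have h2 := ler_wpM2l (ltW e0) h.
  have h3 : expR (- C * s) * K <= K by exact: ler_piMl.
  rewrite /l; move: h2 h3; rewrite mulrDr; lra.
have [del del0 Hdel] := is_derive_le0_step dF l0 eta0.
have /choice[dd Hdd] : forall i, exists d : R, 0 < d /\ forall r : R,
    s <= r -> r < s + d -> r <= T -> x r i.+1 = xh i r.
  move=> i; have [d d0 Hd] := xD i s0 sT; by exists d; split.
pose dm := \big[Num.min/Num.min del (t - s)]_(i < I) dd i.
have dm0 : 0 < dm.
  rewrite /dm; apply: (big_ind (fun y => 0 < y)) => //.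
  - by rewrite lt_min del0 subr_gt0.
  - by move=> y z y0 z0; rewrite lt_min y0.
  - by move=> i _; have [] := Hdd i.
have dml : dm <= Num.min del (t - s) by exact: bigmin_le_id.
have [ddel dts] : dm <= del /\ dm <= t - s.
  by move: dml; rewrite le_min => /andP[].
pose t' := s + dm / 2.
have st' : s < t' by rewrite ltrDl divr_gt0.
have t't : t' <= t by rewrite /t'; lra.
exists t'; split => //.
have FE r : s <= r -> r <= t' -> F r = Fh r.
  move=> sr rt; rewrite /F /Fh; congr (_ * _ - _).
  apply: eq_bigr => i _; rewrite (Hdd i).2//.
    apply: (le_lt_trans rt); rewrite ltrD2l.
    have : dm <= dd i by rewrite /dm; exact: bigmin_le_cond.
    lra.
  exact: le_trans rt (le_trans t't tT).
rewrite !FE ?lexx ?(ltW st')//; apply: Hdel => //.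
by rewrite /t'; lra.
Qed.

End Stability.

(** * Exponential integrals *)

(* The value of [clock_term] as a function of the Exp(1) input [x] of its clock:
   [a] is the part of [x] used up at the previous event and [b] the part used up
   at the next event of the other clocks or at the time horizon. *)
Definition residual_gain (R : realType) (n : nat) (a b x : R) : R :=
  ((a < x)%R && (x < b)%R)%:R * (n.+1%:R * (x - a) ^+ n - (x - a) ^+ n.+1) -
  (b < x)%R%:R * (b - a) ^+ n.+1.

Section ExponentialIntegral.
Variable R : realType.
Local Notation mu := (@lebesgue_measure R).

(** The formula for [D] makes it dominated by Lebesgue measure, with [h] almost everywhere equal to
    the Radon-Nikodym derivative; the change of variables does the rest. *)
Lemma integral_density (D : {finite_measure set (measurableTypeR R) -> \bar R}) (h : R -> R) f :
  measurable_fun setT h -> (forall x, 0 <= h x) -> mu.-integrable setT (EFin \o h) ->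
  (forall A, measurable A -> D A = (\int[mu]_(x in A) (h x)%:E)%E) ->
  D.-integrable setT f ->
  (\int[D]_x f x = \int[mu]_x (f x * (h x)%:E))%E.
Proof.
move=> mh h0 ih DE intf.
have dom : D `<< mu.
  apply/null_content_dominatesP => A mA A0; rewrite DE//.
  by apply: null_set_integral => //; apply/measurable_EFinP; exact: measurable_funTS.
have mEh : measurable_fun setT (fun x => (h x)%:E) by exact/measurable_EFinP.
have mf : measurable_fun setT f by exact: measurable_int intf.
rewrite -(Radon_Nikodym_change_of_variables dom)//=.
apply: ae_eq_integral => //.
- exact: emeasurable_funM.
- exact: emeasurable_funM.
- apply: ae_eqe_mul2l => /=.
  rewrite Radon_NikodymE//=.
  case: cid => /= k [h1 h2 h3].
  apply: integral_ae_eq => //=.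
  by move=> A A01 mA; rewrite -h3//=; exact: DE.
Qed.

Lemma continuous_expRN : continuous (fun x : R => expR (- x)).
Proof.
move=> x; apply: (@cvg_comp _ _ _ (fun y : R => - y) (@expR R) _ (nbhs (- x))).
  by apply: cvgN; exact: cvg_id.
exact: continuous_expR.
Qed.

Lemma continuous_subX (a : R) m : continuous (fun x : R => (x - a) ^+ m).
Proof.
move=> x; apply: (@cvg_comp _ _ _ (fun y => y - a) (fun y : R => y ^+ m) _ (nbhs (x - a))).
  by apply: cvgB; [exact: cvg_id|exact: cvg_cst].
exact: exprn_continuous.
Qed.

Lemma expNx_derive (n : nat) (a x : R) :
  is_derive x 1 (fun x => (x - a) ^+ n.+1 * expR (- x))
    ((n.+1%:R * (x - a) ^+ n - (x - a) ^+ n.+1) * expR (- x)).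
Proof.
have h1 : is_derive x 1 (fun x : R => x - a) 1.
  by apply: is_derive_eq; rewrite subr0.
have h2 := @is_deriveX _ _ _ n.+1 _ _ _ h1.
have h3 : is_derive x 1 (fun x : R => expR (- x)) (- expR (- x)).
  by apply: is_derive_eq; rewrite /GRing.scale/=; ring.
have h4 := @is_deriveM _ _ _ _ _ _ _ _ h2 h3.
rewrite (_ : (fun _ => _) = (fun x => x - a) ^+ n.+1 * (fun x => expR (- x))); last first.
  by apply/funext => y; rewrite /= exprfctE.
apply: (@is_derive_eq _ _ _ _ _ _ _ _ h4).
by rewrite /GRing.scale/= exprfctE /= exprS; ring.
Qed.

Lemma expR_itv_integral (n : nat) (a b : R) : a <= b ->
  (\int[mu]_(x in `[a, b])
     ((n.+1%:R * (x - a) ^+ n - (x - a) ^+ n.+1) * expR (- x))%:E =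
   ((b - a) ^+ n.+1 * expR (- b))%:E)%E.
Proof.
rewrite le_eqVlt => /predU1P[->|ab].
  by rewrite set_itv1 integral_set1 subrr expr0n mul0r.
have dF x := expNx_derive n a x.
have cF (x : R) : {for x, continuous (fun x : R => (x - a) ^+ n.+1 * expR (- x))}.
  by apply: differentiable_continuous; apply/derivable1_diffP; have [] := dF x.
rewrite (@continuous_FTC2 _ _ (fun x => (x - a) ^+ n.+1 * expR (- x)))//.
- by rewrite subrr expr0n mul0r sube0.
- apply: continuous_subspaceT => x.
  apply: cvgM; last exact: continuous_expRN.
  by apply: cvgB; [apply: cvgM; [exact: cvg_cst|]|]; exact: continuous_subX.
- split.
  + by move=> x _; have [] := dF x.
  + by apply: cvg_at_right_filter; exact: cF.
  + by apply: cvg_at_left_filter; exact: cF.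
- by move=> x _; rewrite derive1E; have [_ ->] := dF x.
Qed.

Lemma expR_tail_integral (b : R) :
  (\int[mu]_(x in `[b, +oo[) (expR (- x))%:E = (expR (- b))%:E)%E.
Proof.
have dF (x : R) : is_derive x 1 (fun x => - expR (- x)) (expR (- x)).
  by apply: is_derive_eq; rewrite /GRing.scale/=; ring.
have cF (x : R) : {for x, continuous (fun x : R => - expR (- x))}.
  by apply: differentiable_continuous; apply/derivable1_diffP; have [] := dF x.
rewrite (@ge0_continuous_FTC2y _ _ (fun x => - expR (- x)) b 0)//.
- by rewrite -EFinB sub0r opprK.
- by apply: continuous_subspaceT; exact: continuous_expRN.
- rewrite -oppr0; apply: cvgN.
  exact: cvgr_expR.
- by apply: cvg_at_right_filter; exact: cF.
- by move=> x _; rewrite derive1E; have [_ ->] := dF x.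
Qed.

Let pdf := exponential_pdf (1 : R).

Let pdfE x : 0 <= x -> pdf x = expR (- x).
Proof. by move=> x0; rewrite /pdf exponential_pdfE// mul1r mulN1r. Qed.

Let poly n a x : R := n.+1%:R * (x - a) ^+ n - (x - a) ^+ n.+1.

(* On [a, b] the integrand is the derivative of [(x - a) ^+ n.+1 * expR (- x)],
   whose boundary term at [b] cancels the contribution of [b, +oo[. *)
Lemma integral_residual_gain (f : R -> R) n (a b g : R) : 0 <= a -> a <= b ->
  measurable_fun setT f ->
  (forall x, 0 < x -> x != a -> x != b -> f x = g * residual_gain n a b x) ->
  (\int[mu]_x ((f x)%:E * (pdf x)%:E) = 0)%E.
Proof.
move=> a0 ab mf fE.
pose k x := poly n a x * expR (- x).
pose j x := (b - a) ^+ n.+1 * expR (- x).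
have cX := @continuous_subX a.
have cE := continuous_expRN.
have ck : continuous k.
  move=> x; apply: cvgM; last exact: cE.
  by apply: cvgB; [apply: cvgM; [exact: cvg_cst|exact: cX]|exact: cX].
have cj : continuous j by move=> x; apply: cvgM; [exact: cvg_cst|exact: cE].
have mE (h : R -> R) D : continuous h -> measurable D -> measurable_fun D (EFin \o h).
  move=> ch mD; apply/measurable_EFinP; apply: measurable_funTS.
  exact: continuous_measurable_fun.
have ik : mu.-integrable `[a, b] (EFin \o k).
  apply: continuous_compact_integrable; first exact: segment_compact.
  exact: continuous_subspaceT.
have ij : mu.-integrable `[b, +oo[ (EFin \o j).
  apply/integrableP; split; first exact: mE.
  under eq_integral do rewrite /= /j normrM (ger0_norm (expR_ge0 _)) EFinM.
  rewrite ge0_integralZl//=.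
  - by rewrite expR_tail_integral -EFinM ltry.
  - exact: mE.
have ip : (\int[mu]_(x in `[a, b]) (k x)%:E = ((b - a) ^+ n.+1 * expR (- b))%:E)%E.
  exact: expR_itv_integral.
have ij' : (\int[mu]_(x in `[b, +oo[) (j x)%:E = ((b - a) ^+ n.+1 * expR (- b))%:E)%E.
  rewrite /j; under eq_integral do rewrite EFinM.
  rewrite ge0_integralZl//=.
  - by rewrite expR_tail_integral -EFinM.
  - exact: mE.
  - by rewrite lee_fin exprn_ge0// subr_ge0.
pose F1 := (fun x => (k x)%:E) \_ `[a, b].
pose F2 := (fun x => (j x)%:E) \_ `[b, +oo[.
have iF1 : mu.-integrable setT F1 by move: ik; rewrite integrable_mkcond.
have iF2 : mu.-integrable setT F2 by move: ij; rewrite integrable_mkcond.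
transitivity (\int[mu]_x (g%:E * (F1 x - F2 x)))%E; last first.
  rewrite integralZl//; last exact: integrableB.
  rewrite integralB// -!integral_mkcond ip ij' subee// mule0//.
apply: ae_eq_integral => //.
- apply: emeasurable_funM; first exact/measurable_EFinP.
  by apply/measurable_EFinP; exact: measurable_exponential_pdf.
- apply: emeasurable_funM; first exact: measurable_cst.
  by apply: emeasurable_funB; apply: measurable_int; [exact: iF1|exact: iF2].
have N1 (y : R) : mu.-negligible [set y].
  by exists [set y]; split => //; exact: lebesgue_measure_set1.
have N3 : mu.-negligible ([set 0] `|` [set a] `|` [set b]).
  by apply: negligibleU; [apply: negligibleU|]; exact: N1.
apply: negligibleS N3 => x /=; apply: contra_notP => nx _.
have x0 : x != 0 by apply/eqP => e; apply: nx; left; left.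
have xa : x != a by apply/eqP => e; apply: nx; left; right.
have xb : x != b by apply/eqP => e; apply: nx; right.
rewrite /F1 /F2 !patchE !mem_setE !in_itv/= andbT.
move: x0; rewrite neq_lt => /orP[xn|xp].
  have h1 : x < a by exact: lt_le_trans a0.
  have h2 : x < b by exact: lt_le_trans ab.
  rewrite /pdf lt0_exponential_pdf// (leNgt a) h1 (leNgt b) h2 /=.
  by rewrite mule0 sube0 mule0.
rewrite (pdfE (ltW xp)) fE// /residual_gain -EFinM.
move: xa xb; rewrite !neq_lt => /orP[h1|h1].
  have h2 : x < b by exact: lt_le_trans ab.
  rewrite (leNgt a) h1 (leNgt b) h2 /= (ltNge a) (ltW h1) (ltNge b) (ltW h2) /=.
  by rewrite !mul0r subr0 mulr0 mul0r sube0 mule0.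
move=> /orP[h2|h2].
  rewrite (ltW h1) (ltW h2) (leNgt b) h2 /= h1 (ltNge b) (ltW h2) /=.
  by rewrite mul0r mul1r subr0 sube0 -EFinM /k /poly mulrA.
rewrite (ltW h1) (leNgt x) h2 (ltW h2) /= h1 (ltNge x) (ltW h2) /=.
rewrite mul0r mul1r sub0r -[point]/(0%E : \bar R) add0e -EFinM /j.
by congr (_%:E); ring.
Qed.

End ExponentialIntegral.

(** * The event chain and its dependence on one input *)

Section Chain.
Variables (R : realType) (N : nat).
Implicit Types (th : clock N -> nat -> \bar R) (U : nat -> R) (q : 'I_N -> nat).
Implicit Types (st : sys_state N) (c : clock N).

(* The chain [event_state], driven by an arbitrary array of tick times [th]
   instead of [tick lam p E], so that a single clock can be switched off. *)
Definition gnext th st : clock N :=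
  [arg min_(c < inr tt) th c (st.1 c)]%O.

Definition gstep U c st : sys_state N :=
  ((fun c' => if c' == c then (st.1 c).+1 else st.1 c'),
   match c with
   | inl (inl n) => fun m => if m == n then (st.2 m).+1 else st.2 m
   | inl (inr n) => decr st.2 n
   | inr _ =>
       if (0 < \sum_(m < N) st.2 m)%N then
         match choose_longest st.2 (U (st.1 c)) with
         | Some n => decr st.2 n
         | None => st.2
         end
       else st.2
   end).

Definition gstate th U q k : sys_state N :=
  iter k (fun st => gstep U (gnext th st) st) (fun _ => 0%N, q).

Definition gclock th U q k : clock N := gnext th (gstate th U q k).

Definition gtime th U q k : \bar R :=
  th (gclock th U q k) ((gstate th U q k).1 (gclock th U q k)).

(** The time of the event preceding event [k], with time 0 before the first one, so that every
    sojourn has a left end. *)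
Definition ptime th U q k : \bar R := if k is j.+1 then gtime th U q j else 0%E.

Lemma gstateS th U q k :
  gstate th U q k.+1 = gstep U (gclock th U q k) (gstate th U q k).
Proof. by []. Qed.

Lemma event_stateE lam p E U q k :
  event_state lam p E U q k = gstate (tick lam p E) U q k.
Proof.
by elim: k => //= k IH; rewrite /event_state iterS -/(event_state lam p E U q k) IH.
Qed.

Lemma event_timeE lam p E U q k :
  event_time lam p E U q k = gtime (tick lam p E) U q k.
Proof. by rewrite /event_time event_stateE. Qed.

Lemma gnext_min th st c : (th (gnext th st) (st.1 (gnext th st)) <= th c (st.1 c))%E.
Proof. by rewrite /gnext; case: Order.TotalTheory.arg_minP => // i _; apply. Qed.

Lemma gtime_min th U q k c : (gtime th U q k <= th c ((gstate th U q k).1 c))%E.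
Proof. exact: gnext_min. Qed.

(* [arg min] returns the first minimiser in the enumeration of the clocks, so
   increasing the value of a clock that was not selected changes nothing. *)
Lemma gnext_raise th th' st c :
  (forall c', c' != c -> th' c' (st.1 c') = th c' (st.1 c')) ->
  (th c (st.1 c) <= th' c (st.1 c))%E -> gnext th st != c ->
  gnext th' st = gnext th st.
Proof.
move=> thE thle nc.
have mn := gnext_min th st.
(* [[arg min]] is exposed as [pick] of the predicate of minimisers, so that the two selections can
   be compared along the enumeration of the clocks. *)
have nE : exists2 P : pred (clock N), gnext th st = odflt (inr tt) (pick P) &
    forall x, P x = [forall y, (th x (st.1 x) <= th y (st.1 y))%E].
  by eexists; [reflexivity|move=> x /=].
have nE' : exists2 P : pred (clock N), gnext th' st = odflt (inr tt) (pick P) &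
    forall x, P x = [forall y, (th' x (st.1 x) <= th' y (st.1 y))%E].
  by eexists; [reflexivity|move=> x /=].
case: nE nE' => P e HP [P' e' HP'].
pose c0 := gnext th st; rewrite -/c0 in mn nc.
have same x : x != c -> th' x (st.1 x) = th x (st.1 x) by exact: thE.
have le' y : (th y (st.1 y) <= th' y (st.1 y))%E.
  by have [->|/same->] := eqVneq y c.
have sub x : P' x -> P x.
  rewrite HP HP' => /forallP h; apply/forallP => y.
  apply: (le_trans (le' x)); apply: (le_trans (h c0)).
  by rewrite same.
have P'c : P' c0.
  by rewrite HP'; apply/forallP => y; rewrite same//; apply: le_trans (mn y) (le' y).
have pc : pick P = Some c0.
  have := sub _ P'c; rewrite /c0 e; case: pickP => //= ->//.
rewrite e' -/c0; suff -> : pick P' = Some c0 by [].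
move: pc; rewrite /pick /enum_mem.
elim: (Finite.enum _) => //= x s IH.
rewrite !unfold_in; case: ifPn => Px /=.
  by case=> xc; rewrite xc P'c.
by move=> /IH; case: ifPn => // /sub; rewrite (negbTE Px).
Qed.

Lemma eq_gnext th th' st :
  (forall c, th' c (st.1 c) = th c (st.1 c)) -> gnext th' st = gnext th st.
Proof.
move=> h; rewrite /gnext.
by rewrite (_ : (fun c => th' c (st.1 c)) = (fun c => th c (st.1 c)))//; apply/funext.
Qed.

Lemma gcntS th U q k c : (gstate th U q k.+1).1 c =
  if c == gclock th U q k then ((gstate th U q k).1 c).+1 else (gstate th U q k).1 c.
Proof. by rewrite gstateS /=; case: eqP => // ->. Qed.

Lemma gcnt_homo th U q c j k : (j <= k)%N ->
  ((gstate th U q j).1 c <= (gstate th U q k).1 c)%N.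
Proof.
elim: k => [|k IH]; first by rewrite leqn0 => /eqP->.
rewrite leq_eqVlt => /orP[/eqP-> //|/IH h]; apply: (leq_trans h).
by rewrite gcntS; case: eqP => // _; exact: leqnSn.
Qed.

Lemma gcnt_le th U q c k : ((gstate th U q k).1 c <= k)%N.
Proof.
elim: k => // k IH; rewrite gcntS; case: eqP => // _.
exact: leq_trans IH (leqnSn k).
Qed.

(* Until clock [c] has ticked [l] times the chain does not see its [l]-th input,
   so the silenced chain yields the history before the event caused by that
   input as a function of the other inputs only. *)
Definition silence th c l : clock N -> nat -> \bar R :=
  fun c' j => if (c' == c) && (l <= j)%N then +oo%E else th c' j.

Lemma silence_ge th c l c' j : (th c' j <= silence th c l c' j)%E.
Proof. by rewrite /silence; case: ifP => // _; rewrite leey. Qed.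

Lemma silence_neq th c l c' j : c' != c -> silence th c l c' j = th c' j.
Proof. by rewrite /silence => /negbTE->. Qed.

Lemma silence_lt th c l c' j : (j < l)%N -> silence th c l c' j = th c' j.
Proof. by move=> jl; rewrite /silence (leqNgt l) jl andbF. Qed.

(** While [c] has ticked fewer than [l] times, silencing alters no pending tick. Once its count is
    [l], the true chain cannot select [c] before [k], as the count would exceed [l]; raising the
    tick of an unselected clock is then harmless. *)
Lemma silence_state th U q c l k :
  ((gstate th U q k).1 c <= l)%N ->
  forall j, (j <= k)%N -> gstate (silence th c l) U q j = gstate th U q j.
Proof.
move=> kl; elim=> // j IH jk; have E := IH (ltnW jk).
rewrite !gstateS E; congr gstep; rewrite /gclock E.
have jl : ((gstate th U q j).1 c <= l)%N by apply: leq_trans kl; exact/gcnt_homo/ltnW.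
have [ltl|eql] : ((gstate th U q j).1 c < l)%N \/ (gstate th U q j).1 c = l.
  by move: jl; rewrite leq_eqVlt => /orP[/eqP|]; [right|left].
  apply: eq_gnext => c'; have [->|c'c] := eqVneq c' c; first exact: silence_lt.
  exact: silence_neq.
apply: (@gnext_raise _ _ _ c); [by move=> c' c'c; exact: silence_neq|exact: silence_ge|].
have := leq_trans (gcnt_homo th U q c jk) kl.
by rewrite gcntS eq_sym /gclock; case: eqP => // _; rewrite eql ltnn.
Qed.

Lemma silence_time th U q c l k :
  ((gstate th U q k).1 c <= l)%N ->
  forall j, (j < k)%N -> gclock (silence th c l) U q j = gclock th U q j /\
    gtime (silence th c l) U q j = gtime th U q j.
Proof.
move=> kl j jk; have S := silence_state kl.
have cE : gclock (silence th c l) U q j = gclock th U q j.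
  have h := congr1 (fun s => s.1 (gclock th U q j)) (S j.+1 jk).
  move: h; rewrite !gcntS eqxx (S j (ltnW jk)).
  by case: eqP => [->//|_ /eqP]; rewrite -[X in X == _]addn0 -addn1 eqn_add2l.
split => //; rewrite /gtime cE (S j (ltnW jk)).
rewrite /silence; case: ifP => // /andP[/eqP ce le].
have := leq_trans (gcnt_homo th U q c jk) kl.
by move: le; rewrite gcntS ce eqxx ltnNge => ->.
Qed.

(** The converse passage, from assumptions on the silenced chain and the single time [th c l]. If
    the true chain selected [c] at count [l], then [th c l] would not exceed a silenced event
    time. *)
Lemma silence_state_conv th U q c l k :
  ((gstate (silence th c l) U q k).1 c <= l)%N ->
  (forall j, (j < k)%N -> (gtime (silence th c l) U q j < th c l)%E) ->
  forall j, (j <= k)%N -> gstate (silence th c l) U q j = gstate th U q j.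
Proof.
set sth := silence th c l => kl tl; elim=> // j IH jk; have E := IH (ltnW jk).
rewrite !gstateS E; congr gstep; rewrite /gclock E.
have jl : ((gstate sth U q j).1 c <= l)%N by apply: leq_trans kl; exact/gcnt_homo/ltnW.
have [ltl|eql] : ((gstate th U q j).1 c < l)%N \/ (gstate th U q j).1 c = l.
  by move: jl; rewrite E leq_eqVlt => /orP[/eqP|]; [right|left].
  apply: eq_gnext => c'; have [->|c'c] := eqVneq c' c; first exact: silence_lt.
  exact: silence_neq.
apply: (@gnext_raise _ _ _ c); [by move=> c' c'c; exact: silence_neq|exact: silence_ge|].
have nc : gclock sth U q j != c.
  have := leq_trans (gcnt_homo sth U q c jk) kl.
  by rewrite gcntS eq_sym E eql; case: eqP => // _; rewrite ltnn.
apply/eqP => cE; have := tl j jk; rewrite /gtime {1}/sth silence_neq//.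
have := gnext_min th (gstate th U q j) (gclock sth U q j).
by rewrite cE eql E => /le_lt_trans h /h; rewrite ltxx.
Qed.

Section PendingClock.
Variables (th : clock N -> nat -> \bar R) (U : nat -> R) (q : 'I_N -> nat).
Variables (c : clock N) (l k : nat).
Let sth := silence th c l.
Hypothesis stE : gstate sth U q k = gstate th U q k.
Hypothesis cl : (gstate th U q k).1 c = l.

(** The pending input influences the next event only by competing with a time that does not depend
    on it. *)
Lemma silence_gtime_min : gtime th U q k = Order.min (th c l) (gtime sth U q k).
Proof.
apply/eqP; rewrite eq_le; apply/andP; split.
  rewrite le_min; apply/andP; split; first by rewrite -cl; exact: gtime_min.
  rewrite {2}/gtime; have [ce|cn] := eqVneq (gclock sth U q k) c.
    by rewrite ce {1}/sth /silence eqxx stE cl leqnn leey.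
  by rewrite {1}/sth silence_neq// stE; exact: gtime_min.
rewrite ge_min; have [ce|cn] := eqVneq (gclock th U q k) c.
  by rewrite {1}/gtime ce cl lexx.
apply/orP; right; rewrite {2}/gtime -(@silence_neq th c l _ _ cn) -stE.
exact: gtime_min.
Qed.

(** Strictness matters: in a tie [arg min] may prefer another clock. *)
Lemma silence_gclock_lt : (th c l < gtime sth U q k)%E -> gclock th U q k = c.
Proof.
move=> h; apply/eqP; apply/negPn/negP => cn.
have : (gtime sth U q k <= gtime th U q k)%E.
  by rewrite {2}/gtime -(@silence_neq th c l _ _ cn) -stE; exact: gtime_min.
by rewrite silence_gtime_min le_min leNgt h.
Qed.

Lemma silence_gclock_eq : gclock th U q k = c -> gtime th U q k = th c l.
Proof. by move=> e; rewrite /gtime e cl. Qed.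

End PendingClock.

Section MonotoneTicks.
Variables (th : clock N -> nat -> \bar R) (U : nat -> R) (q : 'I_N -> nat).
Hypothesis th0 : forall c, (0 <= th c 0%N)%E.
Hypothesis thS : forall c k, (th c k <= th c k.+1)%E.

Lemma ptime_pending k c : (ptime th U q k <= th c ((gstate th U q k).1 c))%E.
Proof.
case: k => [|k]; first exact: th0.
rewrite /ptime gcntS; apply: (le_trans (gtime_min th U q k c)).
by case: eqP.
Qed.

Lemma ptime_le k : (ptime th U q k <= ptime th U q k.+1)%E.
Proof. exact: ptime_pending. Qed.

Lemma ptime_homo j k : (j <= k)%N -> (ptime th U q j <= ptime th U q k)%E.
Proof.
elim: k => [|k IH]; first by rewrite leqn0 => /eqP->.
rewrite leq_eqVlt => /orP[/eqP-> //|/IH h]; exact: le_trans h (ptime_le k).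
Qed.

Lemma ptime_ge0 k : (0 <= ptime th U q k)%E.
Proof. exact: (@ptime_homo 0). Qed.

Lemma ptime_consumed k c j : (j < (gstate th U q k).1 c)%N ->
  (th c j <= ptime th U q k)%E.
Proof.
elim: k => // k IH; rewrite gcntS; case: eqP => [e|_ /IH h]; last first.
  exact: le_trans h (ptime_le k).
rewrite ltnS leq_eqVlt => /orP[/eqP->|/IH h]; last exact: le_trans h (ptime_le k).
by rewrite /ptime /gtime -e.
Qed.

End MonotoneTicks.

End Chain.

(** * Truncated sojourns and the response to one input *)

Section TruncatedTimes.
Variables (R : realType) (N : nat) (th : clock N -> nat -> \bar R).
Variables (U : nat -> R) (q : 'I_N -> nat).

(** For nonnegative nondecreasing ticks and [0 <= t] the truncation makes even an infinite event
    time finite, so [fine] loses nothing; see [rtimeE]. *)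
Definition rtime k (t : R) : R := fine (Order.min (ptime th U q k) t%:E).

Definition dtime k (t : R) : R := rtime k.+1 t - rtime k t.

(* If clock [c] has rate [r], this has mean zero given the history before event
   [k]; [n = 0] gives first moments of the increments and [n = 1] second moments. *)
Definition clock_term (r : R) (n : nat) c k (t : R) : R :=
  n.+1%:R * (r * dtime k t) ^+ n *
    ((gclock th U q k == c) && (gtime th U q k <= t%:E)%E)%:R -
  (r * dtime k t) ^+ n.+1.

End TruncatedTimes.

Section Replace.
Variables (R : realType) (lam p : R) (N : nat).
Implicit Types (E : clock N -> nat -> R).

Definition replace_input E c l (x : R) : clock N -> nat -> R :=
  fun c' j => if (c' == c) && (j == l) then x else E c' j.

Lemma tick_ge0 E c : (forall c j, 0 <= E c j) -> (0 <= tick lam p E c 0%N)%E.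
Proof.
move=> E0; rewrite /tick; case: ifP => [r0|]; last by rewrite leey.
by rewrite lee_fin divr_ge0 ?(ltW r0)// sumr_ge0.
Qed.

Lemma tickS E c k : (forall c j, 0 <= E c j) ->
  (tick lam p E c k <= tick lam p E c k.+1)%E.
Proof.
move=> E0; rewrite /tick; case: ifP => [r0|]; last by rewrite leey.
by rewrite lee_fin ler_pM2r ?invr_gt0// [leRHS]big_ord_recr/= lerDl.
Qed.

(** A tick of [c] before index [l] sums inputs of index below [l], and the later ones are infinite
    after silencing; the [l]-th input thus disappears. *)
Lemma silence_replace E c l x :
  silence (tick lam p (replace_input E c l x)) c l = silence (tick lam p E) c l.
Proof.
apply/funext => c'; apply/funext => j; rewrite /silence.
case: ifPn => //; rewrite negb_and /tick => h; case: ifP => // _.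
congr (_ / _)%:E; apply: eq_bigr => i _; rewrite /replace_input.
case: ifP => // /andP[c'c /eqP il]; move: h; rewrite c'c/= -ltnNge -il.
by move=> ji; have := ltn_ord i; rewrite ltnS leqNgt ji.
Qed.

Lemma tick_replace E c l x : 0 < rate lam p c ->
  tick lam p (replace_input E c l x) c l =
  ((\sum_(j < l) E c j + x) / rate lam p c)%:E.
Proof.
move=> r0; rewrite /tick r0 big_ord_recr/=; congr (_ / _)%:E; congr (_ + _).
  apply: eq_bigr => i _; rewrite /replace_input eqxx/= ltn_eqF//.
by rewrite /replace_input !eqxx.
Qed.

End Replace.

Section InnerGain.
Variables (R : realType) (lam p : R) (N : nat) (E : clock N -> nat -> R).
Variables (U : nat -> R) (q : 'I_N -> nat) (c : clock N) (l k n : nat) (t : R).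
Variable G : (clock N -> nat -> \bar R) -> R.
Hypothesis E0 : forall c j, 0 <= E c j.
Hypothesis r0 : 0 < rate lam p c.
Hypothesis t0 : 0 <= t.
Hypothesis Ghist : forall th th',
  (forall j, (j <= k)%N -> gstate th U q j = gstate th' U q j) ->
  (forall j, (j < k)%N -> gclock th U q j = gclock th' U q j /\
     gtime th U q j = gtime th' U q j) ->
  G th = G th'.

Let r := rate lam p c.
Let thx x := tick lam p (replace_input E c l x).
Let sth := silence (tick lam p E) c l.
Let S := \sum_(j < l) E c j.

(** The integrand as a function of one input [x], the others being frozen. The indicator says that
    [x] is the input pending at event [k], and [G] is a weight determined by the history before that
    event. *)
Definition inner_term x : R :=
  ((gstate (thx x) U q k).1 c == l)%:R * G (thx x) * clock_term (thx x) U q r n c k t.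

Let sthE x : silence (thx x) c l = sth. Proof. exact: silence_replace. Qed.

Let rE0 x : 0 < x -> forall c' j, 0 <= replace_input E c l x c' j.
Proof. by move=> x0 c' j; rewrite /replace_input; case: ifP => // _; exact: ltW. Qed.

Let sth0 c' : (0 <= sth c' 0%N)%E.
Proof. by apply: le_trans (silence_ge _ _ _ _ _); exact: tick_ge0. Qed.

Let sthS c' j : (sth c' j <= sth c' j.+1)%E.
Proof.
rewrite /sth /silence; case: ifP => [/andP[-> lj]|_].
  by rewrite (leq_trans lj (leqnSn _)).
by case: ifP => _; [rewrite leey|exact: tickS].
Qed.

Let thxE x : thx x c l = ((S + x) / r)%:E.
Proof. exact: tick_replace. Qed.

Let stays x : 0 < x -> (gstate (thx x) U q k).1 c = l ->
  (gstate sth U q k).1 c = l /\ (ptime sth U q k <= thx x c l)%E.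
Proof.
move=> x0 cl; have cl' : ((gstate (thx x) U q k).1 c <= l)%N by rewrite cl.
have st := silence_state cl'; have ti := silence_time cl'.
rewrite sthE in st ti; split; first by rewrite st.
have -> : ptime sth U q k = ptime (thx x) U q k.
  by case: k ti => // j ti; rewrite /ptime (ti j _).2.
have := ptime_pending U q (fun c => tick_ge0 lam p c (rE0 x0))
  (fun c k => tickS lam p c k (rE0 x0)) k c.
by rewrite cl.
Qed.

(** For [x < a] the input is consumed before event [k] and the indicator vanishes. For [x > a] the
    history is that of the silenced chain, so the weight is the constant [G sth]. Ticks may tie at
    [a] and [b]; these two values are excluded and form a null set. *)
Lemma inner_term_gain : exists a b g : R, [/\ 0 <= a, a <= b &
  forall x, 0 < x -> x != a -> x != b -> inner_term x = g * residual_gain n a b x].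
Proof.
have zero : (forall x, 0 < x -> (gstate (thx x) U q k).1 c <> l) ->
    exists a b g : R, [/\ 0 <= a, a <= b &
  forall x, 0 < x -> x != a -> x != b -> inner_term x = g * residual_gain n a b x].
  move=> h; exists 0, 0, 0; split => // x x0 _ _.
  by rewrite /inner_term; case: eqP => [/(h x x0)//|_]; rewrite !mul0r.
have [cl|ncl] := eqVneq ((gstate sth U q k).1 c) l; last first.
  by apply: zero => x x0 /(stays x0)[/eqP]; rewrite (negbTE ncl).
have T'0 := ptime_ge0 U q sth0 sthS k.
case T'E : (ptime sth U q k) T'0 => [T'| |]//; last first.
  by move=> _; apply: zero => x x0 /(stays x0)[_]; rewrite T'E thxE.
rewrite lee_fin => T'0.
(* Times are converted to the scale of the inputs: [r * T'] is the previous event time in units of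
   [1 / r], and [S] is the total of the inputs that [c] has already used. *)
pose a := r * T' - S.
have a0 : 0 <= a.
  rewrite subr_ge0 -ler_pdivrMl// mulrC.
  have [l0|lp] := posnP l; first by rewrite /S l0 big_ord0 mul0r.
  have := @ptime_consumed _ _ sth U q sth0 sthS k c l.-1.
  by rewrite cl prednK// leqnn T'E /sth silence_lt ?prednK// /tick r0 prednK// lee_fin => /(_ isT).
have Tgt x : a < x -> (T'%:E < thx x c l)%E.
  by rewrite thxE lte_fin ltr_pdivlMr// /a mulrC; lra.
have hist x : a < x ->
    [/\ gstate sth U q k = gstate (thx x) U q k,
        G (thx x) = G sth & ptime (thx x) U q k = T'%:E].
  move=> ax.
  have st : forall j, (j <= k)%N -> gstate sth U q j = gstate (thx x) U q j.
    rewrite -(sthE x); apply: silence_state_conv; rewrite sthE ?cl// => j jk.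
    apply: le_lt_trans (Tgt x ax); rewrite -T'E.
    by rewrite -[gtime _ _ _ _]/(ptime sth U q j.+1); exact: (ptime_homo U q sth0 sthS).
  have cl' : ((gstate (thx x) U q k).1 c <= l)%N by rewrite -st// cl.
  have ti := silence_time cl'; rewrite sthE in ti.
  split; first exact: st.
  - by apply/esym/Ghist.
  - by rewrite -T'E; case: k ti => // j ti; rewrite /ptime (ti j _).2.
have gsT : (T'%:E <= gtime sth U q k)%E.
  by rewrite -T'E; exact: (ptime_le U q sth0 sthS).
pose gs := gtime sth U q k.
have clx x : a < x -> (gstate (thx x) U q k).1 c = l.
  by move=> /hist[<-].
have sst x : a < x -> gstate (silence (thx x) c l) U q k = gstate (thx x) U q k.
  by move=> ax; rewrite sthE; have [] := hist x ax.
have gtx x : a < x -> gtime (thx x) U q k = Order.min (thx x c l) gs.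
  by move=> ax; rewrite (silence_gtime_min (sst x ax) (clx x ax)) sthE.
have inner0 x : 0 < x -> x < a -> inner_term x = 0.
  move=> x0 xa; rewrite /inner_term; case: eqP => [/(stays x0)[_]|_]; last by rewrite !mul0r.
  rewrite T'E thxE lee_fin ler_pdivlMr// leNgt; move: xa; rewrite /a => xa.
  by rewrite (_ : S + x < T' * r)//; lra.
have rt x : a < x -> rtime (thx x) U q k t = Num.min T' t.
  by move=> /hist[_ _]; rewrite /rtime => ->; rewrite -EFin_min.
(* If the horizon is not after the previous event, the truncated sojourn is empty and the gain is
   zero. *)
have [tT'|T't] := leP t T'.
  exists a, a, 0; split => // x x0 xa _; rewrite mul0r.
  move: xa; rewrite neq_lt => /orP[xa|ax]; first exact: inner0.
  rewrite /inner_term /clock_term /dtime rt// min_r//.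
  have -> : rtime (thx x) U q k.+1 t = t.
    rewrite /rtime /= gtx// min_r// le_min; apply/andP; split.
      by apply: le_trans (ltW (Tgt x ax)); rewrite lee_fin.
    by apply: le_trans gsT; rewrite lee_fin.
  rewrite subrr mulr0 [X in _ - X]expr0n/= subr0.
  suff -> : (gclock (thx x) U q k == c) && (gtime (thx x) U q k <= t%:E)%E = false.
    by rewrite !mulr0.
  apply/negbTE/negP => /andP[/eqP gc].
  rewrite (silence_gclock_eq (clx x ax) gc) leNgt.
  by rewrite (le_lt_trans _ (Tgt x ax)) ?lee_fin.
pose mb := Order.min gs t%:E.
have mbT : (T'%:E <= mb)%E by rewrite le_min gsT lee_fin ltW.
have mbfin : mb \is a fin_num.
  rewrite fin_numElt; apply/andP; split; first by apply: lt_le_trans mbT; rewrite ltNyr.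
  by apply: (@le_lt_trans _ _ t%:E); [rewrite ge_min lexx orbT|rewrite ltry].
have mbE : mb = (fine mb)%:E by rewrite fineK.
pose b := r * fine mb - S.
have ab : a <= b.
  by rewrite lerD2r ler_pM2l// -lee_fin -mbE.
exists a, b, (G sth); split => // x x0 xa xb.
move: xa; rewrite neq_lt => /orP[xa|ax].
  rewrite inner0// /residual_gain (ltNge a) (ltW xa) (ltNge b) (ltW (lt_le_trans xa ab)) /=.
  by rewrite !mul0r subr0 mulr0.
have [h Gx _] := hist x ax.
rewrite /inner_term clx// eqxx mul1r Gx; congr (_ * _).
rewrite /clock_term /residual_gain ax /= /dtime rt// min_l ?(ltW T't)//.
have r1E : rtime (thx x) U q k.+1 t = fine (Order.min (thx x c l) mb).
  by rewrite /rtime /= gtx// -minA.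
move: xb; rewrite neq_lt => /orP[xb|bx].
  have lt1 : (thx x c l < mb)%E.
    by rewrite mbE thxE lte_fin ltr_pdivrMr// mulrC; move: xb; rewrite /b; lra.
  rewrite r1E min_l ?(ltW lt1)// xb (ltNge b) (ltW xb) /= mul0r subr0.
  have -> : r * (fine (thx x c l) - T') = x - a.
    by rewrite thxE /= mulrBr mulrCA divff ?gt_eqF// mulr1 /a; ring.
  have lt2 : (thx x c l < gs)%E by apply: (lt_le_trans lt1); rewrite ge_min lexx.
  have -> : gclock (thx x) U q k = c.
    by apply: (silence_gclock_lt (sst x ax) (clx x ax)); rewrite sthE.
  rewrite eqxx gtx// min_l ?(ltW lt2)// (le_trans (ltW lt1)) ?mulr1 ?mul1r//.
  by rewrite ge_min lexx orbT.
have gt1 : (mb < thx x c l)%E.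
  by rewrite mbE thxE lte_fin ltr_pdivlMr// mulrC; move: bx; rewrite /b; lra.
rewrite r1E min_r ?(ltW gt1)// bx (ltNge x) (ltW bx) /= mul0r mul1r sub0r.
have -> : r * (fine mb - T') = b - a by rewrite /b /a; ring.
(* Clock [c] may still be selected when it is the horizon that precedes its tick, but the event is
   then later than [t] and is not counted. *)
case: eqP => [gc|_] /=; last by rewrite mulr0 sub0r.
have e := silence_gclock_eq (clx x ax) gc.
rewrite e; case: leP => [le|_]; last by rewrite mulr0 sub0r.
have : (thx x c l <= mb)%E.
  by rewrite le_min le andbT -e gtx// ge_min lexx orbT.
by rewrite leNgt gt1.
Qed.

End InnerGain.

(** * Measurability of the event chain *)

Section DiscreteMeasurability.
Context d (X : measurableType d).

(* Measurability into a type [S] that carries no sigma-algebra; it is only useful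
   for countable [S], such as queue lengths and chain states. *)
Definition dmeas (S : Type) (g : X -> S) := forall s, measurable (g @^-1` [set s]).

Lemma dmeas_preimage (S : Type) (g : X -> S) A :
  countable [set: S] -> dmeas g -> measurable (g @^-1` A).
Proof.
move=> cS mg.
rewrite (_ : g @^-1` A = \bigcup_s (if pselect (A s) then g @^-1` [set s] else set0)).
  by apply: countable_bigcupT_measurable => // s; case: pselect => /= _; [exact: mg|exact: measurable0].
rewrite eqEsubset; split => [x Ax|x [s _]].
  by exists (g x) => //; case: pselect.
by case: pselect => // As /= ->.
Qed.

Lemma dmeas_comp (S S' : Type) (g : X -> S) (h : S -> S') :
  countable [set: S] -> dmeas g -> dmeas (h \o g).
Proof. by move=> cS mg s; rewrite comp_preimage; exact: dmeas_preimage. Qed.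

Lemma dmeas_cst (S : Type) (s : S) : dmeas (fun _ => s).
Proof.
move=> s'; have [e|n] := pselect (s = s').
  by rewrite (_ : _ @^-1` _ = setT)//; apply/seteqP; split.
by rewrite (_ : _ @^-1` _ = set0)//; apply/seteqP; split.
Qed.

(** Freezing the discrete value [g x] reduces a random index, such as the current state or the
    selected clock, to countably many deterministic ones. *)
Lemma dmeas_piecewise (S S' : Type) (g : X -> S) (F : S -> X -> S') :
  countable [set: S] -> dmeas g -> (forall s, dmeas (F s)) ->
  dmeas (fun x => F (g x) x).
Proof.
move=> cS mg mF s'.
rewrite (_ : _ @^-1` _ = \bigcup_s (g @^-1` [set s] `&` F s @^-1` [set s'])).
  by apply: countable_bigcupT_measurable => // s; apply: measurableI; [exact: mg|exact: mF].
rewrite eqEsubset; split => [x Ax|x [s _]]; first by exists (g x).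
by move=> [/= <-].
Qed.

Lemma measurable_piecewise (S : Type) d' (Y : measurableType d') (g : X -> S)
    (F : S -> X -> Y) :
  countable [set: S] -> dmeas g -> (forall s, measurable_fun setT (F s)) ->
  measurable_fun setT (fun x => F (g x) x).
Proof.
move=> cS mg mF _ A mA; rewrite setTI.
rewrite (_ : _ @^-1` _ = \bigcup_s (g @^-1` [set s] `&` (setT `&` F s @^-1` A))).
  by apply: countable_bigcupT_measurable => // s; apply: measurableI; [exact: mg|exact: mF].
rewrite eqEsubset; split => [x Ax|x [s _]]; first by exists (g x).
by move=> [/= <-] [].
Qed.

Lemma measurable_dmeas (S : Type) d' (Y : measurableType d') (g : X -> S)
    (h : S -> Y) :
  countable [set: S] -> dmeas g -> measurable_fun setT (fun x => h (g x)).
Proof.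
move=> cS mg; apply: (measurable_piecewise (F := fun s _ => h s) cS mg) => s.
exact: measurable_cst.
Qed.

Lemma dmeas_bool (b : X -> bool) : measurable_fun setT b -> dmeas b.
Proof. by move=> mb s; rewrite -[_ @^-1` _]setTI; exact: mb. Qed.

Lemma dmeas_ffun (I : finType) (S : eqType) (g : I -> X -> S) :
  (forall i, dmeas (g i)) -> dmeas (fun x => [ffun i => g i x]).
Proof.
move=> mg f.
rewrite (_ : _ @^-1` _ = \bigcap_(i in [set: I]) (g i @^-1` [set f i])).
  by apply: fin_bigcap_measurable; [exact: finite_finset|move=> i _; exact: mg].
rewrite eqEsubset; split => [x /= <- i _|x h] /=; first by rewrite ffunE.
by apply/ffunP => i; rewrite ffunE; exact: (h i).
Qed.

Lemma dmeas_truncn (R : realType) (f : X -> R) :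
  measurable_fun setT f -> dmeas (fun x => Num.truncn (f x)).
Proof.
move=> mf.
have mle n : measurable_fun setT (fun x => (Num.truncn (f x) <= n)%N).
  under eq_fun do rewrite truncn_le_nat.
  by apply: measurable_fun_ltr => //; exact: measurable_cst.
have mle' n := dmeas_bool (mle n).
case=> [|j].
  rewrite (_ : _ @^-1` _ = (fun x => (Num.truncn (f x) <= 0)%N) @^-1` [set true]); first exact: mle'.
  rewrite eqEsubset; split => x /=; first by move=> ->.
  by rewrite leqn0 => /eqP.
rewrite (_ : _ @^-1` _ = (fun x => (Num.truncn (f x) <= j.+1)%N) @^-1` [set true] `&`
   (fun x => (Num.truncn (f x) <= j)%N) @^-1` [set false]).
  by apply: measurableI; exact: mle'.
rewrite eqEsubset; split => x /=; first by move=> ->; rewrite leqnn ltnn.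
by move=> [h1 /negbT]; rewrite -ltnNge => h2; apply/eqP; rewrite eqn_leq h1.
Qed.

End DiscreteMeasurability.

Lemma countable_fun_nat (I : finType) : countable [set: I -> nat].
Proof.
apply: (@sub_countable _ _ _ [set: {ffun I -> nat}]); last exact: countableP.
apply: card_le_trans (card_image_le (fun f : {ffun I -> nat} => (f : I -> nat)) setT).
by apply: subset_card_le => f _; exists (finfun f) => //; apply/funext => i; rewrite ffunE.
Qed.

Lemma countable_sys_state N : countable [set: sys_state N].
Proof.
rewrite -setXTT; apply: countableX; exact: countable_fun_nat.
Qed.

Section ChainMeasurability.
Context d (X : measurableType d) (R : realType) (N : nat).
Variables (th : X -> clock N -> nat -> \bar R) (U : X -> nat -> R).
Variable q : X -> 'I_N -> nat.
Hypothesis mth : forall c k, measurable_fun setT (fun x => th x c k).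
Hypothesis mU : forall k, measurable_fun setT (fun x => U x k).
Hypothesis mq : dmeas q.

(** The selection is a function of the finite table of pairwise comparisons of pending ticks, and
    each comparison is a measurable event. *)
Lemma dmeas_gnext st : dmeas (fun x => gnext (th x) st).
Proof.
pose g x := [ffun cc : clock N * clock N =>
   (th x cc.1 (st.1 cc.1) <= th x cc.2 (st.1 cc.2))%E].
pose h (f : {ffun clock N * clock N -> bool}) : clock N :=
  odflt (inr tt) (pick (fun c => [forall y, f (c, y)])).
have -> : (fun x => gnext (th x) st) = h \o g.
  apply/funext => x; rewrite /h /=.
  transitivity (odflt (inr tt) (pick (fun c => [forall y, (th x c (st.1 c) <= th x y (st.1 y))%E]))) => //.
  by congr odflt; apply: eq_pick => c; apply: eq_forallb => y; rewrite ffunE.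
apply: dmeas_comp; first exact: countableP.
by apply: dmeas_ffun => cc; apply: dmeas_bool; exact: measurable_fun_lee.
Qed.

(** For a fixed state the mark enters only through an integer truncation, hence the transition is a
    function of a discrete variable. *)
Lemma dmeas_gstep (c : clock N) st : dmeas (fun x => gstep (U x) c st).
Proof.
case: c => [[n|n]|u]; [by rewrite /gstep; exact: dmeas_cst|by rewrite /gstep; exact: dmeas_cst|].
pose s := size [seq n <- enum 'I_N | [forall m, (st.2 m <= st.2 n)%N]].
pose q' m := if [seq n <- enum 'I_N | [forall m, (st.2 m <= st.2 n)%N]] is n0 :: _
  then Some (nth n0 [seq n <- enum 'I_N | [forall m, (st.2 m <= st.2 n)%N]] (minn m s.-1)) else None.
pose h m : sys_state N :=
  ((fun c' => if c' == inr u then (st.1 (inr u)).+1 else st.1 c'),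
   if (0 < \sum_(m < N) st.2 m)%N then
     match q' m with Some n => decr st.2 n | None => st.2 end else st.2).
rewrite (_ : (fun x => _) = h \o (fun x => Num.truncn (U x (st.1 (inr u)) * s%:R))).
  apply: dmeas_comp; first exact: countableP.
  by apply: dmeas_truncn; apply: measurable_funM => //; exact: measurable_cst.
by apply/funext.
Qed.

Lemma dmeas_gstate k : dmeas (fun x => gstate (th x) (U x) (q x) k).
Proof.
have cS := @countable_sys_state N.
elim: k => [|k IH].
  apply: (@dmeas_comp _ _ _ _ q (fun q => (fun _ => 0%N, q))) => //.
  exact: countable_fun_nat.
apply: (dmeas_piecewise (F := fun st x => gstep (U x) (gnext (th x) st) st) cS IH) => st.
apply: (dmeas_piecewise (F := fun c x => gstep (U x) c st) _ (dmeas_gnext st)).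
  exact: countableP.
by move=> c; exact: dmeas_gstep.
Qed.

Lemma dmeas_gclock k : dmeas (fun x => gclock (th x) (U x) (q x) k).
Proof.
apply: (dmeas_piecewise (F := fun st x => gnext (th x) st)
  (@countable_sys_state N) (dmeas_gstate k)) => st.
exact: dmeas_gnext.
Qed.

Lemma measurable_gtime k : measurable_fun setT (fun x => gtime (th x) (U x) (q x) k).
Proof.
apply: (measurable_piecewise (F := fun c x => th x c ((gstate (th x) (U x) (q x) k).1 c))
  _ (dmeas_gclock k)); first exact: countableP.
move=> c; apply: (measurable_piecewise (F := fun st x => th x c (st.1 c))
  (@countable_sys_state N) (dmeas_gstate k)) => st.
exact: mth.
Qed.

Lemma measurable_ptime k : measurable_fun setT (fun x => ptime (th x) (U x) (q x) k).
Proof. by case: k => [|k]; [exact: measurable_cst|exact: measurable_gtime]. Qed.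

Lemma measurable_rtime k t :
  measurable_fun setT (fun x => rtime (th x) (U x) (q x) k t).
Proof.
apply: (measurableT_comp (f := fine)); first exact: fine_measurable.
by apply: measurable_mine; [exact: measurable_ptime|exact: measurable_cst].
Qed.

Lemma measurable_dtime k t :
  measurable_fun setT (fun x => dtime (th x) (U x) (q x) k t).
Proof. by apply: measurable_funB; exact: measurable_rtime. Qed.

Lemma measurable_gtime_le k t :
  measurable_fun setT (fun x => (gtime (th x) (U x) (q x) k <= t%:E)%E).
Proof. by apply: measurable_fun_lee; [exact: measurable_gtime|exact: measurable_cst]. Qed.

End ChainMeasurability.

Lemma measurable_tick d (X : measurableType d) (R : realType) (lam p : R) N
    (E : X -> clock N -> nat -> R) c k :
  (forall c k, measurable_fun setT (fun x => E x c k)) ->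
  measurable_fun setT (fun x => tick lam p (E x) c k).
Proof.
move=> mE; rewrite /tick; case: (0 < rate lam p c); last exact: measurable_cst.
apply/measurable_EFinP; apply: measurable_funM; last exact: measurable_cst.
by apply: measurable_sum => i; exact: mE.
Qed.

(** * Integration against an independent input *)

Lemma bounded_integrable d (X : measurableType d) (R : realType)
    (mu : {measure set X -> \bar R}) (f : X -> R) (M : R) :
  (mu setT < +oo)%E -> measurable_fun setT f -> (forall x, `|f x| <= M) ->
  mu.-integrable setT (fun x => (f x)%:E).
Proof.
move=> muoo mf bf; apply: measurable_bounded_integrable => //.
exists M; split; first exact: num_real.
by move=> y My x _ /=; apply: le_trans (bf x) (ltW My).
Qed.

Section IndependentFubini.
Context d d1 d2 (Om : measurableType d) (Y : measurableType d1) (Z : measurableType d2).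
Context (R : realType) (P : probability Om R).
Variables (V : {mfun Om >-> Y}) (W : {mfun Om >-> Z}).
Hypothesis VW : forall A B, measurable A -> measurable B ->
  P (V @^-1` A `&` W @^-1` B) = (P (V @^-1` A) * P (W @^-1` B))%E.

(** Independence makes the joint law a product, so [W] can be integrated out first with [V] frozen.
    In the application [V] is the identity of the sample space into the coarser sigma-algebra
    generated by the other inputs. *)
Lemma integral_independent_eq0 (f : Y * Z -> R) (M : R) :
  measurable_fun setT f -> (forall z, `|f z| <= M) ->
  (forall y, (\int[distribution P W]_z (f (y, z))%:E = 0)%E) ->
  (\int[P]_w (f (V w, W w))%:E = 0)%E.
Proof.
move=> mf fM f0.
have mVW : measurable_fun setT (fun w => (V w, W w)).
  by apply/measurable_fun_pairP; split => /=; exact: measurable_funPT.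
pose J : {mfun Om >-> (Y * Z)%type} := mfun_Sub (mem_set mVW).
have mEf : measurable_fun setT (fun z => (f z)%:E) by exact/measurable_EFinP.
have mfJ : measurable_fun setT (fun w => f (V w, W w)).
  by have := measurableT_comp mf mVW.
have -> : (\int[P]_w (f (V w, W w))%:E = \int[distribution P J]_z (f z)%:E)%E.
  rewrite integral_distribution//.
  apply: (@bounded_integrable _ _ _ P (fun w => f (V w, W w)) M) => //.
  by rewrite [X in (X < _)%E]probability_setT ltry.
have -> : (\int[distribution P J]_z (f z)%:E =
    \int[distribution P V \x distribution P W]_z (f z)%:E)%E.
  apply: eq_measure_integral => A mA _; apply/esym.
  by apply: product_measure_unique.
rewrite -integral12_prod_meas1.
  rewrite (eq_integral (fun=> 0%E)) ?integral0// => y _; exact: f0.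
apply: (@bounded_integrable _ _ _ _ _ M) => //.
apply: (@le_lt_trans _ _ ((distribution P V \x distribution P W)%E (setT `*` setT))).
  by rewrite setXTT.
by rewrite product_measure1E// [X in (X * _)%E]probability_setT mul1e
  [X in (X < _)%E]probability_setT ltry.
Qed.

End IndependentFubini.

Section IndependentFamily.
Context d (Om : measurableType d) (R : realType) (P : probability Om R).
Variables (I : eqType) (F : I -> set (set Om)) (i0 : I).
Hypothesis indep : mutually_independent P F.
Hypothesis FI : forall i, setI_closed (F i).
Hypothesis FT : forall i, F i setT.
Hypothesis Fm : forall i, F i `<=` measurable.

Definition others : set (set Om) := [set A | exists2 i, i != i0 & F i A].

Let bcap (s : seq I) (B : I -> set Om) := \bigcap_(i in [set` s]) B i.

(** A class closed under intersection whose sigma-algebra contains that of [others], as uniqueness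
    of measures demands. *)
Definition other_cylinders : set (set Om) :=
  [set A | exists (s : seq I) (B : I -> set Om),
     [/\ i0 \notin s, forall i, F i (B i) & A = \bigcap_(i in [set` s]) B i]].

Let bcap_measurable s B : (forall i, F i (B i)) -> measurable (bcap s B).
Proof.
move=> FB; apply: fin_bigcap_measurable; first exact: finite_seq.
by move=> i _; apply: Fm; exact: FB.
Qed.

Let bcap_cons i s B : bcap (i :: s) B = B i `&` bcap s B.
Proof.
rewrite eqEsubset; split => [w h|w [h1 h2] j /=].
  split; first by apply: h; rewrite /= mem_head.
  by move=> j /= js; apply: h; rewrite /= inE js orbT.
by rewrite inE => /predU1P[->//|]; exact: h2.
Qed.

Let prob_bcap s B : uniq s -> (forall i, F i (B i)) ->
  fine (P (bcap s B)) = \prod_(i <- s) fine (P (B i)).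
Proof.
move=> us FB.
have -> : bcap s B = \bigcap_(a in [set a | (a < size s)%N]) B (nth i0 s a).
  rewrite eqEsubset; split => [w h a /= sa|w h i /= si].
    by apply: h => /=; exact: mem_nth.
  by have := h (index i s); rewrite /= index_mem nth_index// => /(_ si).
rewrite (@indep (size s) (nth i0 s) (fun a => B (nth i0 s a)))//.
- by rewrite (big_nth i0) big_mkord.
- by move=> a b sa sb /eqP; rewrite nth_uniq// => /eqP.
Qed.

Let fineP A : measurable A -> (fine (P A))%:E = P A.
Proof. by move=> mA; rewrite fineK// fin_num_measure. Qed.

Let indep_cylinder A B : other_cylinders A -> F i0 B ->
  P (A `&` B) = (P A * P B)%E.
Proof.
move=> [s [C [is0 FC ->]]] FB.
have is0' : i0 \notin undup s by rewrite mem_undup.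
have -> : \bigcap_(i in [set` s]) C i = bcap (undup s) C.
  by rewrite eqEsubset; split => w h i /= si; apply: h; rewrite /= ?mem_undup// -mem_undup.
pose C' i := if i == i0 then B else C i.
have FC' i : F i (C' i) by rewrite /C'; case: eqP => [->|].
have CC' : bcap (undup s) C = bcap (undup s) C'.
  apply: eq_bigcapr => i /= si; rewrite /C'; case: eqP => // ii0.
  by rewrite -ii0 si in is0'.
have e : bcap (undup s) C' `&` B = bcap (i0 :: undup s) C'.
  by rewrite bcap_cons /C' eqxx setIC.
rewrite CC' e -fineP; last exact: bcap_measurable.
rewrite prob_bcap//=; last by rewrite is0' undup_uniq.
rewrite big_cons -prob_bcap ?undup_uniq// {1}/C' eqxx EFinM muleC.
by rewrite !fineP//; [exact: (Fm FB)|exact: bcap_measurable].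
Qed.

Let cylinderI : setI_closed other_cylinders.
Proof.
move=> A A' [s [B [is0 FB ->]]] [s' [B' [is0' FB' ->]]].
pose C i := (if i \in s then B i else setT) `&` (if i \in s' then B' i else setT).
exists (s ++ s'), C; split.
- by rewrite mem_cat negb_or is0.
- by move=> i; apply: FI; [case: ifP => _ //; exact: FT|case: ifP => _ //; exact: FT].
- rewrite eqEsubset; split => w.
    move=> [h h'] i /=; rewrite mem_cat /C => _; split.
      by case: ifPn => // si; exact: h.
    by case: ifPn => // si; exact: h'.
  move=> h; split => i /= si.
    by have := h i; rewrite /= mem_cat si /C si => /(_ isT)[].
  by have := h i; rewrite /= mem_cat si orbT /C si => /(_ isT)[].
Qed.

Let sub_others : <<s others >> `<=` <<s other_cylinders >>.
Proof.
apply: smallest_sub; first exact: smallest_sigma_algebra.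
move=> A [i ii0 FA]; apply: sub_sigma_algebra.
exists [:: i], (fun j => if j == i then A else setT); split.
- by rewrite inE eq_sym.
- by move=> j; case: eqP => [->//|_]; exact: FT.
- rewrite eqEsubset; split => [w Aw j /=|w h]; first by rewrite inE => ->.
  by have := h i; rewrite /= eqxx inE eqxx; apply.
Qed.

Let cylinder_measurable : other_cylinders `<=` measurable.
Proof. by move=> A [s [B [_ FB ->]]]; exact: bcap_measurable. Qed.

Lemma others_measurable : <<s others >> `<=` measurable.
Proof.
apply: smallest_sub; first exact: sigma_algebra_measurable.
by move=> A [i _ /Fm].
Qed.

(** For fixed [B] both sides are finite measures in [A], namely a restriction and a multiple of [P],
    and they agree on the cylinders. *)
Lemma independent_others A B : <<s others >> A -> F i0 B ->
  P (A `&` B) = (P A * P B)%E.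
Proof.
move=> /sub_others sA FB; have mB := Fm FB.
pose r := NngNum (fine_ge0 (measure_ge0 P B)).
have e : mrestr P mB A = mscale r P A.
  apply: (@g_sigma_algebra_measure_unique _ _ _ other_cylinders cylinder_measurable
    (fun=> setT)) => //.
  - move=> _; exists [::], (fun=> setT); split => //.
    by rewrite eqEsubset; split.
  - by rewrite bigcup_const.
  - move=> A' cA'; apply: (etrans (indep_cylinder cA' FB)).
    by rewrite muleC -[in LHS](fineP mB).
  - move=> _; apply: (@le_lt_trans _ _ (P (setT `&` B))) => //.
    by rewrite setTI -ge0_fin_numE// fin_num_measure.
by apply: (etrans e); rewrite muleC -[in RHS](fineP mB).
Qed.

End IndependentFamily.

(** * Martingales of the event chain *)

Lemma measurable_boolr d (X : measurableType d) (R : realType) (b : X -> bool) :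
  measurable_fun setT b -> measurable_fun setT (fun x => (b x)%:R : R).
Proof.
move=> mb; exact: (@measurable_dmeas _ _ bool _ (measurableTypeR R) b
  (fun b : bool => (b : nat)%:R) (countableP _) (dmeas_bool mb)).
Qed.

Lemma measurable_clock_term d (X : measurableType d) (R : realType) N
    (th : X -> clock N -> nat -> \bar R) U q r n c k t :
  (forall c k, measurable_fun setT (fun x => th x c k)) ->
  (forall k, measurable_fun setT (fun x => U x k)) -> dmeas q ->
  measurable_fun setT (fun x => clock_term (th x) (U x) (q x) r n c k t).
Proof.
move=> mth mU mq; rewrite /clock_term.
have md m : measurable_fun setT (fun x => (r * dtime (th x) (U x) (q x) k t) ^+ m).
  apply: measurable_funX; apply: measurable_funM; first exact: measurable_cst.
  exact: measurable_dtime.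
apply: measurable_funB; last exact: md.
apply: measurable_funM.
  by apply: measurable_funM; [exact: measurable_cst|exact: md].
apply: measurable_boolr; apply: measurable_and; last exact: measurable_gtime_le.
exact: (@measurable_dmeas _ _ _ _ _ _ (fun c' : clock N => c' == c)
  (countableP _) (dmeas_gclock mth mU mq k)).
Qed.

(** * Expectations of bounded random variables *)

Section BoundedMeasurable.
Context d (Om : measurableType d) (R : realType) (P : probability Om R).
Implicit Types f g : Om -> R.

Definition bmf f := measurable_fun setT f /\ exists M, forall w, `|f w| <= M.

Lemma bmf_int f : bmf f -> P.-integrable setT (EFin \o f).
Proof.
move=> [mf [M fM]]; apply: (bounded_integrable _ mf fM).
by rewrite [X in (X < _)%E]probability_setT ltry.
Qed.

Lemma bmf_cst r : bmf (fun _ => r).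
Proof. by split; [exact: measurable_cst|exists `|r|]. Qed.

Lemma bmfD f g : bmf f -> bmf g -> bmf (fun w => f w + g w).
Proof.
move=> [mf [M fM]] [mg [M' gM]]; split; first exact: measurable_funD.
by exists (M + M') => w; apply: le_trans (ler_normD _ _) _; exact: lerD.
Qed.

Lemma bmfM f g : bmf f -> bmf g -> bmf (fun w => f w * g w).
Proof.
move=> [mf [M fM]] [mg [M' gM]]; split; first exact: measurable_funM.
by exists (M * M') => w; rewrite normrM; exact: ler_pM.
Qed.

Lemma bmfX f n : bmf f -> bmf (fun w => f w ^+ n).
Proof.
move=> bf; elim: n => [|n IH]; first by under eq_fun do rewrite expr0; exact: bmf_cst.
by under eq_fun do rewrite exprS; exact: bmfM.
Qed.

Lemma bmf_sum (I : Type) (s : seq I) (F : I -> Om -> R) :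
  (forall i, bmf (F i)) -> bmf (fun w => \sum_(i <- s) F i w).
Proof.
move=> bF; elim: s => [|i s IH].
  by under eq_fun do rewrite big_nil; exact: bmf_cst.
by under eq_fun do rewrite big_cons; exact: bmfD.
Qed.

Lemma bmf_bool (b : Om -> bool) : measurable_fun setT b -> bmf (fun w => (b w)%:R).
Proof.
move=> mb; split.
  exact: measurable_boolr.
by exists 1 => w; case: (b w); rewrite ?normr1 ?normr0.
Qed.

Definition Ex f : R := \int[P]_w f w.

Lemma ExD f g : bmf f -> bmf g -> Ex (fun w => f w + g w) = Ex f + Ex g.
Proof. by move=> bf bg; apply: RintegralD => //; exact: bmf_int. Qed.

Lemma ExB f g : bmf f -> bmf g -> Ex (fun w => f w - g w) = Ex f - Ex g.
Proof. by move=> bf bg; apply: RintegralB => //; exact: bmf_int. Qed.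

Lemma ExZ f r : bmf f -> Ex (fun w => r * f w) = r * Ex f.
Proof. by move=> bf; apply: RintegralZl => //; exact: bmf_int. Qed.

Lemma Ex_cst r : Ex (fun _ => r) = r.
Proof. by rewrite /Ex Rintegral_cst// [X in fine X]probability_setT mulr1. Qed.

Lemma Ex_sum (I : Type) (s : seq I) (F : I -> Om -> R) : (forall i, bmf (F i)) ->
  Ex (fun w => \sum_(i <- s) F i w) = \sum_(i <- s) Ex (F i).
Proof.
move=> bF; elim: s => [|i s IH].
  by rewrite big_nil -[RHS](Ex_cst 0); congr Ex; apply/funext => w; rewrite big_nil.
rewrite big_cons -IH -ExD//; last exact: bmf_sum.
by congr Ex; apply/funext => w; rewrite big_cons.
Qed.

Lemma le_Ex f g : bmf f -> bmf g -> (forall w, f w <= g w) -> Ex f <= Ex g.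
Proof. by move=> bf bg fg; apply: le_Rintegral => //; exact: bmf_int. Qed.

Lemma second_moment_bound f (a : R) : 0 < a -> bmf f ->
  (P [set w | (a <= `|f w|)%R] <= (Ex (fun w => f w ^+ 2) / a ^+ 2)%:E)%E.
Proof.
move=> a0 bf.
have mA : measurable [set w | (a <= `|f w|)%R].
  rewrite (_ : [set w | _] = (fun w => a <= `|f w|) @^-1` [set true]); last first.
    by apply/seteqP; split.
  apply: dmeas_bool; apply: measurable_fun_ler; first exact: measurable_cst.
  by apply: measurableT_comp => //; case: bf.
pose b w : R := (a <= `|f w|)%R%:R.
have bb : bmf b.
  apply: bmf_bool; apply: measurable_fun_ler; first exact: measurable_cst.
  by apply: measurableT_comp => //; case: bf.
have PE : P [set w | (a <= `|f w|)%R] = (Ex b)%:E.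
  rewrite /Ex /Rintegral (eq_integral (fun w => (\1_[set w | (a <= `|f w|)%R] w)%:E)).
    by rewrite integral_indic// setIT fineK// fin_num_measure.
  move=> w _; rewrite /b indicE; congr (_%:R)%:E.
  by case: (boolP (a <= _)) => h; [rewrite mem_set|rewrite memNset//; exact/negP].
rewrite PE lee_fin ler_pdivlMr ?exprn_gt0// mulrC -ExZ//.
apply: le_Ex; [by apply: bmfM => //; exact: bmf_cst|exact: bmfX|].
move=> w; rewrite /b; case: (leP a `|f w|) => h; last by rewrite mulr0 sqr_ge0.
rewrite mulr1 -(real_normK (num_real (f w))) ler_pXn2r// nnegrE ?normr_ge0//.
exact: ltW.
Qed.

End BoundedMeasurable.

Section RtimeBounds.
Variables (R : realType) (N : nat) (th : clock N -> nat -> \bar R).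
Variables (U : nat -> R) (q : 'I_N -> nat).
Hypothesis th0 : forall c, (0 <= th c 0%N)%E.
Hypothesis thS : forall c k, (th c k <= th c k.+1)%E.

Lemma rtimeE k t : 0 <= t -> (rtime th U q k t)%:E = Order.min (ptime th U q k) t%:E.
Proof.
move=> t0; rewrite /rtime fineK// fin_numElt; apply/andP; split.
  rewrite lt_min ltNyr andbT; apply: lt_le_trans (ptime_ge0 U q th0 thS k).
  exact: ltNyr.
by apply: (@le_lt_trans _ _ t%:E); [rewrite ge_min lexx orbT|rewrite ltry].
Qed.

Lemma rtime0 t : 0 <= t -> rtime th U q 0 t = 0.
Proof. by move=> t0; rewrite /rtime /= min_l// lee_fin. Qed.

Lemma rtime_ge0 k t : 0 <= t -> 0 <= rtime th U q k t.
Proof.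
by move=> t0; rewrite -lee_fin rtimeE// le_min (ptime_ge0 U q th0 thS) lee_fin.
Qed.

Lemma rtime_le k t : 0 <= t -> rtime th U q k t <= t.
Proof. by move=> t0; rewrite -lee_fin rtimeE// ge_min lexx orbT. Qed.

Lemma rtime_homo j k t : 0 <= t -> (j <= k)%N -> rtime th U q j t <= rtime th U q k t.
Proof.
move=> t0 jk; rewrite -lee_fin !rtimeE// le_min !ge_min lexx orbT andbT.
by rewrite (ptime_homo U q th0 thS jk).
Qed.

Lemma dtime_ge0 k t : 0 <= t -> 0 <= dtime th U q k t.
Proof. by move=> t0; rewrite subr_ge0 rtime_homo. Qed.

Lemma dtime_le k t : 0 <= t -> dtime th U q k t <= t.
Proof.
move=> t0; apply: le_trans (rtime_le k.+1 t0).
by rewrite lerBlDr lerDl rtime_ge0.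
Qed.

Lemma clock_term_bound r n c k t : 0 <= t -> 0 <= r ->
  `|clock_term th U q r n c k t| <= n.+1%:R * (r * t) ^+ n + (r * t) ^+ n.+1.
Proof.
move=> t0 r0; rewrite /clock_term.
have d0 := dtime_ge0 k t0; have d1 := dtime_le k t0.
have rd m : (r * dtime th U q k t) ^+ m <= (r * t) ^+ m.
  by apply: lerXn2r; rewrite ?nnegrE ?mulr_ge0//; exact: ler_wpM2l.
have rd0 m : 0 <= (r * dtime th U q k t) ^+ m by rewrite exprn_ge0// mulr_ge0.
apply: le_trans (ler_normB _ _) _; apply: lerD; last by rewrite ger0_norm.
rewrite normrM [X in _ * X]ger0_norm// -[leRHS]mulr1.
apply: ler_pM => //; last by case: andb.
by rewrite ger0_norm ?mulr_ge0// ler_wpM2l.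
Qed.

End RtimeBounds.

Section Core.
Context d (Om : measurableType d) (R : realType) (P : probability Om R).
Variables (lam p : R) (N : nat) (Q0 : Om -> 'I_N -> nat).
Variables (E : clock N -> nat -> Om -> R) (U : nat -> Om -> R).
Hypothesis inp : system_inputs P Q0 E U.
Hypothesis Epos : forall c k w, 0 < E c k w.

(** [{classic _}] equips the sources with the equality test that the lemmas on independent families
    ask of their index type. *)
Let F (s : {classic (source N)}) : set (set Om) :=
  match (s : source N) with
  | SrcQ0 => [set Q0 @^-1` B | B in [set: set ('I_N -> nat)]]
  | SrcE c k => [set E c k @^-1` B | B in [set B : set R | measurable B]]
  | SrcU k => [set U k @^-1` B | B in [set B : set R | measurable B]]
  end.

Let Findep : mutually_independent P F.
Proof. by have [_ [_ [_ h]]] := inp. Qed.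

Let mE c k : measurable_fun setT (E c k).
Proof. by have [_ [h _]] := inp; have [] := h c k. Qed.

Let mU k : measurable_fun setT (U k).
Proof. by have [_ [_ [h _]]] := inp; have [] := h k. Qed.

Let mQ : dmeas Q0.
Proof. by have [h _] := inp. Qed.

Let FI s : setI_closed (F s).
Proof.
case: s => [|c k|k] _ _ [B mB <-] [B' mB' <-]; rewrite -preimage_setI.
- by exists (B `&` B').
- by exists (B `&` B') => //; exact: measurableI.
- by exists (B `&` B') => //; exact: measurableI.
Qed.

Let FT s : F s setT.
Proof. by case: s => [|c k|k]; exists setT => //=; exact: measurableT. Qed.

Let Fm s : F s `<=` measurable.
Proof.
case: s => [|c k|k] _ [B mB <-].
- exact: (dmeas_preimage B (@countable_fun_nat _) mQ).
- by rewrite -[_ @^-1` _]setTI; exact: mE.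
- by rewrite -[_ @^-1` _]setTI; exact: mU.
Qed.

Definition tickw w := tick lam p (fun c k => E c k w).
Definition Uw w := fun k => U k w.

Section FreshClock.
Variables (c : clock N) (l k n : nat) (t M : R).
Variable G : (clock N -> nat -> \bar R) -> (nat -> R) -> ('I_N -> nat) -> R.
Hypothesis r0 : 0 < rate lam p c.
Hypothesis t0 : 0 <= t.
Hypothesis Ghist : forall U q th th',
  (forall j, (j <= k)%N -> gstate th U q j = gstate th' U q j) ->
  (forall j, (j < k)%N -> gclock th U q j = gclock th' U q j /\
     gtime th U q j = gtime th' U q j) ->
  G th U q = G th' U q.
Hypothesis Gmeas : forall d' (X : measurableType d') (E' : X -> clock N -> nat -> R)
    (U' : X -> nat -> R) (q' : X -> 'I_N -> nat),
  (forall c k, measurable_fun setT (fun x => E' x c k)) ->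
  (forall k, measurable_fun setT (fun x => U' x k)) -> dmeas q' ->
  measurable_fun setT (fun x => G (tick lam p (E' x)) (U' x) (q' x)).
Hypothesis Gbound : forall (E : clock N -> nat -> R) U q,
  (forall c k, 0 <= E c k) -> `|G (tick lam p E) U q| <= M.

Let i0 : {classic (source N)} := SrcE c l.
Let Y := g_sigma_algebraType (others F i0).
Let Z : measurableType _ := measurableTypeR R.

Let mid : measurable_fun setT (id : Om -> Y).
Proof.
by move=> _ A mA; rewrite setTI preimage_id; exact: (others_measurable Fm mA).
Qed.

Let V : {mfun Om >-> Y} := mfun_Sub (mem_set mid).

Let mW : @measurable_fun _ _ Om Z setT (E c l).
Proof. exact: mE. Qed.

Let W : {mfun Om >-> Z} := @mfun_Sub _ _ Om Z (E c l) (mem_set mW).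

(** On the product space the second component is an arbitrary real; the absolute value keeps the
    replaced input nonnegative there and changes nothing at the actual input, which is positive. *)
Let f (z : Y * Z) : R :=
  inner_term lam p (fun c k => E c k z.1) (Uw z.1) (Q0 z.1) c l k n t
    (fun th => G th (Uw z.1) (Q0 z.1)) `|z.2|.

(** The replaced input is read from the second component; all the others are measurable for the
    sigma-algebra that excludes it. *)
Let mE' c' j : measurable_fun [set: (Y * Z)%type]
  (fun z : Y * Z => replace_input (fun c k => E c k z.1) c l `|z.2| c' j).
Proof.
rewrite /replace_input; case e : ((c' == c) && (j == l)).
  by apply: measurableT_comp => //; exact: measurable_snd.
apply: (measurableT_comp (f := (E c' j : Y -> R))); last exact: measurable_fst.
move=> _ B mB; rewrite setTI; apply: sub_sigma_algebra.
exists (SrcE c' j : {classic (source N)}); last by exists B.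
by apply/eqP => -[ec ej]; move: e; rewrite ec ej !eqxx.
Qed.

Let mU' j : measurable_fun [set: (Y * Z)%type] (fun z : Y * Z => Uw z.1 j).
Proof.
apply: (measurableT_comp (f := (U j : Y -> R))); last exact: measurable_fst.
move=> _ B mB; rewrite setTI; apply: sub_sigma_algebra.
exists (SrcU N j : {classic (source N)}); last by exists B.
by apply/eqP.
Qed.

Let mQ' : dmeas (fun z : Y * Z => Q0 z.1).
Proof.
move=> q.
rewrite -[_ @^-1` _]setTI (_ : _ @^-1` _ = fst @^-1` (Q0 @^-1` [set q]))//.
apply: (@measurable_fst _ _ Y Z) => //; apply: sub_sigma_algebra.
exists (SrcQ0 N : {classic (source N)}); last by exists [set q].
by apply/eqP.
Qed.

Let mf : measurable_fun setT f.
Proof.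
have mth c' j : measurable_fun [set: (Y * Z)%type]
    (fun z : Y * Z => tick lam p (replace_input (fun c k => E c k z.1) c l `|z.2|) c' j).
  exact: measurable_tick.
rewrite /f /inner_term; apply: measurable_funM; first apply: measurable_funM.
- exact: (@measurable_dmeas _ _ _ _ (measurableTypeR R) _
    (fun st : sys_state N => ((st.1 c == l) : nat)%:R) (@countable_sys_state N)
    (dmeas_gstate mth mU' mQ' k)).
- exact: Gmeas.
- exact: measurable_clock_term.
Qed.

Let E0' (z : Y * Z) c' j : 0 <= replace_input (fun c k => E c k z.1) c l `|z.2| c' j.
Proof. by rewrite /replace_input; case: ifP => // _; apply: ltW; exact: Epos. Qed.

Let r := rate lam p c.
Let K : R := M * (n.+1%:R * (r * t) ^+ n + (r * t) ^+ n.+1).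

Let fbound z : `|f z| <= K.
Proof.
rewrite /f /inner_term normrM; apply: ler_pM => //.
  rewrite normrM -[M]mul1r; apply: ler_pM => //; last exact: (Gbound _ _ (E0' z)).
  by case: eqP => _; rewrite ?normr1 ?normr0.
apply: clock_term_bound => //; last exact: ltW.
- by move=> c'; apply: tick_ge0; exact: E0'.
- by move=> c' j; apply: tickS; exact: E0'.
Qed.

(** By independence the [l]-th input is integrated first. For frozen others the integrand is almost
    everywhere a multiple of [residual_gain], whose integral against the exponential density is
    zero. *)
Lemma clock_term_fresh :
  Ex P (fun w => ((gstate (tickw w) (Uw w) (Q0 w) k).1 c == l)%:R *
    G (tickw w) (Uw w) (Q0 w) * clock_term (tickw w) (Uw w) (Q0 w) r n c k t) = 0.
Proof.
have e w : replace_input (fun c k => E c k w) c l `|E c l w| = (fun c k => E c k w).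
  apply/funext => c'; apply/funext => j; rewrite /replace_input.
  by case: ifP => // /andP[/eqP-> /eqP->]; rewrite gtr0_norm.
have fE w : ((gstate (tickw w) (Uw w) (Q0 w) k).1 c == l)%:R *
    G (tickw w) (Uw w) (Q0 w) * clock_term (tickw w) (Uw w) (Q0 w) r n c k t =
    f (V w, W w).
  rewrite -[RHS]/(inner_term lam p (fun c k => E c k w) (Uw w) (Q0 w) c l k n t
    (fun th => G th (Uw w) (Q0 w)) `|E c l w|).
  by rewrite /inner_term e.
rewrite (_ : (fun w => _) = (fun w => f (V w, W w))); last exact/funext.
rewrite /Ex /Rintegral (@integral_independent_eq0 _ _ _ _ _ _ _ _ V W _ f K)//.
  move=> A B mA mB; apply: (independent_others Findep FI FT Fm mA).
  by exists B.
move=> y.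
have [a [b [g [a0 ab H]]]] := @inner_term_gain R lam p N (fun c k => E c k y)
  (Uw y) (Q0 y) c l k n t (fun th => G th (Uw y) (Q0 y))
  (fun c k => ltW (Epos c k y)) r0 (fun th th' => @Ghist (Uw y) (Q0 y) th th').
have mfy : measurable_fun [set: Z] (fun z => f (y, z)).
  apply: (measurableT_comp mf); exact: pair1_measurable.
have H' x : 0 < x -> x != a -> x != b -> f (y, x) = g * residual_gain n a b x.
  by move=> x0 xa xb; rewrite /f /= gtr0_norm//; exact: H.
have [_ [hE _]] := inp; have [_ dE] := hE c l.
rewrite (@integral_density R (distribution P W) (exponential_pdf 1)).
- exact: integral_residual_gain a0 ab mfy H'.
- exact: measurable_exponential_pdf.
- by move=> x; apply: exponential_pdf_ge0.
- by apply: integrable_exponential_pdf.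
- by move=> A mA; exact: dE.
- apply: (@bounded_integrable _ _ _ _ _ K) => //.
  by rewrite [X in (X < _)%E]probability_setT ltry.
Qed.

End FreshClock.

(** The number of ticks of [c] before event [k] is exactly one [l <= k], so summing over [l] removes
    the indicator. Measurability of [G] is quantified over all spaces because it is used both on
    [Om] and on the product that separates one input. *)
Lemma clock_term_orth c k n t M
    (G : (clock N -> nat -> \bar R) -> (nat -> R) -> ('I_N -> nat) -> R) :
  0 < rate lam p c -> 0 <= t ->
  (forall U q th th',
    (forall j, (j <= k)%N -> gstate th U q j = gstate th' U q j) ->
    (forall j, (j < k)%N -> gclock th U q j = gclock th' U q j /\
       gtime th U q j = gtime th' U q j) ->
    G th U q = G th' U q) ->
  (forall d' (X : measurableType d') (E' : X -> clock N -> nat -> R)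
    (U' : X -> nat -> R) (q' : X -> 'I_N -> nat),
    (forall c k, measurable_fun setT (fun x => E' x c k)) ->
    (forall k, measurable_fun setT (fun x => U' x k)) -> dmeas q' ->
    measurable_fun setT (fun x => G (tick lam p (E' x)) (U' x) (q' x))) ->
  (forall (E : clock N -> nat -> R) U q,
    (forall c k, 0 <= E c k) -> `|G (tick lam p E) U q| <= M) ->
  Ex P (fun w => G (tickw w) (Uw w) (Q0 w) *
    clock_term (tickw w) (Uw w) (Q0 w) (rate lam p c) n c k t) = 0.
Proof.
move=> r0 t0 Gh Gm Gb.
pose g l w := ((gstate (tickw w) (Uw w) (Q0 w) k).1 c == l)%:R *
    G (tickw w) (Uw w) (Q0 w) * clock_term (tickw w) (Uw w) (Q0 w) (rate lam p c) n c k t.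
have mth c' j : measurable_fun setT (fun w => tickw w c' j).
  by apply: measurable_tick => ? ?; exact: mE.
have bg l : bmf (g l).
  apply: bmfM; first apply: bmfM.
  - apply: bmf_bool.
    exact: (@measurable_dmeas _ _ _ _ _ _ (fun st : sys_state N => st.1 c == l)
      (@countable_sys_state N) (dmeas_gstate mth mU mQ k)).
  - split; first by apply: Gm => // ? ?; exact: mE.
    by exists M => w; apply: Gb => c' j; exact: ltW.
  - split; first exact: measurable_clock_term.
    exists (n.+1%:R * (rate lam p c * t) ^+ n + (rate lam p c * t) ^+ n.+1) => w.
    apply: clock_term_bound => //; last exact: ltW.
    + by move=> c'; apply: tick_ge0 => ? ?; exact: ltW.
    + by move=> c' j; apply: tickS => ? ?; exact: ltW.
rewrite (_ : (fun w => _) = (fun w => \sum_(l < k.+1) g l w)).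
  by rewrite Ex_sum// big1// => l _; exact: (clock_term_fresh _ _ r0 t0 Gh Gm Gb).
apply/funext => w; rewrite /g -!mulr_suml.
have ck : ((gstate (tickw w) (Uw w) (Q0 w) k).1 c < k.+1)%N by rewrite ltnS gcnt_le.
rewrite (bigD1 (Ordinal ck))//= eqxx big1 ?addr0 ?mul1r// => l ln.
by case: eqP => // e; move: ln; rewrite -val_eqE /= e eqxx.
Qed.

End Core.

Section Martingale.
Variables (R : realType) (lam p : R) (N : nat).
Variable h : sys_state N -> clock N -> R.

Definition hrate st : R := \sum_(c : clock N) rate lam p c * h st c.

(* Martingale increment of the additive functional of the chain with jumps [h];
   the compensator is integrated over the part of the sojourn before [t]. *)
Definition mstep th U q k (t : R) : R :=
  h (gstate th U q k) (gclock th U q k) * (gtime th U q k <= t%:E)%E%:R -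
  hrate (gstate th U q k) * dtime th U q k t.

Definition mart th U q n t : R := \sum_(k < n) mstep th U q k t.

Definition total_rate : R := \sum_(c : clock N) rate lam p c.

(** For [n = 0] the clock terms are the compensated ticks of the individual clocks, and only the
    selected clock contributes a jump. *)
Lemma mstepE th U q k t : mstep th U q k t =
  \sum_(c : clock N) h (gstate th U q k) c * clock_term th U q (rate lam p c) 0 c k t.
Proof.
rewrite /mstep /clock_term.
under [RHS]eq_bigr do rewrite !expr0 expr1 !mul1r mulrBr.
rewrite sumrB; congr (_ - _).
  rewrite (bigD1 (gclock th U q k))//= eqxx /= big1 ?addr0// => c cn.
  by rewrite eq_sym (negbTE cn) mulr0.
by rewrite /hrate mulr_suml; apply: eq_bigr => c _; rewrite mulrA (mulrC (h _ _)).
Qed.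

(** This qualifies [mart] as a weight [G] in [clock_term_orth]. *)
Lemma mart_hist U q th th' k t :
  (forall j, (j <= k)%N -> gstate th U q j = gstate th' U q j) ->
  (forall j, (j < k)%N -> gclock th U q j = gclock th' U q j /\
     gtime th U q j = gtime th' U q j) ->
  mart th U q k t = mart th' U q k t.
Proof.
move=> st ti; have pt j : (j <= k)%N -> ptime th U q j = ptime th' U q j.
  by case: j => // j jk; rewrite /ptime (ti j jk).2.
apply: eq_bigr => j _; rewrite /mstep /dtime /rtime.
by rewrite st ?(ltnW (ltn_ord j))// (ti j _).1// (ti j _).2// !pt// ltnW.
Qed.

Hypothesis rate0 : forall c : clock N, 0 <= rate lam p c.
Hypothesis h1 : forall st c, `|h st c| <= 1.

Lemma total_rate_ge0 : 0 <= total_rate.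
Proof. by apply: sumr_ge0. Qed.

Lemma hrate_le st : `|hrate st| <= total_rate.
Proof.
apply: le_trans (ler_norm_sum _ _ _) _; apply: ler_sum => c _.
by rewrite normrM (ger0_norm (rate0 c)); apply: ler_piMr.
Qed.

Lemma mstep_le th U q k t : 0 <= t ->
  (forall c, (0 <= th c 0%N)%E) -> (forall c k, (th c k <= th c k.+1)%E) ->
  `|mstep th U q k t| <= 1 + total_rate * dtime th U q k t.
Proof.
move=> t0 th0 thS; apply: le_trans (ler_normB _ _) _; apply: lerD.
  rewrite normrM -[leRHS]mul1r; apply: ler_pM => //.
  by case: (_ <= _)%E; rewrite ?normr1 ?normr0.
rewrite normrM; apply: ler_pM => //; first exact: hrate_le.
by rewrite ger0_norm//; exact: dtime_ge0.
Qed.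

Lemma mart_le th U q n t : 0 <= t ->
  (forall c, (0 <= th c 0%N)%E) -> (forall c k, (th c k <= th c k.+1)%E) ->
  `|mart th U q n t| <= n%:R * (1 + total_rate * t).
Proof.
move=> t0 th0 thS; apply: le_trans (ler_norm_sum _ _ _) _.
rewrite -[n in n%:R]card_ord -sum1_card natr_sum mulr_suml.
apply: ler_sum => k _; rewrite mul1r; apply: le_trans (mstep_le _ _ _ t0 th0 thS) _.
by rewrite lerD2l; apply: ler_wpM2l; [exact: total_rate_ge0|exact: dtime_le].
Qed.

Lemma measurable_mstep d (X : measurableType d) (th : X -> clock N -> nat -> \bar R)
    U q k t :
  (forall c k, measurable_fun setT (fun x => th x c k)) ->
  (forall k, measurable_fun setT (fun x => U x k)) -> dmeas q ->
  measurable_fun setT (fun x => mstep (th x) (U x) (q x) k t).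
Proof.
move=> mth mU mq; under eq_fun do rewrite mstepE.
apply: measurable_sum => c; apply: measurable_funM; last exact: measurable_clock_term.
exact: (@measurable_dmeas _ _ _ _ (measurableTypeR R) _ (fun st => h st c)
  (@countable_sys_state N) (dmeas_gstate mth mU mq k)).
Qed.

Lemma measurable_mart d (X : measurableType d) (th : X -> clock N -> nat -> \bar R)
    U q n t :
  (forall c k, measurable_fun setT (fun x => th x c k)) ->
  (forall k, measurable_fun setT (fun x => U x k)) -> dmeas q ->
  measurable_fun setT (fun x => mart (th x) (U x) (q x) n t).
Proof. by move=> mth mU mq; apply: measurable_sum => k; exact: measurable_mstep. Qed.

End Martingale.

(** * Second moments of the martingales *)

Section Variance.
Context d (Om : measurableType d) (R : realType) (P : probability Om R).
Variables (lam p : R) (N : nat) (Q0 : Om -> 'I_N -> nat).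
Variables (E : clock N -> nat -> Om -> R) (U : nat -> Om -> R).
Hypothesis inp : system_inputs P Q0 E U.
Hypothesis Epos : forall c k w, 0 < E c k w.
Hypothesis rate0 : forall c : clock N, 0 <= rate lam p c.

Let th w := tickw lam p E w.
Let u w := Uw U w.

Let mth c k : measurable_fun setT (fun w => th w c k).
Proof.
apply: measurable_tick => c' j.
by have [_ [hE _]] := inp; have [] := hE c' j.
Qed.

Let mu k : measurable_fun setT (fun w => u w k).
Proof. by have [_ [_ [hU _]]] := inp; have [] := hU k. Qed.

Let mq : dmeas Q0.
Proof. by have [] := inp. Qed.

Let th0 w c : (0 <= th w c 0%N)%E.
Proof. by apply: tick_ge0 => c' j; exact: ltW. Qed.

Let thS w c k : (th w c k <= th w c k.+1)%E.
Proof. by apply: tickS => c' j; exact: ltW. Qed.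

Let Rt := total_rate lam p N.

Let Rt0 : 0 <= Rt. Proof. exact: total_rate_ge0. Qed.

Let ind c k t w : R := ((gclock (th w) (u w) (Q0 w) k == c) &&
  (gtime (th w) (u w) (Q0 w) k <= t%:E)%E)%:R.

Let dt k t w := dtime (th w) (u w) (Q0 w) k t.

Let b_ind c k t : bmf (ind c k t).
Proof.
apply: bmf_bool; apply: measurable_and; last exact: measurable_gtime_le.
exact: (@measurable_dmeas _ _ _ _ _ _ (fun c' : clock N => c' == c)
  (countableP _) (dmeas_gclock mth mu mq k)).
Qed.

Let b_dt k t : 0 <= t -> bmf (dt k t).
Proof.
move=> t0; split; first exact: measurable_dtime.
exists t => w; rewrite ger0_norm; first exact: dtime_le.
exact: dtime_ge0.
Qed.

Let ind0 c k t w : rate lam p c = 0 -> ind c k t w = 0.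
Proof.
move=> r0; rewrite /ind; case: eqP => //= e.
by rewrite /gtime e /th /tickw /tick r0 ltxx leye_eq.
Qed.

Let b_clock r n c k t : 0 <= t -> 0 <= r ->
  bmf (fun w => clock_term (th w) (u w) (Q0 w) r n c k t).
Proof.
move=> t0 r0; split; first exact: measurable_clock_term.
by exists (n.+1%:R * (r * t) ^+ n + (r * t) ^+ n.+1) => w; exact: clock_term_bound.
Qed.

Let Ex_clock n c k t : 0 < rate lam p c -> 0 <= t ->
  Ex P (fun w => clock_term (th w) (u w) (Q0 w) (rate lam p c) n c k t) = 0.
Proof.
move=> r0 t0.
have := @clock_term_orth _ _ _ P lam p N Q0 E U inp Epos c k n t 1
  (fun _ _ _ => 1) r0 t0 _ _ _.
under eq_fun do rewrite mul1r; apply => // ? ? ?.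
by rewrite normr1.
Qed.

(** The case [n = 0] identifies rate times mean sojourn with the probability that the clock causes
    event [k] by time [t]; these events are disjoint, so the sum over clocks is at most 1. *)
Lemma Ex_dtime k t : 0 <= t -> Rt * Ex P (dt k t) <= 1.
Proof.
move=> t0; have H c : rate lam p c * Ex P (dt k t) = Ex P (ind c k t).
  have := rate0 c; rewrite le_eqVlt => /predU1P[r0|r0].
    rewrite -r0 mul0r -[LHS](Ex_cst P 0); congr Ex; apply/funext => w.
    by rewrite ind0.
  have := Ex_clock 0 k r0 t0.
  rewrite /clock_term; under eq_fun do rewrite expr0 expr1 !mul1r.
  rewrite (_ : (fun w => _) = (fun w => ind c k t w - rate lam p c * dt k t w))//.
  rewrite ExB//; last by apply: bmfM; [exact: bmf_cst|exact: b_dt].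
  by rewrite ExZ; [lra|exact: b_dt].
rewrite /Rt /total_rate mulr_suml; under eq_bigr do rewrite H.
rewrite -Ex_sum// -[leRHS](Ex_cst P 1); apply: le_Ex.
- exact: bmf_sum.
- exact: bmf_cst.
- move=> w; rewrite (bigD1 (gclock (th w) (u w) (Q0 w) k))//= big1 ?addr0.
    by rewrite /ind; case: andb.
  by move=> c cn; rewrite /ind eq_sym (negbTE cn).
Qed.

(** The case [n = 1] equates rate times the mean of [dt ^ 2] with twice the mean of [dt] on the
    event that the clock rings. Summing over clocks gives at most twice the mean of [dt], and
    [Ex_dtime] absorbs the second factor of the total rate. *)
Lemma Ex_dtime_sqr k t : 0 <= t -> Rt ^+ 2 * Ex P (fun w => dt k t w ^+ 2) <= 2.
Proof.
move=> t0; have H c : rate lam p c * Ex P (fun w => dt k t w ^+ 2) =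
    2 * Ex P (fun w => dt k t w * ind c k t w).
  have := rate0 c; rewrite le_eqVlt => /predU1P[r0|r0].
    rewrite -r0 mul0r -[LHS](Ex_cst P 0) -ExZ; last by apply: bmfM => //; exact: b_dt.
    by congr Ex; apply/funext => w; rewrite ind0// !mulr0.
  have := Ex_clock 1 k r0 t0; rewrite /clock_term.
  rewrite (_ : (fun w => _) = (fun w => 2 * rate lam p c * (dt k t w * ind c k t w) -
     rate lam p c ^+ 2 * dt k t w ^+ 2)); last first.
    by apply/funext => w; rewrite -/(ind c k t w) -/(dt k t w); ring.
  rewrite ExB; last 2 first.
  - by apply: bmfM; [exact: bmf_cst|apply: bmfM => //; exact: b_dt].
  - by apply: bmfM; [exact: bmf_cst|apply: bmfX; exact: b_dt].
  rewrite !ExZ; last 2 first.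
  - by apply: bmfX; exact: b_dt.
  - by apply: bmfM => //; exact: b_dt.
  by move=> h; apply: (mulfI (lt0r_neq0 r0)); move: h; lra.
have e : Rt * Ex P (fun w => dt k t w ^+ 2) <= 2 * Ex P (dt k t).
  rewrite /Rt /total_rate mulr_suml; under eq_bigr do rewrite H.
  rewrite -mulr_sumr ler_pM2l// -Ex_sum; last by move=> c; apply: bmfM => //; exact: b_dt.
  apply: le_Ex; [by apply: bmf_sum => c; apply: bmfM => //; exact: b_dt|exact: b_dt|].
  move=> w; rewrite (bigD1 (gclock (th w) (u w) (Q0 w) k))//= big1 ?addr0.
    by apply: ler_piMr; [exact: dtime_ge0|rewrite /ind; case: andb].
  by move=> c cn; rewrite /ind eq_sym (negbTE cn) mulr0.
rewrite expr2 -mulrA; apply: (le_trans (ler_wpM2l Rt0 e)).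
by have := Ex_dtime k t0; rewrite mulrCA; lra.
Qed.

Section SecondMoment.
Variable h : sys_state N -> clock N -> R.
Hypothesis h1 : forall st c, `|h st c| <= 1.

Let M n t w := mart lam p h (th w) (u w) (Q0 w) n t.
Let m k t w := mstep lam p h (th w) (u w) (Q0 w) k t.

Let b_m k t : 0 <= t -> bmf (m k t).
Proof.
move=> t0; split; first exact: measurable_mstep.
exists (1 + Rt * t) => w; apply: (le_trans (mstep_le rate0 h1 _ _ _ t0 (th0 w) (thS w))).
by rewrite lerD2l; apply: ler_wpM2l => //; exact: dtime_le.
Qed.

Lemma bmf_mart n t : 0 <= t -> bmf (M n t).
Proof. by move=> t0; apply: bmf_sum => k; exact: b_m. Qed.

(** From [(1 + y) ^ 2 <= 2 + 2 * y ^ 2] with [y] the total rate times the sojourn: the bound 2 on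
    the mean of [y ^ 2] gives [2 + 4 = 6]. *)
Let Ex_mstep_sqr k t : 0 <= t -> Ex P (fun w => m k t w ^+ 2) <= 6.
Proof.
move=> t0.
apply: (@le_trans _ _ (Ex P (fun w => 2 + 2 * Rt ^+ 2 * dt k t w ^+ 2))).
  apply: le_Ex; first by apply: bmfX; exact: b_m.
    by apply: bmfD; [exact: bmf_cst|apply: bmfM; [exact: bmf_cst|apply: bmfX; exact: b_dt]].
  move=> w; rewrite -(real_normK (num_real (m k t w))).
  have hm := mstep_le rate0 h1 (u w) (Q0 w) k t0 (th0 w) (thS w).
  have d0 : 0 <= Rt * dt k t w by rewrite mulr_ge0//; exact: dtime_ge0.
  apply: (@le_trans _ _ ((1 + Rt * dt k t w) ^+ 2)).
    by apply: lerXn2r => //; rewrite nnegrE// addr_ge0.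
  have := sqr_ge0 (1 - Rt * dt k t w); lra.
rewrite ExD ?ExZ ?Ex_cst//; last 3 first.
- by apply: bmfX; exact: b_dt.
- exact: bmf_cst.
- by apply: bmfM; [exact: bmf_cst|apply: bmfX; exact: b_dt].
by have := Ex_dtime_sqr k t0; lra.
Qed.

(** The increment is expanded into clock terms; the weight of each, [mart] times [h], is determined
    by the history before event [k]. Clocks of rate 0 never ring and are treated apart. *)
Let Ex_mart_mstep k t : 0 <= t -> Ex P (fun w => M k t w * m k t w) = 0.
Proof.
move=> t0.
pose g c w := M k t w * h (gstate (th w) (u w) (Q0 w) k) c *
  clock_term (th w) (u w) (Q0 w) (rate lam p c) 0 c k t.
have bh c : bmf (fun w => h (gstate (th w) (u w) (Q0 w) k) c).
  split; last by exists 1.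
  exact: (@measurable_dmeas _ _ _ _ (measurableTypeR R) _ (fun st => h st c)
    (@countable_sys_state N) (dmeas_gstate mth mu mq k)).
rewrite (_ : (fun w => _) = (fun w => \sum_(c : clock N) g c w)); last first.
  apply/funext => w; rewrite /m mstepE mulr_sumr; apply: eq_bigr => c _.
  by rewrite /g mulrA.
rewrite Ex_sum; last first.
  move=> c; apply: bmfM; last exact: b_clock.
  by apply: bmfM => //; exact: bmf_mart.
apply: big1 => c _; have := rate0 c; rewrite le_eqVlt => /predU1P[r0|r0].
  rewrite -[RHS](Ex_cst P 0); congr Ex; apply/funext => w.
  by rewrite /g /clock_term -r0 mul0r expr0 expr1 !mul1r subr0 -/(ind c k t w) ind0 ?mulr0.
apply: (@clock_term_orth _ _ _ P lam p N Q0 E U inp Epos c k 0 t (k%:R * (1 + Rt * t))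
  (fun th u q => mart lam p h th u q k t * h (gstate th u q k) c) r0 t0).
- move=> u' q' th1 th2 st ti; rewrite (mart_hist lam p h t st ti) st//.
- move=> d' X E' U' q' mE' mU' mq'; apply: measurable_funM.
    by apply: measurable_mart => // ? ?; exact: measurable_tick.
  apply: (@measurable_dmeas _ _ _ _ (measurableTypeR R) _ (fun st => h st c)
    (@countable_sys_state N)).
  by apply: dmeas_gstate => // ? ?; exact: measurable_tick.
- move=> E' U' q' E'0; rewrite normrM -[leRHS]mulr1; apply: ler_pM => //.
  by apply: mart_le => // [c'|c' j]; [exact: tick_ge0|exact: tickS].
Qed.

Lemma Ex_mart_sqr n t : 0 <= t -> Ex P (fun w => M n t w ^+ 2) <= 6 * n%:R.
Proof.
move=> t0; elim: n => [|n IH].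
  rewrite mulr0 -[leRHS](Ex_cst P 0); apply: le_Ex; [|exact: bmf_cst|].
    by apply: bmfX; exact: bmf_mart.
  by move=> w; rewrite /M /mart big_ord0 expr0n.
have bM := bmf_mart n t0; have bm := b_m n t0.
rewrite (_ : (fun w => _) = (fun w => M n t w ^+ 2 + 2 * (M n t w * m n t w) + m n t w ^+ 2)).
  have b1 : bmf (fun w => M n t w ^+ 2) by exact: bmfX.
  have b2 : bmf (fun w => m n t w ^+ 2) by exact: bmfX.
  have b3 : bmf (fun w => M n t w * m n t w) by exact: bmfM.
  have b4 : bmf (fun w => 2 * (M n t w * m n t w)) by apply: bmfM => //; exact: bmf_cst.
  rewrite ExD//; last exact: bmfD.
  rewrite ExD// ExZ// Ex_mart_mstep// mulr0 addr0.
  by have := Ex_mstep_sqr n t0; rewrite -natr1; lra.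
by apply/funext => w; rewrite /M /mart big_ord_recr/= -/(mart _ _ _ _ _ _ _ _) -/(M n t w) -/(m n t w); ring.
Qed.

Lemma mart_deviation n t a : 0 <= t -> 0 < a ->
  (P [set w | (a <= `|mart lam p h (tickw lam p E w) (Uw U w) (Q0 w) n t|)%R] <=
   (6 * n%:R / a ^+ 2)%:E)%E.
Proof.
move=> t0 a0; apply: le_trans (second_moment_bound P a0 (bmf_mart n t0)) _.
by rewrite lee_fin ler_pM2r ?invr_gt0 ?exprn_gt0//; exact: Ex_mart_sqr.
Qed.

End SecondMoment.
End Variance.

(** * Decomposition of the paths *)

Lemma tail_sum_finite (R : realType) (x : nat -> R) i M :
  (forall j, (M <= j)%N -> x j = 0) -> tail_sum x i = \sum_(i <= j < M) x j.
Proof.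
move=> xM; rewrite /tail_sum; apply/cvg_lim => //.
apply: cvg_near_cst; exists (maxn i M) => // k /=; rewrite geq_max => /andP[ik Mk].
have [iM|Mi] := leqP i M.
  have z : \sum_(M <= j < k) x j = 0.
    by rewrite big_nat big1// => j /andP[Mj _]; exact: xM.
  by rewrite (big_cat_nat iM Mk)/= z addr0.
rewrite [RHS]big_geq ?(ltnW Mi)// big_nat big1// => j /andP[ij _].
by apply: xM; rewrite (leq_trans (ltnW Mi)).
Qed.

Lemma sum_nat_tail (i M m : nat) : (m < M)%N ->
  (\sum_(i <= j < M) (j <= m) = m.+1 - i)%N.
Proof.
move=> mM; have [im|mi] := leqP i m.+1.
  have z : (\sum_(m.+1 <= j < M) (j <= m) = 0)%N.
    by rewrite big_nat big1// => j /andP[mj _]; rewrite leqNgt mj.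
  rewrite (big_cat_nat im mM)/= z addn0 big_nat (eq_bigr (fun=> 1%N)); last first.
    by move=> j /andP[_]; rewrite ltnS => ->.
  by rewrite -big_nat sum_nat_const_nat muln1.
rewrite big_nat big1; last first.
  by move=> j /andP[ij _]; rewrite leqNgt (leq_trans (ltnW mi) ij).
by apply/esym/eqP; rewrite subn_eq0 ltnW.
Qed.

(** * Queue tails and their jumps *)

Section QueueTails.
Variables (R : realType) (N : nat).
Implicit Types q : 'I_N -> nat.

Lemma S_ofE q i : S_of R q i = (\sum_(n < N) (i <= q n))%N%:R / N%:R.
Proof.
rewrite /S_of; congr (_%:R / _); rewrite -sum1_card big_mkcond.
by apply: eq_bigr => n _; rewrite unfold_in /in_set /= asboolb; case: leqP.
Qed.

(** After exchanging the sums, a queue of length [m] is counted once for each [j] from [i] to [m];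
    truncated subtraction covers [m < i]. *)
Lemma V_ofE q i : V_of R q i = (\sum_(n < N) ((q n).+1 - i))%N%:R / N%:R.
Proof.
rewrite /V_of (@tail_sum_finite _ _ _ (\max_(n < N) q n).+1); last first.
  move=> j jM; rewrite S_ofE big1 ?mul0r// => n _; apply/eqP; rewrite eqb0 -ltnNge.
  by apply: leq_trans jM; rewrite ltnS; exact: leq_bigmax.
under eq_bigr do rewrite S_ofE.
rewrite -mulr_suml -natr_sum exchange_big/=; congr (_%:R / _).
by apply: eq_bigr => n _; apply: sum_nat_tail; rewrite ltnS; exact: leq_bigmax.
Qed.

Lemma V_of_ge0 q i : 0 <= V_of R q i.
Proof. by rewrite V_ofE divr_ge0. Qed.

Lemma V_of_step q i :
  V_of R q i - V_of R q i.+1 = (\sum_(n < N) (i <= q n))%N%:R / N%:R.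
Proof.
rewrite !V_ofE -mulrBl -natrB; last by apply: leq_sum => n _; apply: leq_sub2l.
congr (_%:R / _); rewrite -sumnB; last by move=> n _; apply: leq_sub2l.
apply: eq_bigr => n _; rewrite subSS; case: leqP => h.
  by rewrite subSn// -addn1 addKn.
by rewrite (_ : (q n).+1 - i = 0)%N ?sub0n//; apply/eqP; rewrite subn_eq0.
Qed.

Lemma V_of_noninc q i : V_of R q i.+1 <= V_of R q i.
Proof. by rewrite -subr_ge0 V_of_step divr_ge0. Qed.

Lemma V_of_le0 q i : V_of R q i <= V_of R q 0.
Proof. by elim: i => // i; apply: le_trans; exact: V_of_noninc. Qed.

Lemma V_of01 q : (0 < N)%N -> V_of R q 0 = V_of R q 1 + 1.
Proof.
move=> N0; apply/eqP; rewrite addrC -subr_eq V_of_step; apply/eqP.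
by under eq_bigr do rewrite leq0n; rewrite sum1_card card_ord divff// pnatr_eq0 -lt0n.
Qed.

Lemma V_of_gt0 q i : (0 < V_of R q i) = [exists n, (i <= q n)%N].
Proof.
rewrite V_ofE; apply/idP/existsP => [|[n inq]].
  move=> h; apply/existsP; apply: contraLR h; rewrite negb_exists => /forallP h.
  rewrite big1 ?mul0r ?ltxx// => n _; apply/eqP; rewrite subn_eq0.
  by have := h n; rewrite -ltnNge.
have N0 : (0 < N)%N by apply: leq_ltn_trans (ltn_ord n).
rewrite divr_gt0 ?ltr0n// (bigD1 n)//= addn_gt0 subn_gt0 ltnS inq//.
Qed.

End QueueTails.

(* [N] times the change of [V_of] caused by a tick; a central tick serves a longest
   queue, hence lowers [V_i] exactly when some queue has length at least [i]. *)
Definition jump (R : realType) (N : nat) (i : nat) (st : sys_state N) (c : clock N) : R :=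
  match c with
  | inl (inl n) => (i <= (st.2 n).+1)%N%:R
  | inl (inr n) => - (i <= st.2 n)%N%:R
  | inr _ => - [exists n, (i <= st.2 n)%N]%:R
  end.

Lemma jump_le1 (R : realType) N i (st : sys_state N) c : `|jump R i st c| <= 1.
Proof.
have b1 (b : bool) : `|b%:R : R| <= 1 by case: b; rewrite ?normr1 ?normr0.
by case: c => [[n|n]|u] /=; rewrite ?normrN.
Qed.

(** The index is clipped to the list of longest queues, so one of them is returned for every real
    mark, not only for those in the unit interval. *)
Lemma choose_longestP (R : realType) N (q : 'I_N -> nat) (u : R) : (0 < N)%N ->
  exists2 n, choose_longest q u = Some n & forall m, (q m <= q n)%N.
Proof.
move=> N0; rewrite /choose_longest.
set L := [seq n <- _ | _].
have [n0 n0L] : exists n0, n0 \in L.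
  pose n0 := [arg max_(n > Ordinal N0) q n]%N.
  exists n0; rewrite mem_filter mem_enum andbT; apply/forallP => m.
  by rewrite /n0; case: arg_maxnP => // n _; apply.
have Ln n : n \in L -> forall m, (q m <= q n)%N.
  by rewrite mem_filter => /andP[/forallP].
case: L n0L Ln => // n1 L _ Ln.
set k := minn _ _; exists (nth n1 (n1 :: L) k) => //.
by apply: Ln; apply: mem_nth; rewrite /k /= ltnS geq_minr.
Qed.

Section Jumps.
Variables (R : realType) (N : nat).
Hypothesis N0 : (0 < N)%N.

Lemma V_of_decr (q : 'I_N -> nat) n i : (0 < i)%N ->
  V_of R (decr q n) i = V_of R q i - (i <= q n)%N%:R / N%:R.
Proof.
move=> i0; apply/eqP; rewrite eq_sym subr_eq !V_ofE -mulrDl -natrD; apply/eqP.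
congr (_%:R / _); rewrite (bigD1 n)//= [in RHS](bigD1 n)//= addnAC; congr (_ + _)%N.
  rewrite /decr eqxx; case: (q n) => [|m] /=; first by rewrite leqNgt i0 addn0.
  by case: leqP => h; lia.
by apply: eq_bigr => m mn; rewrite /decr (negbTE mn).
Qed.

Lemma V_of_gstep (U : nat -> R) c (st : sys_state N) i : (0 < i)%N ->
  V_of R (gstep U c st).2 i = V_of R st.2 i + jump R i st c / N%:R.
Proof.
move=> i0; case: c => [[n|n]|u] /=.
- rewrite !V_ofE -mulrDl -natrD; congr (_%:R / _).
  rewrite (bigD1 n)//= [in RHS](bigD1 n)//= addnAC; congr (_ + _)%N.
    by rewrite eqxx; case: leqP => h; lia.
  by apply: eq_bigr => m mn; rewrite (negbTE mn).
- by rewrite V_of_decr// mulNr.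
- case: ltnP => h.
    have [n -> nmax] := choose_longestP st.2 (U (st.1 (inr u))) N0.
    rewrite V_of_decr// mulNr; congr (_ - _%:R / _); congr nat_of_bool.
    apply/idP/existsP => [|[m im]]; first by exists n.
    exact: leq_trans im (nmax m).
  rewrite (_ : [exists n, _] = false) ?oppr0 ?mul0r ?addr0//.
  apply/existsP => -[n]; rewrite leqNgt (leq_trans _ i0)// ltnS.
  by apply: leq_trans h; rewrite (bigD1 n)//= leq_addr.
Qed.

(** An arrival raises [V_i] at the fraction [V_(i-1) - V_i] of the stations, a local token lowers it
    at the fraction [V_i - V_(i+1)], and the central clock of rate [N * p] acts exactly when
    [V_i > 0]. *)
Lemma hrate_jump lam p (st : sys_state N) i : (0 < i)%N ->
  hrate lam p (jump R i) st = N%:R * drift lam p (V_of R st.2) i.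
Proof.
case: i => // i _; rewrite /hrate /drift /= big_sumType/= big_sumType/=.
have Nn0 : N%:R != 0 :> R by rewrite pnatr_eq0 -lt0n.
rewrite !V_of_step V_of_gt0 -!mulr_sumr.
under eq_bigr do rewrite ltnS.
rewrite sumrN -!natr_sum.
rewrite big_const card_unit /= addr0.
by case: [exists n, _]; rewrite ?mulr1n ?mulr0n; field.
Qed.

Lemma total_rateE lam p : total_rate lam p N = N%:R * (lam + 1) :> R.
Proof.
rewrite /total_rate big_sumType/= big_sumType/= !sumr_const !card_ord card_unit.
by rewrite mulr1n -(mulr_natl lam) -(mulr_natl (1 - p)); ring.
Qed.

End Jumps.

(** * Compensated paths, explosion and oscillation *)

Section PathDecomposition.
Variables (R : realType) (lam p : R) (N : nat) (E : clock N -> nat -> R).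
Variables (U : nat -> R) (q : 'I_N -> nat).
Hypothesis N0 : (0 < N)%N.
Hypothesis lam0 : 0 <= lam.
Hypothesis p01 : 0 <= p <= 1.
Hypothesis Epos : forall c k, 0 < E c k.

Let th := tick lam p E.
Let st k := gstate th U q k.
Let tau k := gtime th U q k.
Let pt k := ptime th U q k.
Let rt k t := rtime th U q k t.

Let rate0 (c : clock N) : 0 <= rate lam p c.
Proof.
by have /andP[p0 p1] := p01; case: c => [[n|n]|u] //=; rewrite ?subr_ge0// mulr_ge0.
Qed.

Let th0 c : (0 <= th c 0%N)%E.
Proof. by apply: tick_ge0 => ? ?; exact: ltW. Qed.

Let thS c k : (th c k <= th c k.+1)%E.
Proof. by apply: tickS => ? ?; exact: ltW. Qed.

Lemma gtime0_gt0 : (0 < tau 0)%E.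
Proof.
rewrite /tau /gtime /=; set c := gclock _ _ _ _; rewrite /th /tick.
case: ifP => r0; last by rewrite ltry.
by rewrite lte_fin divr_gt0// big_ord_recr big_ord0 /= add0r.
Qed.

Lemma Q_at (t : R) m : (pt m <= t%:E)%E -> (t%:E < tau m)%E -> 0 <= t ->
  Q lam p E U q t = (st m).2.
Proof.
move=> mt tm t0; rewrite /Q event_stateE; congr ((gstate _ _ _ _).2).
rewrite /n_events; set A := [set k | _].
have Am : A m.
  split; last by rewrite event_timeE.
  move=> j jm; rewrite event_timeE; apply: le_trans mt.
  by rewrite -[gtime _ _ _ _]/(pt j.+1); exact: (ptime_homo U q th0 thS).
have [xA1 xA2] : A (xget 0%N A) by apply: xgetPex; exists m.
apply/eqP; rewrite eqn_leq; apply/andP; split; rewrite leqNgt; apply/negP => h.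
  by have := xA1 m h; rewrite event_timeE leNgt tm.
by case: Am => /(_ _ h); rewrite leNgt xA2.
Qed.

Lemma current_index (t : R) n : 0 <= t -> (t%:E < tau n)%E ->
  exists m, [/\ (m <= n)%N, (pt m <= t%:E)%E & (t%:E < tau m)%E].
Proof.
move=> t0; elim: n => [|n IH] tn; first by exists 0%N; split => //; rewrite lee_fin.
have [h|h] := ltP t%:E (tau n).
  by have [m [mn h1 h2]] := IH h; exists m; split => //; rewrite (leq_trans mn).
by exists n.+1; split.
Qed.

Let dt k t := dtime th U q k t.

Let rtE k (t : R) : 0 <= t -> (rt k t)%:E = Order.min (pt k) t%:E.
Proof. exact: rtimeE. Qed.

Lemma rtime_min k (s : R) (t : R) : 0 <= s -> s <= t -> rt k s = Num.min (rt k t) s.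
Proof.
move=> s0 st_; apply: EFin_inj; rewrite EFin_min !rtE//; last exact: le_trans st_.
by rewrite -minA [Order.min t%:E _]min_r// lee_fin.
Qed.

Lemma dtime_homo k (s : R) (t : R) : 0 <= s -> s <= t -> dt k s <= dt k t.
Proof.
move=> s0 st_; rewrite /dt /dtime -!/(rt _ _) !(rtime_min _ s0 st_).
have : rt k t <= rt k.+1 t by apply: rtime_homo => //; exact: le_trans st_.
by case: (leP (rt k.+1 t) s) => ?; case: (leP (rt k t) s) => ?; lra.
Qed.

Lemma sum_dtime n (t : R) : 0 <= t -> \sum_(k < n) dt k t = rt n t.
Proof.
move=> t0; rewrite -(big_mkord xpredT (fun k => dt k t)) telescope_sumr//.
by rewrite rtime0// subr0.
Qed.

Lemma sum_dtimeB n (s : R) (t : R) : 0 <= s -> s <= t ->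
  \sum_(k < n) (dt k t - dt k s) <= t - s.
Proof.
move=> s0 st_; rewrite sumrB !sum_dtime//; last exact: le_trans st_.
rewrite (rtime_min n s0 st_).
have : rt n t <= t by apply: rtime_le => //; exact: le_trans st_.
by case: (leP (rt n t) s) => ?; lra.
Qed.

(* [V_of] with the martingale part removed: a Lipschitz path whose right
   derivative is [drift] of the current state. *)
Definition compensated n t i : R :=
  V_of R q i + (\sum_(k < n) hrate lam p (jump R i) (st k) * dt k t) / N%:R.

Let Npos : 0 < N%:R :> R. Proof. by rewrite ltr0n. Qed.

(** The sojourns grow by at most [t - s] altogether, and each is weighted by at most the total rate
    [N * (lam + 1)]; the division by [N] leaves a constant independent of [N]. *)
Lemma compensated_lip n (s : R) (t : R) i : 0 <= s -> s <= t ->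
  `|compensated n t i - compensated n s i| <= (lam + 1) * (t - s).
Proof.
move=> s0 st_; rewrite /compensated opprD addrACA subrr add0r -mulrBl normrM.
rewrite [X in _ * X]ger0_norm ?invr_ge0 ?ler0n// ler_pdivrMr//.
rewrite -sumrB; apply: (le_trans (ler_norm_sum _ _ _)).
apply: (@le_trans _ _ (\sum_(k < n) total_rate lam p N * (dt k t - dt k s))).
  apply: ler_sum => k _; rewrite -mulrBr normrM.
  have d0 : 0 <= dt k t - dt k s by rewrite subr_ge0 dtime_homo.
  rewrite (ger0_norm d0); apply: ler_wpM2r => //.
  by apply: hrate_le => // ? ?; exact: jump_le1.
rewrite -mulr_sumr total_rateE; apply: (@le_trans _ _ (N%:R * (lam + 1) * (t - s))).
  apply: ler_wpM2l; last exact: sum_dtimeB.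
  by rewrite mulr_ge0// addr_ge0.
by rewrite le_eqVlt; apply/orP; left; apply/eqP; ring.
Qed.

Section BeforeExplosion.
Variables (n : nat) (t : R).
Hypothesis t0 : 0 <= t.
Hypothesis tn : (t%:E < tau n)%E.

Let tau_le m k : (pt m <= t%:E)%E -> (t%:E < tau m)%E -> (tau k <= t%:E)%E = (k < m)%N.
Proof.
move=> mt tm; apply/idP/idP => [h|km].
  rewrite ltnNge; apply/negP => mk; move: tm; rewrite ltNge => /negP; apply.
  by apply: le_trans h; exact: (ptime_homo U q th0 thS (j := m.+1) (k := k.+1)).
by apply: le_trans mt; exact: (ptime_homo U q th0 thS (j := k.+1)).
Qed.

Let V_of_st i m : (0 < i)%N -> V_of R (st m).2 i =
  V_of R q i + (\sum_(k < m) jump R i (st k) (gclock th U q k)) / N%:R.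
Proof.
move=> i0; elim: m => [|m IH]; first by rewrite big_ord0 mul0r addr0.
by rewrite /st gstateS V_of_gstep// -/(st m) IH big_ord_recr /= mulrDl addrA.
Qed.

(** Event times are nondecreasing, so among the [n + 1] terms the indicator of [tau k <= t] keeps
    exactly those before the current index; the compensators cancel. *)
Lemma V_of_Q i : (0 < i)%N -> V_of R (Q lam p E U q t) i =
  compensated n.+1 t i + mart lam p (jump R i) th U q n.+1 t / N%:R.
Proof.
move=> i0; have [m [mn mt tm]] := current_index t0 tn.
rewrite (Q_at mt tm t0) V_of_st// /compensated -addrA; congr (_ + _).
rewrite -mulrDl; congr (_ / _); rewrite /mart /mstep sumrB addrC subrK.
rewrite (big_ord_widen n.+1 (fun k => jump R i (st k) (gclock th U q k)))//; last exact: ltnW.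
rewrite big_mkcond; apply: eq_bigr => k _; rewrite -/(tau k) (tau_le k mt tm).
by case: ltnP => _; rewrite ?mulr1 ?mulr0.
Qed.

Lemma V_of_Q_le i : V_of R (Q lam p E U q t) i <= V_of R q 0 + n.+1%:R / N%:R.
Proof.
apply: (le_trans (V_of_le0 _ _ _)).
have [m [mn mt tm]] := current_index t0 tn.
rewrite (Q_at mt tm t0) !V_of01// V_of_st// addrAC lerD2l ler_pM2r ?invr_gt0//.
apply: (le_trans (ler_norm _)); apply: (le_trans (ler_norm_sum _ _ _)).
apply: (@le_trans _ _ (\sum_(k < m) 1)); first by apply: ler_sum => k _; exact: jump_le1.
by rewrite sumr_const card_ord ler_nat; exact: leqW.
Qed.

(** Up to the next event only the sojourn in the current state grows, at unit speed. *)
Lemma compensated_slope i : (0 < i)%N -> exists2 del, 0 < del &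
  forall s, t <= s -> s < t + del -> compensated n.+1 s i =
    compensated n.+1 t i + drift lam p (V_of R (Q lam p E U q t)) i * (s - t).
Proof.
move=> i0; have [m [mn mt tm]] := current_index t0 tn.
have [del del0 Hdel] : exists2 del : R, 0 < del &
    forall s, s < t + del -> (s%:E < tau m)%E.
  case: (tau m) tm => [r| |]//; last by exists 1 => // s _; rewrite ltry.
  by rewrite lte_fin => tr; exists (r - t); [rewrite subr_gt0|
    move=> s; rewrite addrC subrK lte_fin].
exists del => // s ts sdel; have sm := Hdel s sdel.
have s0 : 0 <= s by exact: le_trans ts.
have rlow k : (k <= m)%N -> rt k s = rt k t.
  move=> km; apply: EFin_inj; rewrite !rtE//.
  have kt : (pt k <= t%:E)%E by apply: le_trans mt; exact: (ptime_homo U q th0 thS).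
  by rewrite !min_l//; apply: le_trans kt _; rewrite lee_fin.
have rhigh k r : (m < k)%N -> 0 <= r -> (r%:E < tau m)%E -> rt k r = r.
  move=> mk r0 rm; apply: EFin_inj; rewrite rtE// min_r//; apply: ltW.
  by apply: (lt_le_trans rm); exact: (ptime_homo U q th0 thS (j := m.+1)).
have dk k : dt k s = dt k t + (k == m)%:R * (s - t).
  rewrite /dt /dtime -!/(rt _ _); case: (ltngtP k m) => [km|mk|->].
  - by rewrite !rlow// ?mul0r ?addr0// ltnW.
  - by rewrite !rhigh// ?mul0r ?addr0 ?subrr// ltnW.
  - by rewrite (rlow m)// !(rhigh m.+1)// mul1r; ring.
rewrite /compensated -addrA; congr (_ + _).
rewrite (Q_at mt tm t0).
have -> : drift lam p (V_of R (st m).2) i = hrate lam p (jump R i) (st m) / N%:R.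
  by rewrite hrate_jump// mulrC mulKf ?gt_eqF.
under eq_bigr do rewrite dk mulrDr.
rewrite big_split/= mulrDl; congr (_ + _).
have mn1 : (m < n.+1)%N by rewrite ltnS.
rewrite (bigD1 (Ordinal mn1))//= eqxx mul1r big1 ?addr0; last first.
  by move=> k km; rewrite (_ : (k == m :> nat) = false) ?mul0r ?mulr0//;
    apply: negbTE; apply: contra km => /eqP e; apply/eqP/val_inj.
by rewrite mulrAC.
Qed.

End BeforeExplosion.

Let ticks n t : R := \sum_(k < n) (tau k <= t%:E)%E%:R.

Let mart_ticks n (t : R) : 0 <= t ->
  mart lam p (fun _ _ => 1) th U q n t = ticks n t - total_rate lam p N * rt n t.
Proof.
move=> t0; rewrite /mart /mstep sumrB; congr (_ - _).
  by apply: eq_bigr => k _; rewrite mul1r.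
rewrite -(sum_dtime n t0) mulr_sumr; apply: eq_bigr => k _; congr (_ * _).
by rewrite /hrate; apply: eq_bigr => c _; rewrite mulr1.
Qed.

(** If event [n] had occurred by [T], all [n + 1] events would be counted while the compensator is
    at most the total rate times [T], so the counting martingale would reach [a]. *)
Lemma no_explosion n (T : R) (a : R) : 0 <= T ->
  a <= n.+1%:R - total_rate lam p N * T ->
  `|mart lam p (fun _ _ => 1) th U q n.+1 T| < a -> (T%:E < tau n)%E.
Proof.
move=> T0 aT h; rewrite ltNge; apply/negP => nT; move: h; rewrite ltNge => /negP; apply.
apply: (le_trans aT); apply: le_trans (ler_norm _); rewrite mart_ticks// lerB//.
  rewrite /ticks (eq_bigr (fun=> 1)) ?sumr_const ?card_ord// => k _.
  rewrite (_ : (tau k <= T%:E)%E)//; apply: le_trans nT.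
  by apply: (ptime_homo U q th0 thS (j := k.+1) (k := n.+1)); exact: ltn_ord.
by apply: ler_wpM2l; [exact: total_rate_ge0|exact: rtime_le].
Qed.

(** Between [s] and [t] the path moves by at most the number of events plus a compensator. The
    counting martingale at [s] and [t'] bounds that number by [2 * a] plus one compensator; the
    third [a] is the value at [s]. *)
Lemma mart_between h n (s : R) (t : R) (t' : R) (a : R) : 0 <= s -> s <= t -> t <= t' ->
  (forall st c, `|h st c| <= 1) ->
  `|mart lam p h th U q n s| <= a ->
  `|mart lam p (fun _ _ => 1) th U q n s| <= a ->
  `|mart lam p (fun _ _ => 1) th U q n t'| <= a ->
  `|mart lam p h th U q n t| <= 3 * a + 2 * (total_rate lam p N * (t' - s)).
Proof.
move=> s0 st_ tt' h1 hs h1s h1t'.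
have t0 : 0 <= t by exact: le_trans st_.
have t'0 : 0 <= t' by exact: le_trans tt'.
have Rt0 : 0 <= total_rate lam p N by exact: total_rate_ge0.
have ind_homo k : (tau k <= s%:E)%E -> (tau k <= t%:E)%E.
  by move=> e; apply: (le_trans e); rewrite lee_fin.
have diff : `|mart lam p h th U q n t - mart lam p h th U q n s| <=
    (ticks n t - ticks n s) + total_rate lam p N * (t - s).
  rewrite /mart -sumrB; apply: (le_trans (ler_norm_sum _ _ _)).
  rewrite /ticks -sumrB.
  apply: (@le_trans _ _ (\sum_(k < n) (((tau k <= t%:E)%E%:R - (tau k <= s%:E)%E%:R) +
     total_rate lam p N * (dt k t - dt k s)))).
    apply: ler_sum => k _; rewrite /mstep.
    rewrite (_ : _ - _ = h (st k) (gclock th U q k) * ((tau k <= t%:E)%E%:R - (tau k <= s%:E)%E%:R)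
      - hrate lam p h (st k) * (dt k t - dt k s)); last first.
      by rewrite -/(st k) -!/(tau k) -!/(dt k _); ring.
    apply: (le_trans (ler_normB _ _)); apply: lerD.
      rewrite normrM -[leRHS]mul1r; apply: ler_pM => //.
      rewrite ger0_norm// subr_ge0 ler_nat.
      by case: (boolP (tau k <= s%:E)%E) => // /ind_homo ->.
    rewrite normrM; apply: ler_pM => //; first exact: hrate_le.
    by rewrite ger0_norm// subr_ge0 dtime_homo.
  rewrite big_split/= -mulr_sumr lerD2l; apply: ler_wpM2l => //; exact: sum_dtimeB.
have tk : ticks n t <= ticks n t'.
  apply: ler_sum => k _; rewrite ler_nat.
  case: (boolP (tau k <= t%:E)%E) => // e.
  by rewrite (_ : (tau k <= t'%:E)%E)//; apply: (le_trans e); rewrite lee_fin.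
have tks : ticks n t' - ticks n s <= 2 * a + total_rate lam p N * (t' - s).
  have e1 := mart_ticks n s0; have e2 := mart_ticks n t'0.
  have h2 := le_trans (ler_norm _) h1t'; have h3 := lerNnormlW h1s.
  have h4 : total_rate lam p N * (rt n t' - rt n s) <= total_rate lam p N * (t' - s).
    apply: ler_wpM2l => //; rewrite -!sum_dtime// -sumrB; apply: sum_dtimeB => //.
    exact: le_trans tt'.
  rewrite e1 e2 in h2 h3; rewrite mulrBr in h4; lra.
have h5 : total_rate lam p N * (t - s) <= total_rate lam p N * (t' - s).
  by apply: ler_wpM2l => //; rewrite lerB.
rewrite -[X in `|X|](subrK (mart lam p h th U q n s)).
apply: (le_trans (ler_normD _ _)); lra.
Qed.

End PathDecomposition.

(** * Closeness to the fluid solution *)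

Section WeightedNorm.
Variables (R : realType) (x : nat -> R) (B : R).
Hypothesis xB : forall i, `|x i| <= B.

Let a i : R := (2%:R)^-1 ^+ i * (x i) ^+ 2.
Let S n : R := \sum_(0 <= i < n) a i.

Let a0 i : 0 <= a i.
Proof. by rewrite mulr_ge0 ?sqr_ge0 ?exprn_ge0. Qed.

Let S_homo : nondecreasing_seq S.
Proof.
apply/nondecreasing_seqP => n; rewrite /S big_nat_recr//= lerDl; exact: a0.
Qed.

Let S_le n : S n <= 2 * B ^+ 2.
Proof.
apply: (@le_trans _ _ ((2 - 2 * 2^-1 ^+ n) * B ^+ 2)); last first.
  by apply: ler_wpM2r; [exact: sqr_ge0|rewrite gerBl mulr_ge0// exprn_ge0].
elim: n => [|n IH]; first by rewrite /S big_geq// expr0 mulr1 subrr mul0r.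
rewrite /S big_nat_recr//= -/(S n).
have h : a n <= 2^-1 ^+ n * B ^+ 2.
  apply: ler_wpM2l; first by rewrite exprn_ge0.
  rewrite -(real_normK (num_real (x n))); apply: lerXn2r => //; rewrite nnegrE//.
  exact: le_trans (xB n).
rewrite exprS; move: IH h; set b := 2^-1 ^+ n => IH h; lra.
Qed.

Let S_cvg : cvgn S.
Proof.
apply: nondecreasing_is_cvgn => //; exists (2 * B ^+ 2) => _ [n _ <-]; exact: S_le.
Qed.

(** The uniform bound on the coordinates makes the series converge, so that [norm_w] really is
    governed by its partial sums. *)
Lemma norm_w_le gamma : 0 <= gamma ->
  (forall n, \sum_(i < n) (2^-1) ^+ i * x i ^+ 2 <= gamma ^+ 2) -> norm_w x <= gamma.
Proof.
move=> g0 H; rewrite /norm_w -[gamma]ger0_norm// -sqrtr_sqr; apply: ler_wsqrtr.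
apply: limr_le; first exact: S_cvg.
by apply: nearW => n; rewrite big_mkord.
Qed.

Lemma partial_le_norm_w n :
  \sum_(i < n) (2^-1) ^+ i * x i ^+ 2 <= norm_w x ^+ 2.
Proof.
rewrite /norm_w sqr_sqrtr; last first.
  by apply: limr_ge; [exact: S_cvg|apply: nearW => k; apply: sumr_ge0 => i _; exact: a0].
have := nondecreasing_cvgn_le S_homo S_cvg n.
by rewrite /S big_mkord.
Qed.

End WeightedNorm.

(** The term at 0 equals [d 1 ^ 2], twice the first term of the sum on the right, which turns the
    factor 1 into 3. Coordinates beyond [I] are bounded by a geometric tail. *)
Lemma partial_tail_le (R : realType) (d : nat -> R) (B : R) I n :
  (0 < I)%N -> d 0%N = d 1%N -> (forall i, `|d i| <= B) ->
  \sum_(i < n) (2^-1) ^+ i * d i ^+ 2 <=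
  3 * (\sum_(i < I) (2^-1) ^+ i.+1 * d i.+1 ^+ 2) + 2^-1 ^+ I * B ^+ 2.
Proof.
move=> I0 d01 dB; pose w i : R := (2^-1) ^+ i * d i ^+ 2.
have w0 i : 0 <= w i by rewrite mulr_ge0 ?sqr_ge0 ?exprn_ge0.
have B2 : 0 <= B ^+ 2 by exact: sqr_ge0.
have dB2 i : d i ^+ 2 <= B ^+ 2.
  rewrite -(real_normK (num_real (d i))); apply: lerXn2r => //; rewrite nnegrE//.
  exact: le_trans (dB i).
set SI := \sum_(i < I) _.
have base : \sum_(i < I.+1) w i <= 3 * SI.
  rewrite big_ord_recl /= -/SI /w expr0 mul1r d01.
  have : 2^-1 * d 1%N ^+ 2 <= SI.
    rewrite /SI (bigD1 (Ordinal I0))//= expr1 lerDl.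
    by apply: sumr_ge0 => i _; rewrite mulr_ge0 ?sqr_ge0 ?exprn_ge0.
  by move: SI => s h; lra.
have step k : \sum_(i < I.+1 + k) w i <= 3 * SI + (2^-1 ^+ I - 2^-1 ^+ (I + k)) * B ^+ 2.
  elim: k => [|k IH]; first by rewrite !addn0 subrr mul0r addr0.
  rewrite addnS big_ord_recr /=.
  have h : w (I.+1 + k)%N <= 2^-1 ^+ (I.+1 + k) * B ^+ 2.
    by apply: ler_wpM2l; [rewrite exprn_ge0|exact: dB2].
  have e1 : 2^-1 ^+ (I.+1 + k) = 2^-1 * 2^-1 ^+ (I + k) :> R by rewrite addSn exprS.
  have e2 : 2^-1 ^+ (I + k.+1) = 2^-1 * 2^-1 ^+ (I + k) :> R by rewrite addnS exprS.
  move: IH h; rewrite e1 e2; set b := 2^-1 ^+ (I + k); set b' := 2^-1 ^+ I => IH h; lra.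
apply: (@le_trans _ _ (\sum_(i < I.+1 + n) w i)).
  rewrite (big_ord_widen (I.+1 + n) w)//; last exact: leq_addl.
  by rewrite big_mkcond; apply: ler_sum => i _; case: ifP.
apply: (le_trans (step n)); rewrite lerD2l; apply: ler_wpM2r => //.
by rewrite gerBl exprn_ge0.
Qed.

Lemma tail_sum_ge0 (R : realType) (s : nat -> R) i :
  (forall j, 0 <= s j) -> 0 <= tail_sum s i.
Proof.
move=> s0; rewrite /tail_sum.
have [h|h] := pselect (cvgn (fun n => \sum_(i <= j < n) s j)).
  by apply: limr_ge => //; apply: nearW => n; apply: sumr_ge0 => j _; exact: s0.
(* The limit of a divergent sequence is the default point, here 0. *)
by rewrite (dvgP h).
Qed.

Section FluidFacts.
Variables (R : realType) (lam p : R) (v0 : nat -> R) (v : R -> nat -> R).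
Hypothesis fl : fluid_solution lam p v0 v.

Lemma fluid_ge0 t i : 0 <= t -> 0 <= v t i.
Proof.
move=> t0; have [_ [_ [h _]]] := fl; have [[s [[[_ [sb _]] _] vE]] _] := h t t0.
by rewrite vE; apply: tail_sum_ge0 => j; have /andP[] := sb j.
Qed.

Lemma fluid01 t : 0 <= t -> v t 0%N = v t 1%N + 1.
Proof.
move=> t0; have [_ [_ [h _]]] := fl; have [_ [e _]] := h t t0.
by rewrite -e addrC subrK.
Qed.

Lemma fluid_le0 t i : 0 <= t -> v t i <= v t 0%N.
Proof.
move=> t0; have [_ [_ [h _]]] := fl; have [_ [_ m]] := h t t0.
elim: i => // i IH; apply: le_trans IH; have [_ [h1 h2]] := m i.
by rewrite -subr_ge0 (le_trans h2).
Qed.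

Lemma fluid_lip : exists2 L, 0 <= L & forall i t s, 0 <= t -> 0 <= s ->
  `|v t i - v s i| <= L * `|t - s|.
Proof.
have [[L HL] _] := fl; exists `|L| => // i t s t0 s0.
apply: (le_trans (HL i t s t0 s0)); apply: ler_wpM2r => //; exact: ler_norm.
Qed.

End FluidFacts.

Lemma half_power_small (R : realType) (C e : R) : 0 <= C -> 0 < e ->
  exists2 I, (0 < I)%N & 2^-1 ^+ I * C <= e.
Proof.
move=> C0 e0; pose n := (Num.truncn (C / e)).+1; exists n => //.
have h : C / e < n%:R by exact: truncnS_gt.
have h2 : n%:R <= 2 ^+ n :> R by rewrite -natrX ler_nat ltnW// ltn_expl.
rewrite exprVn mulrC ler_pdivrMr ?exprn_gt0//.
rewrite -ler_pdivrMl// mulrC; apply: le_trans h2; exact: ltW.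
Qed.

(** The order of quantifiers is the point: [I] and [eta] are chosen before [u] and [x], hence serve
    all [N] and all sample points at once. *)
Lemma fluid_close (R : realType) (lam p T gamma : R) (v0 : nat -> R)
    (v : R -> nat -> R) (m Lx : R) :
  0 <= lam <= 1 -> 0 <= p <= 1 -> 0 <= T -> 0 <= m -> 0 < gamma ->
  fluid_solution lam p v0 v ->
  exists I eta, 0 < eta /\ forall u x : R -> nat -> R,
    (forall t i, 0 <= t <= T -> 0 <= u t i <= u 0 0%N + m) ->
    (forall t, 0 <= t <= T -> u t 0%N = u t 1%N + 1) ->
    (forall t i, 0 <= t <= T -> (i < I)%N -> `|u t i.+1 - x t i.+1| <= eta) ->
    (forall s t i, 0 <= s -> s <= t -> t <= T ->
       `|x t i.+1 - x s i.+1| <= Lx * (t - s)) ->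
    (forall t i, 0 <= t -> t < T -> exists2 del, 0 < del &
      forall s, t <= s -> s < t + del -> s <= T ->
        x s i.+1 = x t i.+1 + drift lam p (u t) i.+1 * (s - t)) ->
    (forall i, x 0 i.+1 = u 0 i.+1) ->
    norm_w (fun i => u 0 i - v0 i) <= eta ->
    forall t, 0 <= t <= T -> norm_w (fun i => u t i - v t i) <= gamma.
Proof.
move=> lam01 p01 T0 m0 g0 fl.
have [L L0 vL] := fluid_lip fl.
have [_ [v00 [_ [Z [Zn vD]]]]] := fl.
(* A common bound: [u] starts below [v0 0 + 1] because [eta <= 1] and gains at most [m], while [v]
   gains at most [L * T]. *)
pose B := v0 0%N + 1 + m + L * T.
have v0p : 0 <= v0 0%N by rewrite -v00; apply: (fluid_ge0 fl).
have LT0 : 0 <= L * T by rewrite mulr_ge0.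
have B0 : 0 <= B by rewrite /B; lra.
pose e15 := expR (15 * T).
have e0 : 0 <= e15 by exact: expR_ge0.
(* [C1] collects the coefficients of [eta] and [C2] those of [2^-1 ^+ I] in the final estimate. The
   13 is [11 + 2] after [eta ^ 2 <= eta]; the 6 is [3 * 2], from [partial_tail_le] and from
   replacing [u] by [x]. *)
pose C1 := 6 * (1 + 13 * T) * e15 + 6.
pose C2 := B ^+ 2 * (6 * T * e15 + 1).
have Te : 0 <= T * e15 by rewrite mulr_ge0.
have C10 : 0 < C1 by rewrite /C1; lra.
have C20 : 0 <= C2 by rewrite /C2 mulr_ge0 ?sqr_ge0//; lra.
have g2 : 0 < gamma ^+ 2 / 2 by rewrite divr_gt0// exprn_gt0.
have [I I0 IC] := half_power_small C20 g2.
pose eta := Num.min 1 (gamma ^+ 2 / 2 / C1).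
have eta0 : 0 < eta by rewrite lt_min ltr01 divr_gt0.
have eta1 : eta <= 1 by rewrite ge_min lexx.
have etaC : C1 * eta <= gamma ^+ 2 / 2.
  by rewrite -ler_pdivlMl// mulrC ge_min lexx orbT.
exists I, eta; split => // u x uB u01 ux xL xD x0 init t tT.
have T00 : 0 <= (0 : R) <= T by rewrite lexx T0.
have vB s i : 0 <= s <= T -> 0 <= v s i <= v0 0%N + L * T.
  move=> /andP[s0 sT]; rewrite (fluid_ge0 fl)//=.
  apply: (le_trans (fluid_le0 fl _ s0)); rewrite -lerBlDl -v00.
  apply: (le_trans (ler_norm _)); apply: (le_trans (vL _ _ _ s0 (lexx 0))).
  by rewrite subr0 ger0_norm//; apply: ler_wpM2l.
have eta2 : eta ^+ 2 <= eta by rewrite expr2; apply: ler_piMl => //; exact: ltW.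
have d0B i : `|u 0 i - v0 i| <= u 0 0%N + m + v0 0%N.
  have /andP[b1 b2] := uB 0 i T00; have b3 := fluid_le0 fl i (lexx 0).
  have b4 := fluid_ge0 fl i (lexx 0); rewrite v00 in b3 b4.
  by rewrite ler_norml; apply/andP; split; lra.
have part n : \sum_(i < n) (2^-1) ^+ i * (u 0 i - v0 i) ^+ 2 <= eta ^+ 2.
  apply: (le_trans (partial_le_norm_w d0B n)).
  by apply: lerXn2r => //; rewrite nnegrE; [exact: sqrtr_ge0|exact: ltW].
have u00 : u 0 0%N <= v0 0%N + 1.
  have := part 1%N; rewrite big_ord_recl big_ord0 expr0 mul1r addr0 => h.
  have h2 : (u 0 0%N - v0 0%N) ^+ 2 <= 1 ^+ 2 by rewrite expr1n; lra.
  have : `|u 0 0%N - v0 0%N| <= 1.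
    by rewrite -(@ler_pXn2r _ 2)// ?nnegrE// real_normK// num_real.
  by rewrite ler_norml => /andP[_]; lra.
have uB' s i : 0 <= s <= T -> 0 <= u s i <= B.
  by move=> sT; have /andP[-> h] := uB s i sT; apply: (le_trans h); rewrite /B; lra.
have vB' s i : 0 <= s <= T -> 0 <= v s i <= B.
  by move=> sT; have /andP[-> h] := vB s i sT; apply: (le_trans h); rewrite /B; lra.
have W0 : wdist2 I (x 0) (v 0) <= eta ^+ 2.
  apply: le_trans (part I.+1); rewrite big_ord_recl /= v00 /wdist2.
  under [leLHS]eq_bigr do rewrite x0.
  by rewrite lerDr mulr_ge0 ?sqr_ge0.
have v01 s : 0 <= s <= T -> v s 0%N = v s 1%N + 1.
  by move=> /andP[s0 _]; exact: (fluid01 fl).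
have vL' s r i : 0 <= s -> s <= r -> r <= T -> `|v r i - v s i| <= L * (r - s).
  move=> s0 sr _; apply: (le_trans (vL i r s (le_trans s0 sr) s0)).
  by rewrite ger0_norm// subr_ge0.
have G := wdist2_gronwall lam01 p01 T0 uB' vB' u01 v01 (ltW eta0) ux xL vL' xD Zn vD tT.
have dB i : `|u t i - v t i| <= B.
  have /andP[? ?] := uB' t i tT; have /andP[? ?] := vB' t i tT.
  by rewrite ler_norml; apply/andP; split; lra.
apply: (norm_w_le dB (ltW g0)) => n.
apply: (le_trans (partial_tail_le n I0 _ dB)); first by rewrite u01// v01//; ring.
have S : \sum_(i < I) 2^-1 ^+ i.+1 * (u t i.+1 - v t i.+1) ^+ 2 <=
    2 * wdist2 I (x t) (v t) + 2 * eta ^+ 2.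
  apply: (@le_trans _ _ (\sum_(i < I) (2 * (2^-1 ^+ i.+1 * (x t i.+1 - v t i.+1) ^+ 2) +
                                  2 * eta ^+ 2 * 2^-1 ^+ i.+1))).
    apply: ler_sum => i _.
    rewrite (_ : _ + _ = 2^-1 ^+ i.+1 * (2 * (x t i.+1 - v t i.+1) ^+ 2 + 2 * eta ^+ 2)); last by ring.
    apply: ler_wpM2l; first by rewrite exprn_ge0.
    have : (u t i.+1 - x t i.+1) ^+ 2 <= eta ^+ 2.
      rewrite -(real_normK (num_real (u t _ - _))); apply: lerXn2r; rewrite ?nnegrE ?(ltW eta0)//.
      exact: ux.
    have := sqr_ge0 ((u t i.+1 - x t i.+1) - (x t i.+1 - v t i.+1)).
    nra.
  rewrite big_split/= -!mulr_sumr lerD2l; apply: ler_piMr.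
    by rewrite mulr_ge0 ?sqr_ge0.
  exact: sum_half_powers_le1.
have wI : 0 <= (2^-1 : R) ^+ I by rewrite exprn_ge0.
have B20 : 0 <= 2^-1 ^+ I * B ^+ 2 by rewrite mulr_ge0 ?sqr_ge0.
have G' : wdist2 I (x t) (v t) <= (eta + (13 * eta + 2^-1 ^+ I * B ^+ 2) * T) * e15.
  apply: (le_trans G); apply: ler_wpM2r => //; apply: lerD; first exact: le_trans eta2.
  by apply: ler_wpM2r => //; rewrite lerD2r; lra.
have IC' : (2^-1 ^+ I * B ^+ 2) * (6 * T * e15 + 1) <= gamma ^+ 2 / 2 by rewrite -mulrA.
move: S G' IC' etaC; rewrite /C1; set b := 2^-1 ^+ I * B ^+ 2 => S G' IC' etaC.
apply: (@le_trans _ _ (6 * ((eta + (13 * eta + b) * T) * e15) + 6 * eta + b)); first by lra.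
apply: (@le_trans _ _ (gamma ^+ 2 / 2 + gamma ^+ 2 / 2)); last by lra.
apply: le_trans (lerD etaC IC').
by rewrite le_eqVlt; apply/orP; left; apply/eqP; ring.
Qed.

(** * Measurability of the deviation event *)

Section EventCount.
Variables (R : realType) (lam p : R) (N : nat) (E : clock N -> nat -> R).
Variables (U : nat -> R) (q : 'I_N -> nat).

Let tau k := event_time lam p E U q k.
Let nev t := n_events lam p E U q t.

Let valid t k := (forall j, (j < k)%N -> (tau j <= t%:E)%E) /\ (t%:E < tau k)%E.

Let valid_inj t j k : valid t j -> valid t k -> j = k.
Proof.
move=> [h1 h2] [h3 h4]; case: (ltngtP j k) => // jk.
  by have := h3 _ jk; rewrite leNgt h2.
by have := h1 _ jk; rewrite leNgt h4.
Qed.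

Let nevE t k : valid t k -> nev t = k.
Proof.
by move=> vk; apply: (@valid_inj t) => //; apply: (@xgetPex _ 0%N); exists k.
Qed.

Let nev0 t : (forall k, (tau k <= t%:E)%E) -> nev t = 0%N.
Proof.
move=> h; rewrite /nev /n_events; case: xgetP => // k -> [_].
by rewrite ltNge h.
Qed.

Let dichotomy t : (exists k, valid t k) \/ (forall k, (tau k <= t%:E)%E).
Proof.
have [h|h] := pselect (exists k, (t%:E < tau k)%E); last first.
  by right => k; rewrite leNgt; apply/negP => tk; apply: h; exists k.
left; pose P k := (t%:E < tau k)%E.
have hP : exists k, P k by exact: h.
exists (ex_minn hP); case: ex_minnP => k Pk kmin; split => // j jk.
by rewrite leNgt; apply/negP => tj; have := kmin j tj; rewrite leqNgt jk.
Qed.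

(** The value 0 has two causes: no event has occurred yet, or infinitely many have occurred by [t]
    and [xget] returns its default. *)
Lemma n_events_eq t m : (nev t = m) <->
  (if m is _.+1 then valid t m else (t%:E < tau 0)%E \/ forall k, (tau k <= t%:E)%E).
Proof.
split; last first.
  case: m => [[h|]|m]; [|exact: nev0|exact: nevE].
  by apply: nevE; split.
move=> <-; have [[k vk]|h] := dichotomy t; last by rewrite nev0//; right.
by rewrite (nevE vk); case: k vk => // [[_ h]]; left.
Qed.

(** A valid index remains valid until the next event. On an explosive sample point the default value
    of [n_events] persists at all later times. *)
Lemma Q_right_constant t : exists2 del, 0 < del &
  forall s, t <= s -> s < t + del -> Q lam p E U q s = Q lam p E U q t.
Proof.
have [[k vk]|h] := dichotomy t; last first.
  exists 1 => // s ts _; rewrite /Q -/(nev s) -/(nev t) !nev0// => k.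
  by apply: (le_trans (h k)); rewrite lee_fin.
have [del del0 Hdel] : exists2 del : R, 0 < del &
    forall s, s < t + del -> (s%:E < tau k)%E.
  case: vk => _; case: (tau k) => [r| |]//; last by exists 1 => // s _; rewrite ltry.
  by rewrite lte_fin => tr; exists (r - t); [rewrite subr_gt0|
    move=> s; rewrite addrC subrK lte_fin].
exists del => // s ts sd; rewrite /Q -/(nev s) -/(nev t) (nevE vk) (@nevE s k)//.
split; last exact: Hdel.
by move=> j jk; apply: (le_trans (vk.1 j jk)); rewrite lee_fin.
Qed.

End EventCount.

Section TargetMeasurability.
Context d (Om : measurableType d) (R : realType).
Variables (lam p : R) (N : nat) (E : Om -> clock N -> nat -> R) (U : Om -> nat -> R).
Variable q : Om -> 'I_N -> nat.
Hypothesis mE : forall c k, measurable_fun setT (fun w => E w c k).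
Hypothesis mU : forall k, measurable_fun setT (fun w => U w k).
Hypothesis mq : dmeas q.

Let mth c k : measurable_fun setT (fun w => tick lam p (E w) c k).
Proof. exact: measurable_tick. Qed.

Lemma dmeas_Q t : dmeas (fun w => Q lam p (E w) (U w) (q w) t).
Proof.
have mtau k : measurable [set w | (event_time lam p (E w) (U w) (q w) k <= t%:E)%E].
  have := dmeas_bool (measurable_gtime_le mth mU mq k t) true.
  by congr measurable; apply/funext => w /=; rewrite event_timeE; apply/propext.
have mtauC k : measurable [set w | (t%:E < event_time lam p (E w) (U w) (q w) k)%E].
  rewrite (_ : [set w | _] = ~` [set w | (event_time lam p (E w) (U w) (q w) k <= t%:E)%E]).
    exact: measurableC.
  by apply/seteqP; split => w /=; [move=> h; rewrite leNgt h|move/negP; rewrite -ltNge].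
have mn : dmeas (fun w => n_events lam p (E w) (U w) (q w) t).
  move=> m.
  rewrite (_ : _ @^-1` _ = [set w | if m is _.+1 then
     (forall j, (j < m)%N -> (event_time lam p (E w) (U w) (q w) j <= t%:E)%E) /\
     (t%:E < event_time lam p (E w) (U w) (q w) m)%E
   else (t%:E < event_time lam p (E w) (U w) (q w) 0)%E \/
     forall k, (event_time lam p (E w) (U w) (q w) k <= t%:E)%E]); last first.
    by apply/funext => w; apply/propext; exact: n_events_eq.
  case: m => [|m].
    apply: measurableU; first exact: mtauC.
    rewrite (_ : (fun _ => _) = \bigcap_k
       [set w | (event_time lam p (E w) (U w) (q w) k <= t%:E)%E]).
      exact: bigcapT_measurable.
    by apply/seteqP; split => w h k; [move=> _; exact: h|exact: (h k I)].
  apply: measurableI; last exact: mtauC.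
  rewrite (_ : (fun _ => _) = \bigcap_(k in [set k | (k < m.+1)%N])
     [set w | (event_time lam p (E w) (U w) (q w) k <= t%:E)%E]).
    by apply: bigcap_measurable => //; exists 0%N.
  by apply/seteqP; split => w h k //; exact: h.
apply: (dmeas_piecewise (F := fun m w => (event_state lam p (E w) (U w) (q w) m).2) _ mn).
  exact: countableP.
move=> m; under eq_fun do rewrite event_stateE.
apply: (dmeas_comp (fun st : sys_state N => st.2) (@countable_sys_state N)).
exact: dmeas_gstate.
Qed.

Lemma measurable_Q_event t (A : set ('I_N -> nat)) :
  measurable [set w | A (Q lam p (E w) (U w) (q w) t)].
Proof. by apply: (dmeas_preimage A _ (dmeas_Q t)); exact: countable_fun_nat. Qed.

Variables (T gamma : R) (v0 : nat -> R) (v : R -> nat -> R).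
Hypothesis T0 : 0 <= T.
Hypothesis g0 : 0 < gamma.
Hypothesis fl : fluid_solution lam p v0 v.

Let dist (q : 'I_N -> nat) t := norm_w (fun i => V_of R q i - v t i).

Let diff_le (q' : 'I_N -> nat) t i : 0 <= t -> `|V_of R q' i - v t i| <= V_of R q' 0 + v t 0%N.
Proof.
move=> t0; have := V_of_ge0 R q' i; have := V_of_le0 R q' i.
have := fluid_ge0 fl i t0; have := fluid_le0 fl i t0 => ? ? ? ?.
by rewrite ler_norml; apply/andP; split; lra.
Qed.

(** If the norm exceeds [gamma], some partial sum of its square already exceeds [gamma ^ 2], and a
    partial sum varies continuously in time. *)
Let dist_open (q' : 'I_N -> nat) t : 0 <= t -> gamma < dist q' t ->
  exists2 del, 0 < del & forall s, t <= s -> s < t + del -> gamma < dist q' s.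
Proof.
move=> t0 gt.
have [n Hn] : exists n, gamma ^+ 2 < \sum_(i < n) (2^-1) ^+ i * (V_of R q' i - v t i) ^+ 2.
  apply: contrapT => h; move: gt; rewrite ltNge => /negP; apply.
  apply: (norm_w_le (fun i => diff_le q' i t0) (ltW g0)) => n.
  by rewrite leNgt; apply/negP => hn; apply: h; exists n.
have [L L0 HL] := fluid_lip fl.
(* A Lipschitz constant of the partial sum on a unit time interval, from the difference of squares
   in each of the [n] terms; the added 1 keeps it positive. *)
pose K := n%:R * (L * (2 * V_of R q' 0 + 2 * (v t 0%N + L))) + 1.
have vt0 := fluid_ge0 fl 0 t0; have V0 := V_of_ge0 R q' 0.
have K0 : 0 < K.
  by apply: ltr_wpDl => //; rewrite !mulr_ge0// !addr_ge0// mulr_ge0// addr_ge0.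
set S := \sum_(i < n) _ in Hn.
pose del := Num.min 1 ((S - gamma ^+ 2) / K).
have del0 : 0 < del by rewrite lt_min ltr01 divr_gt0// subr_gt0.
exists del => // s ts sd.
have s0 : 0 <= s by exact: le_trans ts.
have st1 : s - t < 1 by apply: (@lt_le_trans _ _ del); [lra|rewrite ge_min lexx].
have stS : (s - t) * K < S - gamma ^+ 2.
  rewrite -ltr_pdivlMr//; apply: (@lt_le_trans _ _ del); first lra.
  by rewrite ge_min lexx orbT.
pose S' := \sum_(i < n) (2^-1) ^+ i * (V_of R q' i - v s i) ^+ 2.
have vs0 : v s 0%N <= v t 0%N + L.
  rewrite -lerBlDl; apply: (le_trans (ler_norm _)); apply: (le_trans (HL _ _ _ s0 t0)).
  by rewrite ger0_norm ?subr_ge0//; apply: ler_piMr => //; exact: ltW.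
have SS' : S - S' <= (s - t) * K.
  rewrite /S /S' -sumrB; apply: (@le_trans _ _ (\sum_(i < n)
     ((s - t) * (L * (2 * V_of R q' 0 + 2 * (v t 0%N + L)))))); last first.
    rewrite sumr_const card_ord -[leLHS]mulr_natl /K [leRHS]mulrDr mulr1 [leLHS]mulrCA lerDl subr_ge0//.
  apply: ler_sum => i _; rewrite -mulrBr subr_sqr.
  rewrite (_ : V_of R q' i - v t i - _ = v s i - v t i); last by ring.
  apply: (@le_trans _ _ `|(v s i - v t i) * (V_of R q' i - v t i + (V_of R q' i - v s i))|).
    apply: (le_trans (ler_norm _)); rewrite normrM; apply: ler_piMl => //.
    by rewrite ger0_norm ?exprn_ge0// exprn_ile1// invf_le1// ler1n.
  rewrite normrM mulrA; apply: ler_pM => //.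
    apply: (le_trans (HL _ _ _ s0 t0)).
    by rewrite ger0_norm ?subr_ge0// mulrC.
  apply: (le_trans (ler_normD _ _)).
  have h1 := diff_le q' i t0; have h2 := diff_le q' i s0; lra.
have h : gamma ^+ 2 < S' by lra.
have h2 := partial_le_norm_w (fun i => diff_le q' i s0) n.
have d0 : 0 <= dist q' s by exact: sqrtr_ge0.
rewrite -(@ltr_pXn2r _ 2)// ?nnegrE ?(ltW g0)//.
exact: lt_le_trans h h2.
Qed.

(* Paths are locally constant to the right, on every sample point, so rational
   times and the endpoint [T] suffice. *)
Lemma measurable_target :
  measurable [set w | exists t : R, 0 <= t <= T /\
    gamma < norm_w (fun i => V_of R (Q lam p (E w) (U w) (q w) t) i - v t i)].
Proof.
pose A t := [set w | gamma < dist (Q lam p (E w) (U w) (q w) t) t].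
have mA t : measurable (A t).
  exact: (measurable_Q_event t [set q' | gamma < dist q' t]).
rewrite (_ : [set w | _] = A T `|`
   \bigcup_(r : rat) (if 0 <= (ratr r : R) <= T then A (ratr r) else set0)).
  apply: measurableU => //; apply: bigcupT_measurable_rat => r.
  by case: ifP => // _; exact: measurable0.
apply/seteqP; split => w; last first.
  case=> [h|[r _]]; first by exists T; rewrite T0 lexx.
  by case: ifP => // rT h; exists (ratr r).
move=> [t [/andP[t0 tT] h]]; have [tT'|Tt] := ltP t T; last first.
  by left; rewrite /A /= (_ : T = t)//; apply/eqP; rewrite eq_le Tt tT.
right.
have [d1 d10 H1] := Q_right_constant lam p (E w) (U w) (q w) t.
have [d2 d20 H2] := dist_open t0 h.
have tm : t < Num.min T (Num.min (t + d1) (t + d2)).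
  by rewrite !lt_min tT' !ltrDl d10 d20.
have [r] := rat_in_itvoo tm; rewrite in_itv/= => /andP[tr].
rewrite !lt_min => /and3P[rT r1 r2].
exists r => //; rewrite (le_trans t0 (ltW tr)) (ltW rT) /= /A /= H1//; last exact: ltW.
by apply: H2 => //; exact: ltW.
Qed.

End TargetMeasurability.

(** * The fluid limit *)

Lemma compensated0 (R : realType) (lam p : R) N (E : clock N -> nat -> R) U q n i :
  (forall c k, 0 < E c k) -> compensated lam p E U q n 0 i = V_of R q i.
Proof.
move=> Epos; rewrite /compensated big1 ?mul0r ?addr0// => k _.
have th0 c : (0 <= tick lam p E c 0)%E by apply: tick_ge0 => ? ?; exact: ltW.
have thS c j : (tick lam p E c j <= tick lam p E c j.+1)%E.
  by apply: tickS => ? ?; exact: ltW.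
have rt0 j : rtime (tick lam p E) U q j 0 = 0.
  by apply/eqP; rewrite eq_le rtime_le ?rtime_ge0.
by rewrite /dtime !rt0 subrr mulr0.
Qed.

Section PathwiseLimit.
Variables (R : realType) (lam p T gamma : R) (v0 : nat -> R) (v : R -> nat -> R).
Hypothesis lam01 : 0 <= lam <= 1.
Hypothesis p01 : 0 <= p <= 1.
Hypothesis T0 : 0 < T.
Hypothesis gamma0 : 0 < gamma.
Hypothesis fl : fluid_solution lam p v0 v.

(* Index 0 is the number of events, which controls explosion and oscillation. *)
Definition observable N (i : nat) : sys_state N -> clock N -> R :=
  if i is 0%N then fun _ _ => 1 else jump R i.

(** All randomness is reduced to finitely many martingale values on a time grid, with constants that
    do not depend on [N]. *)
Lemma fluid_limit_pathwise : exists (I K mm : nat) (eta alpha : R),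
  [/\ 0 < eta, 0 < alpha & forall N (E : clock N -> nat -> R) U q, (0 < N)%N ->
   (forall c k, 0 < E c k) ->
   (forall i j, (i <= I)%N -> (j <= K.+1)%N ->
     `|mart lam p (observable i) (tick lam p E) U q (N * mm) (T * (j%:R / K.+1%:R))| <
        N%:R * alpha) ->
   norm_w (fun i => V_of R (Q lam p E U q 0) i - v0 i) <= eta ->
   forall t, 0 <= t <= T ->
     norm_w (fun i => V_of R (Q lam p E U q t) i - v t i) <= gamma].
Proof.
have /andP[lam0 lam1] := lam01.
(* The total rate is at most [2 * N], so [2 * T * N] bounds the compensator of the event count; the
   extra [N] leaves room for the counting martingale, which stays below [N] since [alpha <= 1]. *)
pose mm := (Num.truncn (2 * T + 1)).+1.
have mmT : 2 * T + 1 < mm%:R by exact: truncnS_gt.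
have [I [eta [eta0 close]]] :=
  fluid_close (lam + 1) lam01 p01 (ltW T0) (ler0n R mm) gamma0 fl.
(* Grid cells shorter than [eta / 8], together with [alpha <= eta / 6], make the bound of
   [mart_between] over [N] at most [3 * (eta / 6) + 4 * (eta / 8) = eta]. *)
pose K := Num.truncn (8 * T / eta).
have KT : 8 * T / eta < K.+1%:R by exact: truncnS_gt.
pose alpha := Num.min 1 (eta / 6).
have alpha0 : 0 < alpha by rewrite lt_min ltr01 divr_gt0.
have alpha1 : alpha <= 1 by rewrite ge_min lexx.
have alphae : alpha <= eta / 6 by rewrite ge_min lexx orbT.
exists I, K, mm, eta, alpha; split=> // N E U q N0 Epos good init.
have NR : 0 < N%:R :> R by rewrite ltr0n.
have K0 : 0 < K.+1%:R :> R by rewrite ltr0n.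
pose n := (N * mm).-1.
have nE : n.+1 = (N * mm)%N by rewrite prednK// muln_gt0 N0.
have tn : (T%:E < gtime (tick lam p E) U q n)%E.
  apply: (@no_explosion _ _ _ _ _ _ _ lam0 p01 Epos _ _ N%:R); first exact: ltW.
    rewrite nE natrM total_rateE// -mulrA -mulrBr -[leLHS]mulr1 ler_pM2l//.
    have : (lam + 1) * T <= 2 * T by rewrite ler_pM2r//; lra.
    by move: mmT; lra.
  have := good 0%N K.+1 (leq0n _) (leqnn _).
  rewrite divff ?gt_eqF// mulr1 nE => /lt_le_trans; apply.
  by rewrite -[leRHS]mulr1 ler_pM2l.
have gn t : t <= T -> (t%:E < gtime (tick lam p E) U q n)%E.
  by move=> tT; apply: le_lt_trans tn; rewrite lee_fin.
have Q00 : Q lam p E U q 0 = q.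
  by apply: (Q_at Epos (m := 0%N)) => //; exact: gtime0_gt0.
apply: (close (fun t => V_of R (Q lam p E U q t)) (fun t => compensated lam p E U q n.+1 t)).
- move=> t i /andP[t0 tT]; rewrite V_of_ge0 /= Q00.
  have := V_of_Q_le N0 Epos t0 (gn t tT) i.
  by rewrite nE natrM [_ * _ / _]mulrAC divff ?gt_eqF// mul1r.
- by move=> t _; exact: V_of01.
- move=> t i /andP[t0 tT] iI.
  rewrite (V_of_Q N0 Epos t0 (gn t tT))// addrC addKr.
  rewrite normrM [`|_^-1|]gtr0_norm ?invr_gt0// ler_pdivrMr//.
  pose tt j : R := T * (j%:R / K.+1%:R).
  have [j [jK s1 s2 s3]] : exists j, [/\ (j <= K.+1)%N, tt j <= t,
      t <= tt (minn j.+1 K.+1) & tt (minn j.+1 K.+1) - tt j <= T / K.+1%:R].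
    have tK : 0 <= t / T * K.+1%:R by rewrite !mulr_ge0// invr_ge0 ltW.
    (* At [t = T] this is [K.+1], which is why the right end of the cell is clipped by [minn]. *)
    pose j := Num.truncn (t / T * K.+1%:R).
    have j1 : j%:R <= t / T * K.+1%:R by rewrite truncn_le.
    have j2 : t / T * K.+1%:R < j.+1%:R by exact: truncnS_gt.
    have jK : (j <= K.+1)%N.
      rewrite -(ler_nat R); apply: (le_trans j1); rewrite ler_piMl//.
      by rewrite ler_pdivrMr// mul1r.
    exists j; split => //.
    + by rewrite /tt mulrC -ler_pdivlMr// ler_pdivrMr.
    + rewrite /tt mulrC -ler_pdivrMr// ler_pdivlMr//.
      case: (leqP j.+1 K.+1) => h; first by exact: ltW.
      by rewrite ler_piMl// ler_pdivrMr// mul1r.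
    + rewrite /tt -mulrBr -mulrBl ler_pM2l// ler_piMl ?invr_ge0//.
      have : (minn j.+1 K.+1)%:R <= j.+1%:R :> R by rewrite ler_nat geq_minl.
      by rewrite -natr1; lra.
  have jK' : (minn j.+1 K.+1 <= K.+1)%N by exact: geq_minr.
  have b0 : 0 <= tt j by rewrite mulr_ge0 ?(ltW T0)// divr_ge0.
  apply: (@le_trans _ _ (3 * (N%:R * alpha) + 2 * (total_rate lam p N * (T / K.+1%:R)))).
    apply: (le_trans (mart_between lam0 p01 Epos b0 s1 s2 (@jump_le1 R N i.+1)
       (a := N%:R * alpha) _ _ _)).
    + by have := ltW (good i.+1 j iI jK); rewrite nE.
    + by have := ltW (good 0%N j (leq0n _) jK); rewrite nE.
    + by have := ltW (good 0%N _ (leq0n _) jK'); rewrite nE.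
    + by rewrite lerD2l ler_pM2l// ler_wpM2l// total_rateE// mulr_ge0// addr_ge0.
  rewrite total_rateE// -mulrA.
  rewrite (_ : _ + _ = N%:R * (3 * alpha + 2 * ((lam + 1) * (T / K.+1%:R)))); last by ring.
  rewrite mulrC ler_pM2r//.
  have h1 : (lam + 1) * (T / K.+1%:R) <= 2 * (T / K.+1%:R).
    by rewrite ler_pM2r ?divr_gt0//; lra.
  have h2 : T / K.+1%:R <= eta / 8.
    by move: KT; rewrite ltr_pdivrMr// ler_pdivrMr// => ?; lra.
  apply: (@le_trans _ _ (3 * (eta / 6) + 2 * (2 * (eta / 8)))); last by lra.
  by rewrite lerD// ler_pM2l//; apply: (le_trans h1); rewrite ler_pM2l.
- by move=> s t i s0 st _; exact: compensated_lip.
- move=> t i t0 tT; have [del del0 H] :=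
    compensated_slope N0 Epos t0 (gn t (ltW tT)) (ltn0Sn i).
  by exists del => // s ts sd _; exact: H.
- by move=> i; rewrite compensated0// Q00.
- exact: init.
Qed.

End PathwiseLimit.

(** * Modification of the inputs on a null set and the union bound *)

Section PositiveInputs.
Context d (Om : measurableType d) (R : realType) (P : probability Om R).
Variables (N : nat) (Q0 : Om -> 'I_N -> nat).
Variables (E : clock N -> nat -> Om -> R) (U : nat -> Om -> R).
Hypothesis inp : system_inputs P Q0 E U.

Let pos (x : R) : R := if 0 < x then x else 1.

Let measurable_pos : measurable_fun setT pos.
Proof. by apply: measurable_fun_ifT => //; exact: measurable_fun_ltr. Qed.

(* Changing the inputs on a null set makes tick times strictly increasing on
   every sample point. *)
Definition positive_input c k w : R := pos (E c k w).

Lemma positive_input_gt0 c k w : 0 < positive_input c k w.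
Proof. by rewrite /positive_input /pos; case: ifP. Qed.

Definition nonpositive_inputs := [set w | exists c k, E c k w <= 0].

Lemma positive_inputE w c k : ~ nonpositive_inputs w -> positive_input c k w = E c k w.
Proof.
move=> h; rewrite /positive_input /pos; case: ltP => // h0.
by exfalso; apply: h; exists c, k.
Qed.

Let mE c k : measurable_fun setT (E c k).
Proof. by have [_ [/(_ c k)[]]] := inp. Qed.

Lemma exponential_prob_le0 : exponential_prob 1 `]-oo, 0 : R] = 0%E.
Proof.
rewrite /exponential_prob -integral_itv_bndo_bndc.
  by apply: integral0_eq => x; rewrite /= in_itv/= => x0; rewrite lt0_exponential_pdf.
by apply: measurable_funTS; apply/measurable_EFinP; exact: measurable_exponential_pdf.
Qed.

Lemma measurable_null_nonpositive_inputs :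
  measurable nonpositive_inputs /\ P nonpositive_inputs = 0%E.
Proof.
pose F n := if @unpickle (clock N * nat)%type n is Some ck then
  [set w | E ck.1 ck.2 w <= 0] else set0.
have mF n : measurable (F n).
  rewrite /F; case: unpickle => // ck.
  rewrite (_ : [set w | _] = E ck.1 ck.2 @^-1` `]-oo, 0]); last first.
    by apply/seteqP; split=> w /=; rewrite in_itv.
  by rewrite -[X in measurable X]setTI; exact: mE.
have FE : nonpositive_inputs = \bigcup_n F n.
  apply/seteqP; split=> [w [c [k Ew]]|w [n _]].
    by exists (pickle (c, k)); [exact: I|rewrite /F pickleK; exact: Ew].
  by rewrite /F; case: unpickle => // -[c k] Ew; exists c, k.
have mZ : measurable nonpositive_inputs by rewrite FE; exact: bigcupT_measurable.
split => //; apply/(negligibleP P mZ); rewrite FE; apply: negligible_bigcup => n.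
apply/negligibleP => //; rewrite /F; case: unpickle => [[c k]|]; last exact: measure0.
rewrite (_ : [set w | _] = E c k @^-1` `]-oo, 0]); last first.
  by apply/seteqP; split=> w /=; rewrite in_itv.
by have [_ [/(_ c k)[_ h] _]] := inp; rewrite -exponential_prob_le0; exact: h.
Qed.

Lemma le_probability_off_null (A B Z : set Om) : measurable A -> measurable B ->
  measurable Z -> P Z = 0%E -> A `<=` B `|` Z -> (P A <= P B)%E.
Proof.
move=> mA mB mZ Z0 AB; apply: (@le_trans _ _ (P (B `|` Z))).
  by apply: le_measure; rewrite ?inE//; exact: measurableU.
by apply: (le_trans (measureU2 P mB mZ)); rewrite [X in (_ + X)%E](_ : _ = 0%E)// adde0.
Qed.

(** The laws are unchanged because the modification concerns a null set, and independence survives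
    because each new input is a measurable function of the old one. *)
Lemma system_inputs_positive_input : system_inputs P Q0 positive_input U.
Proof.
have [mQ [EP [UP ind]]] := inp.
have mEp c k : measurable_fun setT (positive_input c k).
  exact: (measurableT_comp measurable_pos (mE c k)).
split => //; split; [|split => //].
  move=> c k; split => // A mA; rewrite -(EP c k).2//.
  have m1 : measurable (positive_input c k @^-1` A) by rewrite -[X in measurable X]setTI; exact: mEp.
  have m2 : measurable (E c k @^-1` A) by rewrite -[X in measurable X]setTI; exact: mE.
  have [mZ Z0] := measurable_null_nonpositive_inputs.
  apply/eqP; rewrite eq_le; apply/andP; split;
    apply: (le_probability_off_null _ _ mZ Z0) => // w /= Aw;
    by have [h|h] := pselect (nonpositive_inputs w); [right|left; move: Aw; rewrite /= positive_inputE].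
move=> m J A inj FA; apply: (ind m J A inj) => a am.
have := FA a am; case: (J a) => //= c k [B mB <-].
exists (pos @^-1` B) => //=.
by rewrite -[X in measurable X]setTI; exact: measurable_pos.
Qed.

End PositiveInputs.

Section TargetBound.
Context d (Om : measurableType d) (R : realType) (P : probability Om R).
Variables (lam p : R) (N : nat) (Q0 : Om -> 'I_N -> nat).
Variables (E : clock N -> nat -> Om -> R) (U : nat -> Om -> R).
Hypothesis inp : system_inputs P Q0 E U.
Hypothesis rate0 : forall c : clock N, 0 <= rate lam p c.

Let Ep := positive_input E.
Let M i n t w := mart lam p (@observable R N i) (tickw lam p Ep w) (Uw U w) (Q0 w) n t.

Lemma observable_le1 i (st : sys_state N) c : `|@observable R N i st c| <= 1.
Proof. by case: i => [|i] /=; [rewrite normr1|exact: jump_le1]. Qed.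

Let large i t n a := [set w | (a <= `|M i n t w|)%R].

Let measurable_large i t n a : measurable (large i t n a).
Proof.
have [mQ [EP [UP _]]] := system_inputs_positive_input inp.
have mM : measurable_fun setT (M i n t).
  apply: measurable_mart => //; last by move=> k; exact: (UP k).1.
  by move=> c k; apply: measurable_tick => c' k'; exact: (EP c' k').1.
rewrite (_ : large _ _ _ _ = (fun w => `|M i n t w|) @^-1` `[a, +oo[); last first.
  by apply/seteqP; split=> w; rewrite /large /= in_itv/= andbT.
by rewrite -[X in measurable X]setTI; exact: (measurableT_comp (@normr_measurable R setT) mM).
Qed.

Lemma deviation_union_bound I K n (t : nat -> R) a : 0 < a -> (forall j, 0 <= t j) ->
  exists Bad : set Om, [/\ measurable Bad,
    (P Bad <= (I%:R * (K%:R * (6 * n%:R / a ^+ 2)))%:E)%E &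
    forall i j w, (i < I)%N -> (j < K)%N ->
      a <= `|mart lam p (@observable R N i) (tickw lam p (positive_input E) w) (Uw U w)
              (Q0 w) n (t j)| -> Bad w].
Proof.
move=> a0 t0.
pose F i := \big[setU/set0]_(j < K) large i (t j) n a.
have mF i : measurable (F i).
  by apply: bigsetU_measurable => j _; exact: measurable_large.
have bnd i : (P (F i) <= (K%:R * (6 * n%:R / a ^+ 2))%:E)%E.
  apply: (le_trans (@Boole_inequality _ _ _ P (fun j => large i (t j) n a) K
     (fun j _ => measurable_large _ _ _ _))).
  apply: (@le_trans _ _ (\sum_(j < K) (6 * n%:R / a ^+ 2)%:E)%E).
    apply: lee_sum => j _.
    apply: (mart_deviation (system_inputs_positive_input inp)) => //.
      by move=> *; exact: positive_input_gt0.
    exact: observable_le1.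
  by rewrite sumEFin sumr_const card_ord; move: (_ / _) => x; rewrite mulr_natl.
exists (\big[setU/set0]_(i < I) F i); split.
- by apply: bigsetU_measurable => i _; exact: mF.
- apply: (le_trans (@Boole_inequality _ _ _ P F I (fun i _ => mF i))).
  apply: (@le_trans _ _ (\sum_(i < I) (K%:R * (6 * n%:R / a ^+ 2))%:E)%E).
    by apply: lee_sum => i _; exact: bnd.
  by rewrite sumEFin sumr_const card_ord; move: (_ * (_ / _)) => x; rewrite mulr_natl.
- move=> i j w iI jK h; rewrite -(bigcup_mkord I F); exists i => //.
  by rewrite /F -(bigcup_mkord K (fun j => large i (t j) n a)); exists j.
Qed.

End TargetBound.

Theorem theorem4 (R : realType) (lam p T : R)
    (d : nat -> measure_display) (Om : forall N : nat, measurableType (d N))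
    (P : forall N : nat, probability (Om N) R)
    (Q0 : forall N : nat, Om N -> 'I_N -> nat)
    (E : forall N : nat, clock N -> nat -> Om N -> R)
    (U : forall N : nat, nat -> Om N -> R)
    (v0 : nat -> R) (v : R -> nat -> R) :
  0 <= lam < 1 -> 0 <= p <= 1 -> 0 < T ->
  (forall N : nat, (0 < N)%N -> system_inputs (P N) (Q0 N) (E N) (U N)) ->
  in_Vbar v0 ->
  (forall gamma : R, 0 < gamma ->
     (fun N : nat => P N [set w | gamma <
        norm_w (fun i => @V_of R N (Q lam p (fun c k => E N c k w) (fun k => U N k w)
                                 (Q0 N w) 0) i - v0 i)])
     @ \oo --> 0%E) ->
  fluid_solution lam p v0 v ->
  forall gamma : R, 0 < gamma ->
    (fun N : nat => P N [set w | exists t : R, 0 <= t <= T /\ gamma <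
        norm_w (fun i => @V_of R N (Q lam p (fun c k => E N c k w) (fun k => U N k w)
                                 (Q0 N w) t) i - v t i)])
    @ \oo --> 0%E.
Proof.
move=> /andP[lam0 lam1] p01 T0 inp _ init fl gamma gamma0.
have lam01 : 0 <= lam <= 1 by rewrite lam0 ltW.
have [I [K [mm [eta [alpha [eta0 alpha0 path]]]]]] :=
  fluid_limit_pathwise lam01 p01 T0 gamma0 fl.
(* There are [I + 1] observables and [K + 2] grid times, and the Chebyshev bound
   [6 * (N * mm) / (N * alpha) ^ 2] leaves one factor [1 / N]. *)
pose C := I.+1%:R * (K.+2%:R * (6 * mm%:R / alpha ^+ 2)).
set target := fun N : nat => P N _.
pose Init N : set (Om N) := [set w | eta <
    norm_w (fun i => V_of R (Q lam p (fun c k => E N c k w) (fun k => U N k w)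
      (Q0 N w) 0) i - v0 i)].
have bound N : (0 < N)%N -> (target N <= P N (Init N) + (C / N%:R)%:E)%E.
  move=> N0; have NR : 0 < N%:R :> R by rewrite ltr0n.
  have [mQ [EP [UP _]]] := inp N N0.
  have mE c k : measurable_fun setT (fun w => E N c k w) := (EP c k).1.
  have mU k : measurable_fun setT (fun w => U N k w) := (UP k).1.
  have [mZ Z0] := measurable_null_nonpositive_inputs (inp N N0).
  have rate0 (c : clock N) : 0 <= rate lam p c.
    by have /andP[p0 p1] := p01; case: c => [[n|n]|u] //=; rewrite ?subr_ge0// mulr_ge0.
  have grid0 (j : nat) : 0 <= T * (j%:R / K.+1%:R).
    by rewrite mulr_ge0 ?(ltW T0)// divr_ge0.
  have [Bad [mB PB inB]] := deviation_union_bound (inp N N0) rate0 I.+1 K.+2 (N * mm)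
    (mulr_gt0 NR alpha0) grid0.
  have mI : measurable (Init N).
    exact: (@measurable_Q_event _ _ _ lam p N (fun w c k => E N c k w) (fun w k => U N k w)
      (Q0 N) mE mU mQ 0 [set q' | eta < norm_w (fun i => V_of R q' i - v0 i)]).
  apply: (@le_trans _ _ (P N (Init N `|` Bad))).
    apply: (le_probability_off_null _ _ mZ Z0); [|exact: measurableU|].
      exact: (@measurable_target _ _ _ lam p N (fun w c k => E N c k w) (fun w k => U N k w)
        (Q0 N) mE mU mQ T gamma v0 v (ltW T0) gamma0 fl).
    (* Outside a bad start, a large martingale value and the null set, the modified inputs coincide
       with the original ones and the pathwise statement contradicts [far]. *)
    move=> w [t [t0T far]]; apply: contrapT => off.
    have [offI offB offZ] : [/\ ~ Init N w, ~ Bad w & ~ nonpositive_inputs (E N) w].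
      by split=> h; apply: off; [left; left|left; right|right].
    move: far; apply/negP; rewrite -leNgt.
    have EE : (fun c k => positive_input (E N) c k w) = (fun c k => E N c k w).
      by apply/funext => c; apply/funext => k; exact: positive_inputE.
    rewrite -EE; apply: path => //.
    + by move=> c k; exact: positive_input_gt0.
    + move=> i j iI jK; rewrite ltNge; apply/negP => h; apply: offB.
      exact: (inB i j).
    + by rewrite EE leNgt; apply/negP.
  apply: (le_trans (measureU2 (P N) mI mB)); apply: leeD2l.
  apply: (le_trans PB); rewrite lee_fin /C natrM.
  rewrite le_eqVlt; apply/orP; left; apply/eqP; field.
  by rewrite !gt_eqF.
have CN : (fun N : nat => (C / N%:R)%:E) @ \oo --> 0%E.
  apply: cvg_EFin; first exact: nearW.
  apply/cvgrPdist_le => e e0; near=> N.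
  have N0 : 0 < N%:R :> R by rewrite ltr0n; near: N; exact: nbhs_infty_gt.
  have C0 : 0 <= C by rewrite /C !mulr_ge0// invr_ge0 exprn_ge0// ltW.
  rewrite /= sub0r normrN ger0_norm ?divr_ge0//.
  rewrite ler_pdivrMr// mulrC -ler_pdivrMr//; apply: ltW.
  apply: (lt_le_trans (truncnS_gt _)); rewrite ler_nat.
  by near: N; exact: nbhs_infty_ge.
apply: (@squeeze_cvge _ _ _ _ (fun=> 0%E) _ _ _ _ (cvg_cst _)).
  by near=> N; apply/andP; split; [exact: measure_ge0|apply: bound; near: N; exact: nbhs_infty_gt].
by rewrite -[X in _ --> X]adde0; apply: cvgeD => //; exact: init.
Unshelve. all: by end_near.
Qed.
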